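(* If $\Psi\in \mathrm{MAVal}_k(\mathbb{R}^n)$ is $\mathrm{SO}(n)$-equivariant, then $\Psi$ is a multiple of the $k$th Hessian measure, that is, there exists $c\in\mathbb{C}$ such that for $f\in\mathrm{Conv}(\mathbb{R}^n,\mathbb{R})\cap C^2(\mathbb{R}^n)$, \begin{align*} \Psi(f)[B]=c\int_{B}[D^2f(x)]_kd\mathrm{vol}_n(x)\quad\text{for all bounded Borel sets}~B\subset\mathbb{R}^n, \end{align*} where $[D^2f(x)]_k$ denotes the $k$th elementary symmetric polynomial in the eigenvalues of $D^2f(x)$.
   Context: $\mathrm{Conv}(\mathbb{R}^n,\mathbb{R})$ is the space of finite-valued convex functions on $\mathbb{R}^n$ (locally uniform convergence), $\mathcal{M}(\mathbb{R}^n)$ the complex Radon measures (weak*-topology). $\mathrm{MAVal}_k(\mathbb{R}^n)$ is the space of continuous valuations $\Psi:\mathrm{Conv}(\mathbb{R}^n,\mathbb{R})\to\mathcal{M}(\mathbb{R}^n)$ that are dually epi-translation invariant ($\Psi(f+l)=\Psi(f)$ for affine $l$), locally determined, translation equivariant ($\Psi(f(\cdot+x))[B]=\Psi(f)[B+x]$) and $k$-homogeneous. $\Psi$ is $\mathrm{SO}(n)$-equivariant if $\Psi(f\circ g)[g^{-1}B]=\Psi(f)[B]$ for all $g\in\mathrm{SO}(n)$, $f$, and bounded Borel $B$. *)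

(* Defs.v *)
From mathcomp Require Import all_boot all_order all_algebra.
From mathcomp Require Import all_classical all_reals all_analysis.
From mathcomp Require Export complex.
Import Order.TTheory GRing.Theory Num.Theory.
Import numFieldNormedType.Exports.

Set Implicit Arguments.
Unset Strict Implicit.
Unset Printing Implicit Defensive.

Local Open Scope classical_set_scope.
Local Open Scope ring_scope.
Local Open Scope complex_scope.

Section Defs.
Variables (R : realType) (n : nat).

Notation V := 'rV[R]_n.

Definition Rn_borel : Type := g_sigma_algebraType (@open 'rV[R]_n).

Definition borel_set (B : set V) : Prop := measurable (B : set Rn_borel).

Definition bounded_borel (B : set V) : Prop :=
  borel_set B /\ bounded_set B.

Definition convex_fun (f : V -> R) : Prop :=
  forall (x y : V) (t : R), 0 <= t -> t <= 1 ->
    f ((1 - t) *: x + t *: y) <= (1 - t) * f x + t * f y.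

Definition loc_unif_cvg (fs : nat -> V -> R) (f : V -> R) : Prop :=
  forall (r e : R), 0 < e -> exists N : nat, forall j : nat, (N <= j)%N ->
    forall x : V, `|x| <= r -> `|fs j x - f x| <= e.

Definition affine_fun (l : V -> R) : Prop :=
  exists (a : V) (b : R), forall x : V, l x = \sum_(i < n) a ord0 i * x ord0 i + b.

(* A nonnegative Radon measure on R^n: a Borel measure finite on bounded
   Borel sets (equivalently on compact sets). *)
Definition locally_finite (mu : {measure set Rn_borel -> \bar R}) : Prop :=
  forall B : set V, bounded_borel B -> (mu B < +oo)%E.

(* A complex Radon measure is represented by a Jordan-type decomposition
   (mu1 - mu2) + i (mu3 - mu4) into nonnegative Radon measures. *)
Record cradon := CRadon {
  cr1 : {measure set Rn_borel -> \bar R};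
  cr2 : {measure set Rn_borel -> \bar R};
  cr3 : {measure set Rn_borel -> \bar R};
  cr4 : {measure set Rn_borel -> \bar R};
  cr1_lf : locally_finite cr1;
  cr2_lf : locally_finite cr2;
  cr3_lf : locally_finite cr3;
  cr4_lf : locally_finite cr4 }.

(* the value mu[B] (meaningful for bounded Borel sets B) *)
Definition cvalue (m : cradon) (B : set V) : R[i] :=
  (fine (cr1 m B) - fine (cr2 m B))%:C
  + 'i * (fine (cr3 m B) - fine (cr4 m B))%:C.

Definition cpair (m : cradon) (phi : V -> R) : R[i] :=
  (Rintegral (cr1 m) setT phi - Rintegral (cr2 m) setT phi)%:C
  + 'i * (Rintegral (cr3 m) setT phi - Rintegral (cr4 m) setT phi)%:C.

Definition test_fun (phi : V -> R) : Prop :=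
  continuous phi /\ compact (closure [set x | phi x != 0]).

Definition weak_star_cvg (ms : nat -> cradon) (m : cradon) : Prop :=
  forall phi : V -> R, test_fun phi ->
    forall e : R, 0 < e -> exists N : nat, forall j : nat, (N <= j)%N ->
      `|cpair (ms j) phi - cpair m phi| < e%:C.

Definition is_valuation (Psi : (V -> R) -> cradon) : Prop :=
  forall f g : V -> R, convex_fun f -> convex_fun g ->
    convex_fun (fun x => Num.min (f x) (g x)) ->
    forall B : set V, bounded_borel B ->
      cvalue (Psi (fun x => Num.max (f x) (g x))) B
      + cvalue (Psi (fun x => Num.min (f x) (g x))) B
      = cvalue (Psi f) B + cvalue (Psi g) B.

(* continuity (Conv(R^n,R) is metrizable, so sequential continuity suffices) *)
Definition is_continuous_val (Psi : (V -> R) -> cradon) : Prop :=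
  forall (fs : nat -> V -> R) (f : V -> R),
    (forall j, convex_fun (fs j)) -> convex_fun f -> loc_unif_cvg fs f ->
    weak_star_cvg (fun j => Psi (fs j)) (Psi f).

Definition dually_epi_translation_invariant (Psi : (V -> R) -> cradon) : Prop :=
  forall f l : V -> R, convex_fun f -> affine_fun l ->
    forall B : set V, bounded_borel B ->
      cvalue (Psi (fun x => f x + l x)) B = cvalue (Psi f) B.

Definition locally_determined (Psi : (V -> R) -> cradon) : Prop :=
  forall (f g : V -> R) (U : set V), convex_fun f -> convex_fun g -> open U ->
    (forall x, U x -> f x = g x) ->
    forall B : set V, bounded_borel B -> B `<=` U ->
      cvalue (Psi f) B = cvalue (Psi g) B.

Definition translation_equivariant (Psi : (V -> R) -> cradon) : Prop :=
  forall (f : V -> R) (y : V), convex_fun f ->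
    forall B : set V, bounded_borel B ->
      cvalue (Psi (fun x => f (x + y))) B = cvalue (Psi f) [set b + y | b in B].

Definition homogeneous (k : nat) (Psi : (V -> R) -> cradon) : Prop :=
  forall (f : V -> R) (t : R), convex_fun f -> 0 < t ->
    forall B : set V, bounded_borel B ->
      cvalue (Psi (fun x => t * f x)) B = (t ^+ k)%:C * cvalue (Psi f) B.

Definition MAVal (k : nat) (Psi : (V -> R) -> cradon) : Prop :=
  is_valuation Psi /\ is_continuous_val Psi /\
  dually_epi_translation_invariant Psi /\ locally_determined Psi /\
  translation_equivariant Psi /\ homogeneous k Psi.

Definition special_orthogonal (g : 'M[R]_n) : Prop :=
  g *m g^T = 1%:M /\ \det g = 1.

Definition SO_equivariant (Psi : (V -> R) -> cradon) : Prop :=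
  forall g : 'M[R]_n, special_orthogonal g ->
    forall f : V -> R, convex_fun f ->
      forall B : set V, bounded_borel B ->
        cvalue (Psi (fun x => f (x *m g))) [set x | B (x *m g)]
        = cvalue (Psi f) B.

Definition unitv (i : 'I_n) : V := delta_mx ord0 i.

Definition partial (i : 'I_n) (f : V -> R) : V -> R := fun x => 'D_(unitv i) f x.

Definition C2 (f : V -> R) : Prop :=
  forall i j : 'I_n,
    (forall x, derivable f x (unitv i)) /\ continuous (partial i f) /\
    (forall x, derivable (partial i f) x (unitv j)) /\
    continuous (partial j (partial i f)).

Definition hessian (f : V -> R) (x : V) : 'M[R]_n :=
  \matrix_(i, j) partial j (partial i f) x.

Definition esym (k : nat) (lam : 'I_n -> R) : R :=
  \sum_(I : {set 'I_n} | #|I| == k) \prod_(i in I) lam i.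

Definition eigenvalues_of (A : 'M[R]_n) (lam : 'I_n -> R) : Prop :=
  char_poly A = \prod_(i < n) ('X - (lam i)%:P).

(* [A]_k : the k-th elementary symmetric polynomial in the eigenvalues of A
   (A real symmetric, so such real eigenvalues exist; the value does not depend
   on the enumeration chosen). *)
Definition sigma_k (k : nat) (A : 'M[R]_n) : R :=
  match pselect (exists lam, eigenvalues_of A lam) with
  | left e => esym k (projT1 (cid e))
  | right _ => 0
  end.

Definition box (a b : V) : set V := [set x | forall i, a ord0 i <= x ord0 i <= b ord0 i].

Definition is_lebesgue_n (mu : {measure set Rn_borel -> \bar R}) : Prop :=
  forall a b : V, (forall i, a ord0 i <= b ord0 i) ->
    mu (box a b) = (\prod_(i < n) (b ord0 i - a ord0 i))%:E.

End Defs.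

(* Main.v *)
Require Import Defs.
From HB Require Import structures.
From mathcomp Require Import all_boot all_order fingroup perm all_algebra.
From mathcomp Require Import all_classical all_reals all_analysis.
From mathcomp Require Import measurable_realfun complex.
From mathcomp Require Import ring lra.
Import Order.TTheory GRing.Theory Num.Theory.
Import numFieldNormedType.Exports HBNNSimple.

Set Implicit Arguments.
Unset Strict Implicit.
Unset Printing Implicit Defensive.

Local Open Scope classical_set_scope.
Local Open Scope ring_scope.

(** The real and imaginary parts of Psi are treated separately.

    Since max(0, <u,x> - c) is affine on either side of a hyperplane, the valuation property,
    affine invariance and continuity make Psi(f + t max(0, <u,x> - c)) affine in t >= 0. Writing
    <u,x>^2 as a limit of sums of such hinge functions, Psi(f + t <u,x>^2) is affine in t as well.
    Hence Psi(sum_i lam_i <u_i,x>^2) is multi-affine and k-homogeneous in lam; it is a multiple of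
    Lebesgue measure by translation equivariance, and SO(n)-equivariance makes the factor
    independent of the orthonormal frame and symmetric in lam, i.e. a constant times e_k(lam).

    The values of Psi on small cubes of side r are O(r^n), uniformly over convex functions whose
    perturbation of a fixed multiple of |x|^2 is controlled at scale r (gliding hump: functions
    violating this could be packed into disjoint cells of one convex function, whose measure would
    not be locally finite). On a cube of side r, a convex C^2 function plus delta |x|^2 is, up to
    an affine function, a quadratic form plus eps times such a controlled function, with eps -> 0 as
    r -> 0. Expanding Psi in eps, its value on the cube is c [D^2 f]_k r^n + (o(1) + O(delta)) r^n.
    Summing over dyadic grids and letting r, then delta, tend to 0 identifies Psi(f) on dyadic
    boxes, hence on all bounded Borel sets. *)

(** Continuity of Psi is only weak*, so values on a fixed set do not pass to limits. Identities
    between values on all bounded Borel sets are therefore moved to pairings with test functions,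
    taken to the limit there, and brought back on half-open boxes. A limit needed on one fixed box
    is obtained instead from polynomial dependence on a parameter. Psi is not additive in f, so
    closeness of f to its Taylor polynomial says nothing by itself. The substitute is an expansion
    in eps whose coefficients are fixed linear combinations of finitely many values of Psi; an a
    priori bound on these values controls every coefficient. That bound, of order r^n, cannot come
    from scaling, since dilations of x are not among the symmetries of Psi; it is extracted from the
    finiteness of one measure on one bounded set. The summand delta |x|^2 answers to degenerate
    Hessians: making the Taylor remainder convex costs eps times a fixed multiple of |x|^2, which is
    subtracted from the quadratic part and must leave its coefficients nonnegative. *)

(** * Spectral theorem for real symmetric matrices *)

Section RealSpectral.
Variable R : realType.
Local Open Scope complex_scope.

Lemma mulmx_tr_eq0 n (v : 'rV[R]_n) : v *m v^T = 0 -> v = 0.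
Proof.
move=> /(congr1 (fun M : 'M[R]_(_, _) => M ord0 ord0)); rewrite [LHS]mxE [RHS]mxE => /eqP.
rewrite psumr_eq0; last by move=> i _; rewrite [v^T _ _]mxE -expr2 sqr_ge0.
move=> /allP h; apply/rowP => i; rewrite mxE.
by have := h i (mem_index_enum i) => /=; rewrite mxE -expr2 sqrf_eq0 => /eqP.
Qed.

(** Take a complex eigenvector p + i q with eigenvalue al + i be. Computing p A q^T in two ways by
    symmetry gives be (|p|^2 + |q|^2) = 0, so be = 0, and whichever of p, q is nonzero is a real
    eigenvector. *)
Lemma symmetric_unit_eigenvector n (A : 'M[R]_n.+1) : A^T = A ->
  exists a (v : 'rV[R]_n.+1), v *m v^T = 1%:M /\ v *m A = a *: v.
Proof.
move=> symA; pose A' := map_mx (real_complex R) A.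
have [z /eigenvalueP[w wA w0]] := eigenvalue_closed A' (ltn0Sn n).
pose p := map_mx (@complex.Re R) w; pose q := map_mx (@complex.Im R) w.
have ReMr (x : R[i]) (y : R) : complex.Re (x * y%:C) = complex.Re x * y.
  by case: x => a b /=; ring.
have ImMr (x : R[i]) (y : R) : complex.Im (x * y%:C) = complex.Im x * y.
  by case: x => a b /=; ring.
have Re_sum (F : 'I_n.+1 -> R[i]) : complex.Re (\sum_i F i) = \sum_i complex.Re (F i).
  by apply: (big_morph (@complex.Re R)) => // -[? ?] [? ?].
have Im_sum (F : 'I_n.+1 -> R[i]) : complex.Im (\sum_i F i) = \sum_i complex.Im (F i).
  by apply: (big_morph (@complex.Im R)) => // -[? ?] [? ?].
pose al := complex.Re z; pose be := complex.Im z.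
have pA : p *m A = al *: p - be *: q.
  apply/rowP => j; have := congr1 (fun M : 'M[R[i]]_(1, n.+1) => complex.Re (M ord0 j)) wA.
  rewrite !mxE Re_sum => E.
  transitivity (complex.Re (z * w ord0 j)).
    by rewrite -E; apply: eq_bigr => i _; rewrite !mxE ReMr.
  by rewrite /al /be; case: (z) (w ord0 j) => ? ? [? ?].
have qA : q *m A = be *: p + al *: q.
  apply/rowP => j; have := congr1 (fun M : 'M[R[i]]_(1, n.+1) => complex.Im (M ord0 j)) wA.
  rewrite !mxE Im_sum => E.
  transitivity (complex.Im (z * w ord0 j)).
    by rewrite -E; apply: eq_bigr => i _; rewrite !mxE ImMr.
  by rewrite /al /be; case: (z) (w ord0 j) => a b [c d] /=; ring.
pose nrm (v : 'rV[R]_n.+1) := (v *m v^T) ord0 ord0.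
have nrmE v : nrm v = \sum_i v ord0 i ^+ 2.
  by rewrite /nrm mxE; apply: eq_bigr => i _; rewrite mxE expr2.
have nrm_ge0 v : 0 <= nrm v by rewrite nrmE sumr_ge0// => i _; exact: sqr_ge0.
have nrm_eq0 v : nrm v = 0 -> v = 0.
  rewrite nrmE => /eqP; rewrite psumr_eq0; last by move=> i _; exact: sqr_ge0.
  move=> /allP h; apply/rowP => i; rewrite mxE.
  by have := h i (mem_index_enum i) => /=; rewrite sqrf_eq0 => /eqP.
have be0 : be = 0.
  have E : (p *m A) *m q^T = p *m (q *m A)^T by rewrite trmx_mul symA mulmxA.
  have tqA : (q *m A)^T = be *: p^T + al *: q^T by rewrite qA linearD /= !linearZ.
  move: E; rewrite tqA pA mulmxBl mulmxDr -!scalemxAl -!scalemxAr.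
  have := erefl (nrm p); have := erefl (nrm q); rewrite {1}/nrm {2}/nrm.
  move: (p *m p^T) (q *m q^T) (p *m q^T) => pp qq pq qqE ppE.
  move=> /(congr1 (fun M : 'M[R]_(_, _) => M ord0 ord0)); rewrite !mxE qqE ppE => E.
  have : be * (nrm p + nrm q) = 0 by lra.
  move=> /eqP; rewrite mulf_eq0 => /orP[/eqP//|/eqP s0].
  have p0 : p = 0 by apply: nrm_eq0; have := nrm_ge0 p; have := nrm_ge0 q; lra.
  have q0 : q = 0 by apply: nrm_eq0; have := nrm_ge0 p; have := nrm_ge0 q; lra.
  case/eqP: w0; apply/rowP => i; rewrite mxE.
  have := congr1 (fun M : 'M[R]_(_, _) => M ord0 i) p0; have := congr1 (fun M : 'M[R]_(_, _) => M ord0 i) q0.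
  by rewrite !mxE; case: (w ord0 i) => a b /= -> ->.
have normalize (v : 'rV[R]_n.+1) : v != 0 -> v *m A = al *: v ->
    exists a (v : 'rV[R]_n.+1), v *m v^T = 1%:M /\ v *m A = a *: v.
  move=> v0 vA; have nv : 0 < nrm v.
    rewrite lt_neqAle nrm_ge0 andbT eq_sym; apply: contra v0 => /eqP/nrm_eq0 ->.
    by rewrite eqxx.
  exists al, ((Num.sqrt (nrm v))^-1 *: v); split.
    rewrite linearZ /= -scalemxAl -scalemxAr scalerA -invfM -expr2 sqr_sqrtr ?ltW//.
    by rewrite [v *m _]mx11_scalar -/(nrm v) scale_scalar_mx mulVf// gt_eqF.
  by rewrite -scalemxAl vA scalerA mulrC -scalerA.
rewrite be0 scale0r subr0 in pA; rewrite be0 scale0r add0r in qA.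
have [p0|/normalize] := eqVneq p 0; last exact.
have [q0|/normalize] := eqVneq q 0; last exact.
case/eqP: w0; apply/rowP => i; rewrite mxE.
have := congr1 (fun M : 'M[R]_(_, _) => M ord0 i) p0; have := congr1 (fun M : 'M[R]_(_, _) => M ord0 i) q0.
by rewrite !mxE; case: (w ord0 i) => a b /= -> ->.
Qed.

(* The Householder reflection that exchanges [v] and the first basis vector. *)
Lemma orthogonal_completion n (v : 'rV[R]_n.+1) : v *m v^T = 1%:M ->
  exists H : 'M[R]_n.+1, H *m H^T = 1%:M /\ row ord0 H = v.
Proof.
move=> v1; pose e : 'rV[R]_n.+1 := delta_mx ord0 ord0.
have ee : e *m e^T = 1%:M.
  rewrite trmx_delta mul_delta_mx; apply/matrixP => i j.
  by rewrite !ord1 !mxE !eqxx.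
have ve : v *m e^T = (v ord0 ord0)%:M.
  rewrite trmx_delta -colE; apply/matrixP => i j.
  by rewrite !ord1 !mxE eqxx mulr1n.
have ev : e *m v^T = (v ord0 ord0)%:M by rewrite -[e *m _]trmxK trmx_mul trmxK ve tr_scalar_mx.
have [vE|v0] := eqVneq (v ord0 ord0) 1.
  exists 1%:M; rewrite trmx1 mulmx1; split=> //.
  suff : v - e = 0 by move/subr0_eq => ->; rewrite row1.
  have : (v - e) *m (v - e)^T = 0.
    rewrite linearB /= mulmxBl !mulmxBr v1 ee ve ev vE -!raddfB /=.
    by rewrite !subrr raddf0.
  exact: mulmx_tr_eq0.
(* [c] is 2 / |w|^2, because |w|^2 = 2 (1 - v_0). The case v_0 = 1, where w = 0, has been split
   off. *)
pose w := v - e; pose c := (1 - v ord0 ord0)^-1.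
have c0 : 1 - v ord0 ord0 != 0 by rewrite subr_eq0 eq_sym.
have ww : w *m w^T = (2 * (1 - v ord0 ord0))%:M.
  rewrite /w linearB /= mulmxBl !mulmxBr v1 ee ve ev -!raddfB /=.
  by congr (_%:M); ring.
have ew : e *m w^T = (v ord0 ord0 - 1)%:M.
  by rewrite /w linearB /= mulmxBr ev ee -raddfB.
have we : e + w = v by rewrite /w addrCA subrr addr0.
clearbody w.
have Hs : (1%:M - c *: (w^T *m w))^T = 1%:M - c *: (w^T *m w).
  by rewrite linearB /= trmx1 linearZ /= trmx_mul trmxK.
exists (1%:M - c *: (w^T *m w)); split.
  rewrite Hs mulmxBl mul1mx mulmxBr mulmx1 -scalemxAl -scalemxAr.
  have -> : w^T *m w *m (w^T *m w) = (2 * (1 - v ord0 ord0)) *: (w^T *m w).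
    by rewrite mulmxA -(mulmxA w^T) ww mul_mx_scalar -scalemxAl.
  rewrite !scalerA -scalerBl -[in LHS]addrA -opprD -scalerDl.
  have cancel x : x = 0 -> 1%:M - x *: (w^T *m w) = 1%:M.
    by move=> ->; rewrite scale0r subr0.
  by apply: cancel; rewrite /c; field.
rewrite rowE -/e mulmxBr mulmx1 -scalemxAr mulmxA ew.
rewrite mul_scalar_mx scalerA.
have -> : c * (v ord0 ord0 - 1) = -1 by rewrite /c; field.
by rewrite scaleN1r opprK.
Qed.

(** Deflation: in an orthonormal basis starting with a unit eigenvector the matrix is block
    diagonal, and symmetry passes to the smaller block. The rows of [U] are the eigenvectors. *)
Theorem real_spectral n (A : 'M[R]_n) : A^T = A ->
  exists (U : 'M[R]_n) (lam : 'rV[R]_n), U *m U^T = 1%:M /\ A = U^T *m diag_mx lam *m U.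
Proof.
elim: n A => [|n IH] A symA.
  by exists 1%:M, 0; split; [rewrite trmx1 mulmx1|apply/matrixP => -[]].
have [a [v [v1 vA]]] := symmetric_unit_eigenvector symA.
have [H [HH Hv]] := orthogonal_completion v1.
have HtH : H^T *m H = 1%:M by apply: mulmx1C.
pose B : 'M[R]_(1 + n) := H *m A *m H^T.
have symB : B^T = B by rewrite /B !trmx_mul trmxK symA mulmxA.
have B0 : row ord0 B = a *: delta_mx ord0 ord0.
  rewrite /B !row_mul Hv vA -scalemxAl -Hv -row_mul HH; congr (_ *: _).
  by apply/rowP => j; rewrite !mxE eqxx /= eq_sym.
have B0j j : B ord0 j = a * (j == ord0)%:R.
  by have := congr1 (fun M : 'M[R]_(_, _) => M ord0 j) B0; rewrite !mxE eqxx.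
have AE : A = H^T *m B *m H by rewrite /B !mulmxA HtH mul1mx -mulmxA HtH mulmx1.
clearbody B.
have l0 : @lshift 1 n ord0 = ord0 :> 'I_n.+1 by exact: val_inj.
have BE : B = block_mx a%:M 0 0 (drsubmx B).
  rewrite -[LHS]submxK; congr block_mx.
  - apply/matrixP => i j; rewrite !ord1 !mxE.
    rewrite l0.
    by rewrite B0j eqxx mulr1.
  - apply/matrixP => i j; rewrite !ord1 !mxE.
    rewrite l0.
    by rewrite B0j mulr0.
  - apply/matrixP => i j; rewrite !ord1 !mxE.
    rewrite l0.
    by rewrite -[B]symB mxE B0j mulr0.
have symB' : (drsubmx B)^T = drsubmx B.
  by apply/matrixP => i j; rewrite !mxE -[in LHS]symB mxE.
have [U [lam [UU BU]]] := IH _ symB'.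
pose W : 'M[R]_(1 + n) := block_mx 1%:M 0 0 U.
have Wt : W^T = block_mx 1%:M 0 0 U^T by rewrite tr_block_mx !trmx0 trmx1.
pose D : 'rV[R]_(1 + n) := row_mx a%:M lam.
have WW : W *m W^T = 1%:M.
  rewrite Wt /W mulmx_block !(mulmx1, mul1mx, mulmx0, mul0mx, addr0, add0r) UU.
  by rewrite -scalar_mx_block.
have BW : B = W^T *m diag_mx D *m W.
  rewrite BE BU Wt /W /D diag_mx_row.
  rewrite mulmx_block !(mulmx1, mul1mx, mulmx0, mul0mx, addr0, add0r).
  rewrite mulmx_block !(mulmx1, mul1mx, mulmx0, mul0mx, addr0, add0r).
  by congr block_mx; apply/matrixP => i j; rewrite !ord1 !mxE eqxx.
clearbody W D.
exists (W *m H), D; split.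
  by rewrite trmx_mul mulmxA -(mulmxA W) HH mulmx1; exact: WW.
rewrite AE trmx_mul !mulmxA -(mulmxA _ W^T) -(mulmxA _ _ W); congr (_ *m _ *m _).
exact: BW.
Qed.

End RealSpectral.

(** * Multi-affine functions on the nonnegative orthant *)

Section MultiAffine.
Variables (R : realType) (n : nat).
Implicit Types (G : ('I_n -> R) -> R) (lam : 'I_n -> R) (J : {set 'I_n}).

Definition upd lam (i : 'I_n) (t : R) : 'I_n -> R := fun j => if j == i then t else lam j.

Definition indv J : 'I_n -> R := fun i => (i \in J)%:R.

(** Restricted to the nonnegative orthant, where the quadratic forms to which it is applied are
    convex; [t] may exceed 1. *)
Definition multiaffine G : Prop := forall lam i t, (forall j, 0 <= lam j) -> 0 <= t ->
  G (upd lam i t) = (1 - t) * G (upd lam i 0) + t * G (upd lam i 1).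

(** In the induction [s] lists the coordinates still allowed arbitrary values. Affinity in one of
    them reduces it to the values 0 and 1; when none is left the point is a vertex. *)
Lemma multiaffine_eq0 G : multiaffine G -> (forall J, G (indv J) = 0) ->
  forall lam, (forall j, 0 <= lam j) -> G lam = 0.
Proof.
move=> maG G0.
suff H (s : seq 'I_n) lam : (forall j, 0 <= lam j) ->
    (forall j, j \notin s -> lam j = 0 \/ lam j = 1) -> G lam = 0.
  by move=> lam lam0; apply: (H (enum 'I_n)) => // j; rewrite mem_enum.
elim: s lam => [|i s IH] lam lam0 lams.
  have -> : lam = indv [set j | lam j == 1]; last exact: G0.
  apply/funext => j; rewrite /indv inE; have [->|->] := lams j isT; rewrite ?eqxx//.
  by rewrite eq_sym oner_eq0.
have E : lam = upd lam i (lam i) by apply/funext => j; rewrite /upd; case: eqP => [->|].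
have IHt t : t = 0 \/ t = 1 -> G (upd lam i t) = 0.
  move=> t01; apply: IH => j; rewrite /upd; case: eqP => [_|/eqP ji].
  - by case: t01 => ->.
  - exact: lam0.
  - by [].
  - by move=> js; apply: lams; rewrite inE negb_or ji.
by rewrite E maG// !IHt; [rewrite !mulr0 addr0|right|left].
Qed.

Lemma multiaffineB G G' : multiaffine G -> multiaffine G' ->
  multiaffine (fun lam => G lam - G' lam).
Proof. by move=> mG mG' lam i t lam0 t0; rewrite mG// mG'//; ring. Qed.

Lemma multiaffine_sum (I : finType) (P : pred I) (F : I -> ('I_n -> R) -> R) :
  (forall i, multiaffine (F i)) -> multiaffine (fun lam => \sum_(i | P i) F i lam).
Proof.
move=> mF lam i t lam0 t0; rewrite !mulr_sumr -big_split; apply: eq_bigr => j _.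
exact: mF.
Qed.

Lemma multiaffineZ G (c : R) : multiaffine G -> multiaffine (fun lam => G lam * c).
Proof. by move=> mG lam i t lam0 t0; rewrite mG//; ring. Qed.

Lemma multiaffine_prod (F : 'I_n -> R -> R) :
  (forall i t, F i t = (1 - t) * F i 0 + t * F i 1) ->
  multiaffine (fun lam => \prod_i F i (lam i)).
Proof.
move=> mF lam i t _ _.
have E s : \prod_j F j (upd lam i s j) = F i s * \prod_(j < n | j != i) F j (lam j).
  rewrite (bigD1 i)//= /upd eqxx; congr (_ * _).
  by apply: eq_bigr => j /negbTE ->.
by rewrite !E (mF i t); ring.
Qed.

(** Both sides are multi-affine, and at the vertex K the weight of J is 1 for J = K and 0 otherwise.
    Along the diagonal this yields a polynomial whose coefficients are linear in the vertex
    values. *)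
Lemma multiaffine_bernstein G : multiaffine G -> forall lam, (forall j, 0 <= lam j) ->
  G lam = \sum_(J : {set 'I_n}) (\prod_i (if i \in J then lam i else 1 - lam i)) * G (indv J).
Proof.
move=> mG lam lam0; apply/eqP; rewrite -subr_eq0; apply/eqP.
pose F J (i : 'I_n) (t : R) := if i \in J then t else 1 - t.
apply: (@multiaffine_eq0 (fun lam => G lam - \sum_J (\prod_i F J i (lam i)) * G (indv J))) => //.
  apply: multiaffineB => //; apply: multiaffine_sum => J.
  apply: (@multiaffineZ (fun lam => \prod_i F J i (lam i))).
  apply: (@multiaffine_prod (F J)) => i t.
  by rewrite /F; case: ifP => _; ring.
move=> K; rewrite (bigD1 K)//= [X in _ - (X + _)](_ : _ = G (indv K)).
  rewrite big1 ?addr0 ?subrr// => J JK.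
  have [i iJK] : exists i, (i \in J) != (i \in K).
    by apply/existsP; apply: contraNT JK; rewrite negb_exists => /forallP h;
      apply/eqP/setP => i; have := h i; rewrite negbK => /eqP.
  rewrite (bigD1 i)//= /F /indv; move: iJK; case: (i \in J); case: (i \in K) => // _.
    by rewrite mul0r mul0r.
  by rewrite subrr !mul0r.
rewrite big1 ?mul1r// => i _; rewrite /F /indv.
by case: (i \in K); rewrite ?subr0.
Qed.

Lemma multiaffine_esym k : multiaffine (@Defs.esym R n k).
Proof.
apply: multiaffine_sum => I; rewrite (_ : (fun _ => _) =
  (fun lam => \prod_i (if i \in I then lam i else 1))); last first.
  by apply/funext => lam; rewrite big_mkcond.
apply: (@multiaffine_prod (fun i t => if i \in I then t else 1)) => i t.
by case: ifP => _; ring.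
Qed.

Lemma esymZ k (t : R) lam : Defs.esym k (fun i => t * lam i) = t ^+ k * Defs.esym k lam.
Proof.
rewrite /Defs.esym mulr_sumr; apply: eq_bigr => I /eqP <-.
by rewrite big_split /= prodr_const.
Qed.

Lemma esym_indv k J : #|J| = k -> Defs.esym k (indv J) = 1.
Proof.
move=> Jk; rewrite /Defs.esym (bigD1 J) /=; last by rewrite Jk.
rewrite big1 ?mul1r; last by move=> i iJ; rewrite /indv iJ.
rewrite big1 ?addr0// => I /andP[/eqP Ik IJ].
have /fintype.subsetPn[i iI iJ] : ~~ (I \subset J).
  by apply: contra IJ => IJ; rewrite eqEcard IJ Jk Ik /=.
by rewrite (bigD1 i)//= /indv (negbTE iJ) mul0r.
Qed.

(* By induction on [#|J|], [t |-> G (t 1_J)] equals both [t ^ #|J| G (1_J)] and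
   [t ^ k G (1_J)]. *)
Lemma multiaffine_homog_eq0 G k : multiaffine G ->
  (forall lam (t : R), (forall j, 0 <= lam j) -> 0 < t -> G (fun i => t * lam i) = t ^+ k * G lam) ->
  (forall J, #|J| = k -> G (indv J) = 0) ->
  forall lam, (forall j, 0 <= lam j) -> G lam = 0.
Proof.
move=> mG hG Gk; apply: multiaffine_eq0 => // J.
have indv_ge0 K j : 0 <= indv K j by rewrite ler0n.
have [m] := ubnP #|J|; elim: m J => // m IH J Jm.
have [/Gk//|Jk] := eqVneq #|J| k.
pose G' lam := G (fun i => indv J i * lam i) - (\prod_i (if i \in J then lam i else 1)) * G (indv J).
have mG' : multiaffine G'.
  apply: multiaffineB.
    move=> lam i t lam0 t0; have [iJ|iJ] := boolP (i \in J).
      have E s : (fun j => indv J j * upd lam i s j) = upd (fun j => indv J j * lam j) i s.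
        by apply/funext => j; rewrite /upd /indv; case: eqP => // ->; rewrite iJ mul1r.
      by rewrite !E mG// => j; rewrite mulr_ge0.
    have E s : (fun j => indv J j * upd lam i s j) = (fun j => indv J j * lam j).
      by apply/funext => j; rewrite /upd /indv; case: eqP => // ->; rewrite (negbTE iJ) !mul0r.
    by rewrite !E; ring.
  apply: (@multiaffineZ (fun lam => \prod_i (if i \in J then lam i else 1))).
  apply: (@multiaffine_prod (fun i t => if i \in J then t else 1)) => i t.
  by case: ifP => _; ring.
have G'0 : forall lam, (forall j, 0 <= lam j) -> G' lam = 0.
  apply: multiaffine_eq0 => // K; rewrite /G'.
  have -> : (fun i => indv J i * indv K i) = indv (J :&: K).
    by apply/funext => i; rewrite /indv inE -natrM mulnb.
  have [JK|JK] := boolP (J \subset K).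
    rewrite (finset.setIidPl JK) big1 ?mul1r ?subrr// => i _.
    by case: ifP => // iJ; rewrite /indv (fintype.subsetP JK).
  rewrite IH; last first.
    rewrite -ltnS; apply: leq_trans Jm; rewrite ltnS; apply: proper_card.
    by rewrite properE finset.subsetIl finset.subsetI subxx.
  case/fintype.subsetPn: JK => i iJ iK.
  by rewrite (bigD1 i)//= iJ /indv (negbTE iK) !mul0r subrr.
(* At the constant point 2 the two descriptions give 2^k G(1_J) = 2^#|J| G(1_J), with k different
   from #|J|. *)
have := G'0 (fun=> 2) (fun=> ler0n _ _); rewrite /G' -big_mkcond prodr_const.
rewrite (_ : (fun _ => _) = (fun i => 2 * indv J i)); last by apply/funext => i; rewrite mulrC.
rewrite hG// => /eqP; rewrite -mulrBl mulf_eq0 => /orP[|/eqP//].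
rewrite subr_eq0 => /eqP E; exfalso; move: Jk => /eqP; apply.
by apply/(@ieexprIn R 2) => //; rewrite gt_eqF// ltr1n.
Qed.

End MultiAffine.

(** * Elementary symmetric functions of eigenvalues as characteristic coefficients *)

Section Sigma.
Variables (R : realType) (n : nat).

(** Vieta: in the distributed product, [J] is the set of factors that contribute - lam_i, and only
    #|J| = k produces the degree n - k. *)
Lemma coef_prod_XsubC (lam : 'I_n -> R) k : (k <= n)%N ->
  (\prod_(i < n) ('X - (lam i)%:P))`_(n - k) = (-1) ^+ k * Defs.esym k lam.
Proof.
move=> kn; under eq_bigr do rewrite addrC -polyCN.
rewrite bigA_distr /= coef_sum /Defs.esym mulr_sumr big_mkcond /= [RHS]big_mkcond /=.
apply: eq_bigr => J _.
have -> : \prod_i (if i \in J then (- lam i)%:P else 'X) =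
    ((-1) ^+ #|J| * \prod_(i in J) lam i)%:P * 'X^(n - #|J|) :> {poly R}.
  rewrite (bigID (mem J)) /= polyCM; congr (_ * _).
    rewrite -polyCM -prodrN rmorph_prod /=; apply: eq_bigr => i /= ->//.
  rewrite (eq_bigr (fun=> 'X)); last by move=> i /negbTE ->.
  rewrite prodr_const; congr ('X^_).
  have /(congr1 (subn^~ #|J|)) := cardsC J; rewrite card_ord addKn => <-.
  by apply: eq_card => i; rewrite !inE.
rewrite coefCM coefXn; have Jn := max_card (mem J); rewrite card_ord in Jn.
have [->|Jk] := eqVneq #|J| k; first by rewrite eqxx mulr1.
rewrite (_ : (_ == _) = false) ?mulr0//; apply/negbTE; apply: contra Jk => /eqP E.
by rewrite -(subKn Jn) -E subKn.
Qed.

Lemma esym_gt k (lam : 'I_n -> R) : (n < k)%N -> Defs.esym k lam = 0.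
Proof.
move=> nk; rewrite /Defs.esym big1// => I /eqP Ik; exfalso.
by have := max_card (mem I); rewrite card_ord Ik leqNgt nk.
Qed.

(** [sigma_k] picks an enumeration by choice. Since e_k is, up to sign, a coefficient of the
    characteristic polynomial, every enumeration gives the same value; for k > n all are 0. *)
Lemma sigma_kE k (A : 'M[R]_n) lam : eigenvalues_of A lam -> sigma_k k A = Defs.esym k lam.
Proof.
move=> Alam; rewrite /sigma_k; case: pselect => [e|]; last by case; exists lam.
case: cid => /= mu; rewrite /eigenvalues_of Alam => E.
have [kn|nk] := leqP k n; last by rewrite !esym_gt.
apply: (@mulfI _ ((-1) ^+ k)); first by rewrite signr_eq0.
by rewrite -!coef_prod_XsubC// E.
Qed.

Lemma sigma_k_char_poly k (A : 'M[R]_n) lam : (k <= n)%N -> eigenvalues_of A lam ->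
  sigma_k k A = (-1) ^+ k * (char_poly A)`_(n - k).
Proof.
move=> kn Alam; rewrite (sigma_kE _ Alam) Alam coef_prod_XsubC//.
by rewrite mulrA -expr2 -exprM mulnC exprM sqrrN expr1n expr1n mul1r.
Qed.

Lemma eigenvalues_of_spectral (U : 'M[R]_n) (lam : 'rV[R]_n) : U *m U^T = 1%:M ->
  eigenvalues_of (U^T *m diag_mx lam *m U) (fun i => lam ord0 i).
Proof.
move=> UU; rewrite /eigenvalues_of /char_poly.
have UtU := mulmx1C UU.
have -> : char_poly_mx (U^T *m diag_mx lam *m U) =
   map_mx polyC U^T *m char_poly_mx (diag_mx lam) *m map_mx polyC U.
  rewrite /char_poly_mx mulmxBr mulmxBl !map_mxM; congr (_ - _).
  by rewrite mul_mx_scalar -scalemxAl -map_mxM UtU map_mx1 scalemx1.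
rewrite !det_mulmx mulrC mulrA -det_mulmx -map_mxM UU map_mx1 det1 mul1r.
rewrite (_ : char_poly_mx _ = diag_mx (\row_i ('X - (lam ord0 i)%:P))).
  by rewrite det_diag; apply: eq_bigr => i _; rewrite mxE.
apply/matrixP => i j; rewrite !mxE; case: eqP => [->|_]; first by rewrite !mulr1n.
by rewrite !mulr0n subrr.
Qed.

End Sigma.

(** * Borel sets, half-open boxes and test functions *)

Section Borel.
Variables (R : realType) (n : nat).
Notation V := 'rV[R]_n.
Implicit Types (a b : V) (B : set V) (m : {measure set (Rn_borel R n) -> \bar R}).

Lemma open_borel (U : set V) : open U -> borel_set U.
Proof. by move=> oU; apply: sub_sigma_algebra. Qed.

Lemma continuous_borel (phi : V -> R) : continuous phi ->
  measurable_fun [set: Rn_borel R n] (phi : Rn_borel R n -> R).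
Proof.
move=> cphi; apply: (measurability _ (measurable_realfun.RGenOpens.measurableE R)).
move=> /= _ [_ [x [y ->]] <-]; rewrite setTI; apply: open_borel.
by apply: open_comp => [z _|]; [exact: cphi|exact: interval_open].
Qed.

Lemma coord_le_norm (x : V) i : `|x ord0 i| <= `|x|.
Proof.
rewrite {2}/Num.norm /= mx_normrE.
exact: (@le_bigmax _ _ _ 0 (fun p : 'I_1 * 'I_n => `|x p.1 p.2|) (ord0, i)).
Qed.

Lemma norm_le_coord (x : V) r : 0 <= r -> (forall i, `|x ord0 i| <= r) -> `|x| <= r.
Proof.
move=> r0 xr; rewrite /Num.norm /= mx_normrE; apply: bigmax_le => // -[i j] _ /=.
by rewrite ord1.
Qed.

(** Half-open, so that boxes tile exactly and are stable under intersection; the boxes that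
    normalise Lebesgue measure are closed. *)
Definition hbox a b : set V := [set x | forall i, a ord0 i <= x ord0 i < b ord0 i].

Lemma borel_coord_itv (i : 'I_n) (I : interval R) : borel_set [set x : V | x ord0 i \in I].
Proof.
have := @continuous_borel (fun x => x ord0 i) (@coord_continuous _ _ _ ord0 i).
by move=> /(_ measurableT [set` I] (measurable_itv _)); rewrite setTI.
Qed.

Lemma borel_hbox a b : borel_set (hbox a b).
Proof.
have -> : hbox a b = \bigcap_(i in [set: 'I_n]) [set x | x ord0 i \in `[a ord0 i, b ord0 i[].
  apply/seteqP; split => x /=; first by move=> xab i _ /=; rewrite in_itv /=; exact: xab.
  by move=> h i; have := h i Logic.I; rewrite /= in_itv.
by apply: fin_bigcap_measurable => [|i _]; [exact: finite_finset|exact: borel_coord_itv].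
Qed.

Lemma bounded_setP B : bounded_set B <-> exists r, forall x, B x -> `|x| <= r.
Proof.
split=> [[r [_ h]]|[r h]]; first by exists (r + 1) => x Bx; apply: (h (r + 1)) => //; rewrite ltrDl.
by exists r; split; [exact: num_real|move=> s rs x Bx; apply: le_trans (ltW rs); exact: h].
Qed.

Lemma bounded_hbox a b : bounded_set (hbox a b).
Proof.
apply/bounded_setP; exists (`|a| + `|b|) => x xab.
apply: norm_le_coord => [|i]; first by rewrite addr_ge0.
have /andP[h1 h2] := xab i.
have := coord_le_norm a i; have := coord_le_norm b i.
rewrite !ler_norml => /andP[? ?] /andP[? ?].
have := normr_ge0 a; have := normr_ge0 b => ? ?; apply/andP; split; lra.
Qed.

Lemma bborel_hbox a b : bounded_borel (hbox a b).
Proof. by split; [exact: borel_hbox|exact: bounded_hbox]. Qed.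

Lemma bborelI B B' : bounded_borel B -> borel_set B' -> bounded_borel (B `&` B').
Proof.
move=> [mB /bounded_setP[r Br]] mB'; split; first exact: measurableI.
by apply/bounded_setP; exists r => x [/Br].
Qed.

Lemma sub_bborel B B' : bounded_borel B -> borel_set B' -> B' `<=` B -> bounded_borel B'.
Proof. by move=> bB mB' B'B; rewrite -(setIidr B'B); exact: bborelI. Qed.

Lemma lf_fin m B : locally_finite m -> bounded_borel B -> m B \is a fin_num.
Proof. by move=> lf bB; rewrite ge0_fin_numE//; exact: lf. Qed.

(** Values in [0, 1] allow approximation from below by nonnegative simple functions and domination
    by the indicator of the set where [phi] is nonzero. *)
Definition nntest (phi : V -> R) : Prop := test_fun phi /\ forall x, 0 <= phi x <= 1.

Lemma test_supp_bounded (phi : V -> R) : test_fun phi -> bounded_set [set x | phi x != 0].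
Proof.
move=> [_ /compact_bounded /bounded_setP[r h]]; apply/bounded_setP; exists r => x hx.
by apply: h; exact: subset_closure.
Qed.

Lemma test_supp_bborel (phi : V -> R) : test_fun phi -> bounded_borel [set x | phi x != 0].
Proof.
move=> tphi; split; last exact: test_supp_bounded.
have [cphi _] := tphi; apply: open_borel.
rewrite (_ : [set _ | _] = phi @^-1` [set y | y != 0]) //.
by apply: open_comp => [z _|]; [exact: cphi|exact: open_neq].
Qed.

(** The simple functions that approximate [phi] do not depend on the measure, so one sequence [S]
    serves all measures at once. This lets a linear identity between several measures on sets turn
    into one between integrals. *)
Lemma Rintegral_approx (phi : V -> R) : nntest phi ->
  exists S : nat -> seq (R * set V),
    (forall N c, List.In c (S N) -> bounded_borel c.2) /\
    forall m, locally_finite m ->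
      (\sum_(c <- S N) c.1 * fine (m c.2)) @[N --> \oo] --> Rintegral m setT phi.
Proof.
move=> [tphi phi01]; have bK := test_supp_bborel tphi.
have phi0 x : 0 <= phi x by have /andP[] := phi01 x.
have [cphi _] := tphi.
have mphi : measurable_fun [set: Rn_borel R n] (fun x : Rn_borel R n => (phi x)%:E).
  by apply/measurable_EFinP; exact: continuous_borel.
pose g := nnsfun_approx measurableT mphi.
have gphi x : EFin \o g^~ x @ \oo --> (phi x)%:E.
  by apply: cvg_nnsfun_approx => // y _; rewrite lee_fin.
have ndg x : nondecreasing_seq (g^~ x) by move=> i j ij; exact/lefP/nd_nnsfun_approx.
have g_le N x : g N x <= phi x.
  by rewrite -lee_fin /g nnsfun_approxE; apply: (le_approx N) => // y _; rewrite lee_fin.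
(* The level 0 is dropped because its preimage is unbounded; the other levels lie where [phi] is
   nonzero. *)
pose S N := [seq (x, g N @^-1` [set x]) | x : R <- finmap.enum_fset (fset_set (range (g N))) & x != 0].
have bS N x : x != 0 -> bounded_borel (g N @^-1` [set x]).
  move=> x0; apply: (sub_bborel bK); first by rewrite -[_ @^-1` _]setTI; exact: measurable_funPT.
  move=> y /= gy; rewrite gt_eqF//; apply: lt_le_trans (g_le N y).
  by rewrite gy lt_neqAle eq_sym x0 -gy /=.
exists S; split.
  move=> N c /List.in_map_iff[x [<- /List.filter_In[_ x0]]] /=; exact: bS.
move=> m lf.
have intE : (\int[m]_x (phi x)%:E)%E = limn (sintegral m \o g).
  by apply: nd_ge0_integral_lim => // x; rewrite lee_fin.
have cvS : sintegral m (g N) @[N --> \oo] --> (\int[m]_x (phi x)%:E)%E.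
  by rewrite intE; exact: is_cvg_sintegral.
have sE N : sintegral m (g N) = (\sum_(c <- S N) c.1 * fine (m c.2))%:E.
  rewrite sintegralE fsbig_finite//= /S big_map big_filter -sumEFin [RHS]big_mkcond /=.
  apply: eq_bigr => x _; case: eqP => [->|/eqP x0]; first by rewrite mul0e.
  by rewrite EFinM fineK//; apply: lf_fin => //; exact: bS.
have fint : (\int[m]_x (phi x)%:E)%E \is a fin_num.
  rewrite ge0_fin_numE; last by apply: integral_ge0 => x _; rewrite lee_fin.
  have [mK _] := bK.
  apply: (@le_lt_trans _ _ (\int[m]_x (\1_([set x | phi x != 0] : set (Rn_borel R n)) x)%:E)%E).
    apply: ge0_le_integral => //.
    - by move=> x _; rewrite lee_fin.
    - by apply/measurable_EFinP; exact: measurable_indic.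
    - move=> x _; rewrite lee_fin indicE; case: (boolP (x \in _)).
        by move=> _; have /andP[] := phi01 x.
      by rewrite notin_setE /= => /negP; rewrite negbK => /eqP ->.
  by rewrite integral_indic// setIT; exact: lf.
have : sintegral m (g N) @[N --> \oo] --> (Rintegral m setT phi)%:E.
  by rewrite /Rintegral fineK.
move=> /fine_cvg; apply: cvg_trans; apply: near_eq_cvg; near=> N.
by rewrite /= sE.
Unshelve. all: by end_near.
Qed.

(** The rising ramp sits on [a - 1/(N+1), a] and the falling one on [b - 1/(N+1), b]. Both lie to
    the left of their endpoint, so the pointwise limit is the indicator of the half-open
    interval. *)
Definition trapezoid (a b : R) (N : nat) (s : R) : R :=
  Num.max 0 (Num.min 1 (Num.min (1 + N.+1%:R * (s - a)) (N.+1%:R * (b - s)))).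

Lemma trapezoid_itv (a b : R) N s : 0 <= trapezoid a b N s <= 1.
Proof. by rewrite /trapezoid le_max lexx /= ge_max ler01 ge_min lexx. Qed.

Lemma trapezoid_out (a b : R) N s : ~~ (a - 1 <= s <= b) -> trapezoid a b N s = 0.
Proof.
rewrite negb_and -!ltNge => /orP[sa|bs]; apply/max_l; rewrite ge_min; apply/orP; right;
  rewrite ge_min; apply/orP; [left|right].
  have : 1 <= N.+1%:R :> R by rewrite ler1n.
  by nra.
by rewrite mulr_ge0_le0// subr_le0 ltW.
Qed.

Lemma continuous_trapezoid (a b : R) N : continuous (trapezoid a b N).
Proof.
move=> s.
have c0 : {for s, continuous (cst 0 : R -> R^o)} by exact: cst_continuous.
have c1 : {for s, continuous (cst 1 : R -> R^o)} by exact: cst_continuous.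
have ca : {for s, continuous ((fun s => 1 + N.+1%:R * (s - a)) : R -> R^o)}.
  by apply: cvgD; [exact: cvg_cst|apply: cvgM; [exact: cvg_cst|apply: cvgB; [exact: cvg_id|exact: cvg_cst]]].
have cb : {for s, continuous ((fun s => N.+1%:R * (b - s)) : R -> R^o)}.
  by apply: cvgM; [exact: cvg_cst|apply: cvgB; [exact: cvg_cst|exact: cvg_id]].
exact: (continuous_max c0 (continuous_min c1 (continuous_min ca cb))).
Qed.

Lemma cvg_trapezoid (a b s : R) :
  trapezoid a b N s @[N --> \oo] --> ((a <= s < b)%R%:R : R).
Proof.
apply: cvg_near_cst.
have ev (d : R) : 0 < d -> \forall N \near \oo, 1 <= N.+1%:R * d.
  move=> d0; near=> N; have : d^-1 <= N%:R by near: N; exact: nbhs_infty_ger.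
  move=> h; rewrite -(ler_pM2r d0) mulVf ?gt_eqF// in h; apply: le_trans h _.
  by rewrite ler_pM2r// ler_nat.
have [sa|sa] := ltP s a.
  have := ev (a - s); rewrite subr_gt0 => /(_ sa); apply: filterS => N h /=.
  rewrite /trapezoid; apply/max_l; rewrite ge_min; apply/orP; right.
  rewrite ge_min; apply/orP; left; move: h; set X := _%:R => h; lra.
have [sb|sb] := ltP s b.
  have := ev (b - s); rewrite subr_gt0 => /(_ sb); apply: filterS => N h /=.
  rewrite /trapezoid (@min_l _ _ 1) ?max_r//.
  rewrite le_min h andbT; have : 0 <= N.+1%:R :> R by [].
  by move=> ?; nra.
apply: nearW => N /=; rewrite /trapezoid; apply/max_l; rewrite ge_min; apply/orP; right.
rewrite ge_min; apply/orP; right; rewrite mulr_ge0_le0// subr_le0//.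
Unshelve. all: by end_near.
Qed.

Lemma continuous_prod (T : topologicalType) (I : Type) (s : seq I) (F : I -> T -> R) :
  (forall i, continuous (F i)) -> continuous (fun x => \prod_(i <- s) F i x).
Proof.
move=> cF; elim: s => [|i s IH] x.
  by under eq_fun do rewrite big_nil; exact: cst_continuous.
by under eq_fun do rewrite big_cons; apply: continuousM; [exact: cF|exact: IH].
Qed.

Lemma cvg_prod (I : Type) (s : seq I) (F : I -> nat -> R) (l : I -> R) :
  (forall i, F i N @[N --> \oo] --> l i) ->
  (\prod_(i <- s) F i N) @[N --> \oo] --> \prod_(i <- s) l i.
Proof.
move=> cF; elim: s => [|i s IH].
  by under eq_fun do rewrite big_nil; rewrite big_nil; exact: cvg_cst.
by under eq_fun do rewrite big_cons; rewrite big_cons; apply: cvgM; [exact: cF|exact: IH].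
Qed.

Definition boxtest a b (N : nat) (x : V) : R :=
  \prod_(i < n) trapezoid (a ord0 i) (b ord0 i) N (x ord0 i).

Lemma boxtest_supp a b N x : boxtest a b N x != 0 -> hbox (a - const_mx 1) (b + const_mx 1) x.
Proof.
move=> h i; rewrite !mxE; apply/negPn/negP => hi.
move/negP: h; apply; apply/eqP; rewrite /boxtest (bigD1 i)//= trapezoid_out ?mul0r//.
by apply: contra hi => /andP[-> h] /=; lra.
Qed.

Lemma boxtest_itv a b N x : 0 <= boxtest a b N x <= 1.
Proof.
rewrite /boxtest; apply/andP; split.
  by apply: prodr_ge0 => i _; have /andP[] := trapezoid_itv (a ord0 i) (b ord0 i) N (x ord0 i).
by apply: prodr_ile1 => i _; exact: trapezoid_itv.
Qed.

Lemma nntest_boxtest a b N : nntest (boxtest a b N).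
Proof.
split; last exact: boxtest_itv.
split.
  apply: continuous_prod => i x.
  apply: (@continuous_comp _ _ _ (fun x : V => x ord0 i)); first exact: coord_continuous.
  exact: continuous_trapezoid.
apply: bounded_closed_compact; last exact: closed_closure.
have [r hr] := (bounded_setP _).1 (bounded_hbox (a - const_mx 1) (b + const_mx 1)).
apply/bounded_setP; exists r => x.
have cl : closed [set x : V | `|x| <= r].
  rewrite (_ : [set _ | _] = Num.norm @^-1` [set y | y <= r])//.
  by apply: closed_comp => [y _|]; [exact: norm_continuous|exact: closed_le].
have sub : [set x | boxtest a b N x != 0] `<=` [set x : V | `|x| <= r].
  by move=> y /= /boxtest_supp; exact: hr.
by move/(closure_subset sub); rewrite -((closure_id _).1 cl).
Qed.

Lemma Rintegral_boxtest m a b : locally_finite m ->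
  Rintegral m setT (boxtest a b N) @[N --> \oo] --> fine (m (hbox a b)).
Proof.
move=> lf; pose K := hbox (a - const_mx 1) (b + const_mx 1).
have mK : measurable (K : set (Rn_borel R n)) by exact: borel_hbox.
apply: fine_cvg; rewrite fineK; last by apply: lf_fin => //; exact: bborel_hbox.
have <- : (\int[m]_x (\1_(hbox a b : set (Rn_borel R n)) x)%:E = m (hbox a b))%E.
  by rewrite integral_indic ?setIT//; exact: borel_hbox.
apply: (@dominated_cvg _ _ _ m setT measurableT (fun N x => (boxtest a b N x)%:E)
  (fun x => (\1_(hbox a b : set (Rn_borel R n)) x)%:E) (fun x => (\1_(K : set (Rn_borel R n)) x)%:E)).
- move=> N; apply/measurable_EFinP; apply: continuous_borel.
  by have [[]] := nntest_boxtest a b N.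
- move=> x _; apply: cvg_EFin; first exact: nearW.
  rewrite (_ : \1__ x = \prod_(i < n) (a ord0 i <= x ord0 i < b ord0 i)%R%:R).
    by apply: cvg_prod => i; exact: cvg_trapezoid.
  rewrite indicE; case: (boolP (x \in _)).
    by rewrite inE /= => h; rewrite big1// => i _; rewrite h.
  rewrite notin_setE /= => h; apply/esym/eqP/prodf_eq0.
  have [i hi] : exists i, ~ (a ord0 i <= x ord0 i < b ord0 i) by apply/existsNP.
  by exists i => //; rewrite (negbTE (introN idP hi)).
- by [].
- apply/integrableP; split; first by apply/measurable_EFinP; exact: measurable_indic.
  under eq_integral do rewrite gee0_abs ?lee_fin//.
  by rewrite integral_indic// setIT; apply: lf; exact: bborel_hbox.
- move=> N x _; rewrite gee0_abs ?lee_fin; last by have /andP[] := boxtest_itv a b N x.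
  rewrite indicE; case: (boolP (x \in _)) => [_|].
    by have /andP[] := boxtest_itv a b N x.
  rewrite notin_setE /K; have [->//|/boxtest_supp h] := eqVneq (boxtest a b N x) 0.
  by move/(_ h).
Qed.

End Borel.

(** * Scalar product, convex functions, local uniform convergence *)

Section ConvexFunctions.
Variables (R : realType) (n : nat).
Notation V := 'rV[R]_n.
Implicit Types (u x y : V) (f g : V -> R).

Definition dot u x : R := \sum_(i < n) u ord0 i * x ord0 i.

Lemma dotC u x : dot u x = dot x u.
Proof. by apply: eq_bigr => i _; rewrite mulrC. Qed.

Lemma dotDr u x y : dot u (x + y) = dot u x + dot u y.
Proof. by rewrite /dot -big_split; apply: eq_bigr => i _; rewrite mxE mulrDr. Qed.

Lemma dotZr u (t : R) x : dot u (t *: x) = t * dot u x.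
Proof. by rewrite /dot mulr_sumr; apply: eq_bigr => i _; rewrite mxE mulrCA. Qed.

Lemma dot0r u : dot u 0 = 0.
Proof. by rewrite /dot big1// => i _; rewrite mxE mulr0. Qed.

Lemma dotNr u x : dot u (- x) = - dot u x.
Proof. by rewrite -scaleN1r dotZr mulN1r. Qed.

Lemma dotBr u x y : dot u (x - y) = dot u x - dot u y.
Proof. by rewrite dotDr dotNr. Qed.

Lemma dotDl u x y : dot (x + y) u = dot x u + dot y u.
Proof. by rewrite !(dotC _ u) dotDr. Qed.

Lemma dotZl u (t : R) x : dot (t *: x) u = t * dot x u.
Proof. by rewrite !(dotC _ u) dotZr. Qed.

Lemma dotBl u x y : dot (x - y) u = dot x u - dot y u.
Proof. by rewrite !(dotC _ u) dotBr. Qed.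

Lemma dot_ge0 x : 0 <= dot x x.
Proof. by apply: sumr_ge0 => i _; rewrite -expr2 sqr_ge0. Qed.

Lemma dot_le_norm u x : `|dot u x| <= n%:R * (`|u| * `|x|).
Proof.
apply: le_trans (ler_norm_sum _ _ _) _.
have -> : n%:R * (`|u| * `|x|) = \sum_(i < n) `|u| * `|x| by rewrite sumr_const card_ord mulr_natl.
apply: ler_sum => i _.
by rewrite normrM ler_pM// coord_le_norm.
Qed.

Lemma convexD f g : convex_fun f -> convex_fun g -> convex_fun (fun x => f x + g x).
Proof.
move=> cf cg x y t t0 t1; have := cf x y t t0 t1; have := cg x y t t0 t1; lra.
Qed.

Lemma convexZ f (c : R) : 0 <= c -> convex_fun f -> convex_fun (fun x => c * f x).
Proof.
move=> c0 cf x y t t0 t1; have := ler_wpM2l c0 (cf x y t t0 t1); lra.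
Qed.

Lemma convex_aff (l : V -> R) : affine_fun l -> convex_fun l.
Proof.
move=> [a [b lE]] x y t _ _; rewrite !lE -!/(dot _ _) dotDr !dotZr; lra.
Qed.

Lemma convex_cst (c : R) : convex_fun (fun _ : V => c).
Proof. by move=> x y t _ _; lra. Qed.

Lemma convex_max f g : convex_fun f -> convex_fun g ->
  convex_fun (fun x => Num.max (f x) (g x)).
Proof.
move=> cf cg x y t t0 t1; rewrite ge_max; have t1' : 0 <= 1 - t by rewrite subr_ge0.
apply/andP; split.
  apply: le_trans (cf x y t t0 t1) _.
  by rewrite lerD// ler_wpM2l// le_max lexx.
apply: le_trans (cg x y t t0 t1) _.
by rewrite lerD// ler_wpM2l// le_max lexx orbT.
Qed.

Lemma convex_sum (I : Type) (s : seq I) (P : pred I) (F : I -> V -> R) :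
  (forall i, P i -> convex_fun (F i)) -> convex_fun (fun x => \sum_(i <- s | P i) F i x).
Proof.
move=> cF; elim: s => [|i s IH].
  by under eq_fun do rewrite big_nil; exact: convex_cst.
have [Pi|/negbTE Pi] := boolP (P i); last by under eq_fun do rewrite big_cons Pi.
by under eq_fun do rewrite big_cons Pi; apply: convexD => //; exact: cF.
Qed.

Lemma convex_sq u : convex_fun (fun x => dot u x ^+ 2).
Proof.
move=> x y t t0 t1; rewrite dotDr !dotZr; set a := dot u x; set b := dot u y.
have : 0 <= t * (1 - t) * (a - b) ^+ 2.
  by rewrite mulr_ge0// ?sqr_ge0// mulr_ge0// subr_ge0.
by move=> h; rewrite -subr_ge0; move: h; congr (0 <= _); ring.
Qed.

Lemma convex_comp_add f (y : V) : convex_fun f -> convex_fun (fun x => f (x + y)).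
Proof.
move=> cf x z t t0 t1; have := cf (x + y) (z + y) t t0 t1.
congr (f _ <= _); rewrite !scalerDr addrACA; congr (_ + _).
by rewrite -scalerDl subrK scale1r.
Qed.

Lemma affine_dot u (c : R) : affine_fun (fun x => dot u x + c).
Proof. by exists u, c. Qed.

Definition loc_bounded f := forall r : R, exists C, forall x, `|x| <= r -> `|f x| <= C.

Lemma loc_bounded_dot u : loc_bounded (dot u).
Proof.
move=> r; exists (n%:R * (`|u| * r)) => x xr; apply: le_trans (dot_le_norm u x) _.
by rewrite ler_wpM2l// ler_wpM2l.
Qed.

Lemma loc_boundedD f g : loc_bounded f -> loc_bounded g -> loc_bounded (fun x => f x + g x).
Proof.
move=> lf lg r; have [C hC] := lf r; have [D hD] := lg r; exists (C + D) => x xr.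
by apply: le_trans (ler_normD _ _) _; apply: lerD; [exact: hC|exact: hD].
Qed.

Lemma luc_scale f g (ts : nat -> R) (t : R) : loc_bounded g -> ts j @[j --> \oo] --> t ->
  loc_unif_cvg (fun j x => f x + ts j * g x) (fun x => f x + t * g x).
Proof.
move=> lg cts r e e0; have [C hC] := lg r.
have C1 : 0 < `|C| + 1 by rewrite ltr_pwDr.
have /cvgrPdist_le /(_ (e / (`|C| + 1))) [|N _ hN] := cts; first by rewrite divr_gt0.
exists N => j Nj x xr; rewrite opprD addrACA subrr add0r -mulrBl normrM distrC.
apply: le_trans (_ : e / (`|C| + 1) * (`|C| + 1) <= _); last by rewrite divfK ?gt_eqF.
apply: ler_pM => //; first exact: hN.
apply: le_trans (hC x xr) _; apply: le_trans (ler_norm _) _; lra.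
Qed.

End ConvexFunctions.

(** * Cauchy's functional equation on a half-line *)

Section Cauchy.
Variable R : realType.

Lemma cvg_rsum (I T : Type) (F : set_system T) {FF : Filter F} (s : seq I) (P : pred I)
    (f : I -> T -> R) (l : I -> R) :
  (forall i, P i -> f i x @[x --> F] --> l i) ->
  (\sum_(i <- s | P i) f i x) @[x --> F] --> \sum_(i <- s | P i) l i.
Proof.
move=> cf; elim: s => [|i s IH].
  by under eq_fun do rewrite big_nil; rewrite big_nil; exact: cvg_cst.
rewrite big_cons; have [Pi|/negbTE Pi] := boolP (P i).
  by under eq_fun do rewrite big_cons Pi; apply: cvgD => //; exact: cf.
by under eq_fun do rewrite big_cons Pi.
Qed.

(** Additivity settles the multiples of 1/(N+1), and t is approached by the largest such multiple
    below it. The half-line and sequential continuity match the use: t is a coefficient that must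
    stay nonnegative, and Psi is sequentially continuous. *)
Lemma additive_continuous_linear (u : R -> R) :
  (forall s t, 0 <= s -> 0 <= t -> u (s + t) = u s + u t) ->
  (forall (ts : nat -> R) (t : R), (forall j, 0 <= ts j) -> 0 <= t -> ts j @[j --> \oo] --> t ->
     u (ts j) @[j --> \oo] --> u t) ->
  forall t, 0 <= t -> u t = t * u 1.
Proof.
move=> uD uc t t0.
have u0 : u 0 = 0 by have := uD 0 0 (lexx _) (lexx _); rewrite addr0; lra.
have uM (m : nat) s : 0 <= s -> u (m%:R * s) = m%:R * u s.
  move=> s0; elim: m => [|m IH]; first by rewrite !mul0r.
  by rewrite -natr1 !mulrDl !mul1r uD ?mulr_ge0// IH.
have uV (N : nat) : u N.+1%:R^-1 = N.+1%:R^-1 * u 1.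
  have N0 : N.+1%:R != 0 :> R by rewrite pnatr_eq0.
  apply: (@mulfI _ N.+1%:R) => //; rewrite -uM ?invr_ge0// mulrA.
  by rewrite mulfV// mul1r.
pose ts N : R := (Num.truncn (N.+1%:R * t))%:R * N.+1%:R^-1.
have tst : ts j @[j --> \oo] --> t.
  apply/cvgrPdist_le => e e0; near=> N.
  have N0 : 0 < N.+1%:R :> R by rewrite ltr0n.
  have /truncn_itv/andP[h1 h2] : 0 <= N.+1%:R * t by rewrite mulr_ge0.
  have e1 : 1 <= N.+1%:R * e.
    have : e^-1 <= N%:R by near: N; exact: nbhs_infty_ger.
    move=> h; rewrite -(ler_pM2r e0) mulVf ?gt_eqF// in h; apply: le_trans h _.
    by rewrite ler_pM2r// ler_nat.
  rewrite -(ler_pM2l N0) -[X in X * `|_|](gtr0_norm N0) -normrM mulrBr /ts.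
  rewrite mulrCA mulfV ?gt_eqF// mulr1; move: h1 h2; rewrite -natr1.
  set a := N.+1%:R * t; set b := _%:R => h1 h2; rewrite ger0_norm; lra.
have : u (ts j) @[j --> \oo] --> t * u 1.
  have -> : (fun j => u (ts j)) = (fun j => ts j * u 1).
    by apply/funext => j; rewrite /ts uM ?invr_ge0// uV mulrA.
  by apply: cvgM => //; exact: cvg_cst.
have ts0 j : 0 <= ts j by rewrite mulr_ge0// invr_ge0.
have := uc ts t ts0 t0 tst.
by move=> h1 h2; apply: cvg_unique h1 h2.
Unshelve. all: by end_near.
Qed.

Lemma continuous_dot n (u : 'rV[R]_n) : continuous (dot u).
Proof.
move=> x; apply: (@cvg_rsum _ _ (nbhs x) _ _ _ (fun i (x : 'rV[R]_n) => u ord0 i * x ord0 i)) => i _.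
by apply: cvgM; [exact: cvg_cst|exact: coord_continuous].
Qed.

End Cauchy.

(** * Real parts of the valuation; behaviour under adding hinges *)

Section SignedValuations.
Variables (R : realType) (n : nat).
Notation V := 'rV[R]_n.
Notation meas := {measure set (Rn_borel R n) -> \bar R}.

Definition sval (p q : meas) (B : set V) : R := fine (p B) - fine (q B).

Definition spair (p q : meas) (phi : V -> R) : R :=
  Rintegral p setT phi - Rintegral q setT phi.

(* The real (or imaginary) part of an SO(n)-equivariant element of MAVal_k. *)
Record sMA (k : nat) := SMA {
  pm : (V -> R) -> meas;
  nm : (V -> R) -> meas;
  pm_lf : forall f, locally_finite (pm f);
  nm_lf : forall f, locally_finite (nm f);
  val := fun f => sval (pm f) (nm f);
  val_valuation : forall f g : V -> R, convex_fun f -> convex_fun g ->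
    convex_fun (fun x => Num.min (f x) (g x)) ->
    forall B : set V, bounded_borel B ->
      val (fun x => Num.max (f x) (g x)) B + val (fun x => Num.min (f x) (g x)) B
      = val f B + val g B;
  val_continuous : forall (fs : nat -> V -> R) (f : V -> R),
    (forall j, convex_fun (fs j)) -> convex_fun f -> loc_unif_cvg fs f ->
    forall phi, test_fun phi ->
    spair (pm (fs j)) (nm (fs j)) phi @[j --> \oo] --> spair (pm f) (nm f) phi;
  val_affine : forall f l : V -> R, convex_fun f -> affine_fun l ->
    forall B : set V, bounded_borel B -> val (fun x => f x + l x) B = val f B;
  val_local : forall (f g : V -> R) (U : set V), convex_fun f -> convex_fun g -> open U ->
    (forall x, U x -> f x = g x) ->
    forall B : set V, bounded_borel B -> B `<=` U -> val f B = val g B;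
  val_translation : forall (f : V -> R) (y : V), convex_fun f ->
    forall B : set V, bounded_borel B ->
      val (fun x => f (x + y)) B = val f [set b + y | b in B];
  val_homogeneous : forall (f : V -> R) (t : R), convex_fun f -> 0 < t ->
    forall B : set V, bounded_borel B -> val (fun x => t * f x) B = t ^+ k * val f B;
  val_SO : forall g : 'M[R]_n, special_orthogonal g ->
    forall f : V -> R, convex_fun f -> forall B : set V, bounded_borel B ->
      val (fun x => f (x *m g)) [set x | B (x *m g)] = val f B }.

Variables (k : nat) (Psi : sMA k).
Notation vl := (val Psi).
Implicit Types (f g : V -> R) (phi : V -> R) (B : set V).

Definition pair f phi : R := spair (pm Psi f) (nm Psi f) phi.

Lemma cvg_pair (fs : nat -> V -> R) f phi : (forall j, convex_fun (fs j)) -> convex_fun f ->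
  loc_unif_cvg fs f -> nntest phi -> pair (fs j) phi @[j --> \oo] --> pair f phi.
Proof. by move=> cfs cf fsf [tphi _]; exact: val_continuous. Qed.

Lemma valU f B B' : bounded_borel B -> bounded_borel B' -> B `&` B' = set0 ->
  vl f (B `|` B') = vl f B + vl f B'.
Proof.
move=> bB bB' BB'; have [mB _] := bB; have [mB' _] := bB'.
have addU (m : meas) : locally_finite m -> fine (m (B `|` B')) = fine (m B) + fine (m B').
  by move=> lf; rewrite measureU// fineD//; exact: lf_fin.
by rewrite /val /sval !addU; [ring|exact: nm_lf|exact: pm_lf].
Qed.

Lemma val0 f : vl f set0 = 0.
Proof. by rewrite /val /sval !measure0 subrr. Qed.

(** From sets to test functions. All terms share the sets of [Rintegral_approx], so each
    approximating sum regroups into combinations of values on a single set, which vanish. *)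
Lemma pair_lincomb (s : seq (R * (V -> R))) phi : nntest phi ->
  (forall B, bounded_borel B -> \sum_(c <- s) c.1 * vl c.2 B = 0) ->
  \sum_(c <- s) c.1 * pair c.2 phi = 0.
Proof.
move=> /Rintegral_approx [S [bS cS]] h.
have : \sum_(c <- s) c.1 * (\sum_(d <- S N) d.1 * vl c.2 d.2) @[N --> \oo] -->
    \sum_(c <- s) c.1 * pair c.2 phi.
  apply: cvg_rsum => c _; apply: cvgM; first exact: cvg_cst.
  have -> : (fun N => \sum_(d <- S N) d.1 * vl c.2 d.2) =
      (fun N => \sum_(d <- S N) d.1 * fine (pm Psi c.2 d.2) -
                \sum_(d <- S N) d.1 * fine (nm Psi c.2 d.2)).
    by apply/funext => N; rewrite -sumrB; apply: eq_bigr => d _; rewrite -mulrBr.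
  by apply: cvgB; apply: cS; [exact: pm_lf|exact: nm_lf].
have -> : (fun N => \sum_(c <- s) c.1 * (\sum_(d <- S N) d.1 * vl c.2 d.2)) = (fun=> 0).
  apply/funext => N; under eq_bigr do rewrite mulr_sumr; rewrite exchange_big /=.
  have := bS N; elim: (S N) => [|d S' IH] bd; first by rewrite big_nil.
  rewrite big_cons IH ?addr0; last by move=> c cS'; apply: bd; right.
  under eq_bigr do rewrite mulrCA; rewrite -mulr_sumr h ?mulr0//.
  by apply: bd; left.
move=> h2; have h3 : (0 : R) @[_ --> \oo] --> (0 : R) by exact: cvg_cst.
by apply: cvg_unique h2 h3.
Qed.

Lemma cvg_pair_boxtest f a b :
  pair f (boxtest a b N) @[N --> \oo] --> vl f (hbox a b).
Proof. by apply: cvgB; apply: Rintegral_boxtest; [exact: pm_lf|exact: nm_lf]. Qed.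

(** The way back from test functions, through [boxtest]. It reaches half-open boxes only, which is
    enough for the uniqueness argument on dyadic boxes. *)
Lemma box_lincomb (s : seq (R * (V -> R))) a b :
  (forall phi, nntest phi -> \sum_(c <- s) c.1 * pair c.2 phi = 0) ->
  \sum_(c <- s) c.1 * vl c.2 (hbox a b) = 0.
Proof.
move=> h.
have : \sum_(c <- s) c.1 * pair c.2 (boxtest a b N) @[N --> \oo] -->
    \sum_(c <- s) c.1 * vl c.2 (hbox a b).
  apply: cvg_rsum => c _; apply: cvgM; first exact: cvg_cst.
  exact: cvg_pair_boxtest.
have -> : (fun N => \sum_(c <- s) c.1 * pair c.2 (boxtest a b N)) = (fun=> 0).
  by apply/funext => N; apply: h; exact: nntest_boxtest.
move=> h2; have h3 : (0 : R) @[_ --> \oo] --> (0 : R) by exact: cvg_cst.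
by apply: cvg_unique h2 h3.
Qed.

Definition hinge (u : V) (c : R) : V -> R := fun x => Num.max 0 (dot u x - c).

Lemma convex_hinge u c : convex_fun (hinge u c).
Proof.
apply: convex_max; first exact: convex_cst.
by apply: convex_aff; exact: affine_dot.
Qed.

Lemma loc_bounded_hinge u c : loc_bounded (hinge u c).
Proof.
move=> r; have [C hC] := loc_bounded_dot u r; exists (C + `|c|) => x /hC h.
rewrite /hinge; move: h; rewrite ler_norml => /andP[h1 h2].
have := ler_norm c; have := ler_norm (- c); have := normr_ge0 c; rewrite normrN => ? ? ?.
by rewrite ler_norml; apply/andP; split; have [] := leP 0 (dot u x - c); lra.
Qed.

(** Let l = s (<u,x> - c). The functions f + s hinge and f + t hinge + l have maximum f + (s + t)
    hinge and minimum f + l, by inspection on both sides of <u,x> = c. The valuation property and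
    affine invariance do the rest. *)
Lemma val_hinge_add f u c s t B : convex_fun f -> 0 <= s -> 0 <= t -> bounded_borel B ->
  vl (fun x => f x + (s + t) * hinge u c x) B + vl f B =
  vl (fun x => f x + s * hinge u c x) B + vl (fun x => f x + t * hinge u c x) B.
Proof.
move=> cf s0 t0 bB; have ch := @convex_hinge u c.
pose l x := s * dot u x + - (s * c).
have la : affine_fun l.
  by exists (s *: u), (- (s * c)) => x; rewrite -/(dot _ _) dotZl.
pose F1 x := f x + s * hinge u c x.
pose F2 x := (f x + t * hinge u c x) + l x.
have cF1 : convex_fun F1 by apply: convexD => //; exact: convexZ.
have cF2' : convex_fun (fun x => f x + t * hinge u c x) by apply: convexD => //; exact: convexZ.
have cF2 : convex_fun F2 by apply: convexD => //; exact: convex_aff.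
have maxE : (fun x => Num.max (F1 x) (F2 x)) = (fun x => f x + (s + t) * hinge u c x).
  apply/funext => x; rewrite /F1 /F2 /l /hinge; set y := dot u x.
  have [h|h] := leP 0 (y - c).
    by rewrite max_r; [ring|have := mulr_ge0 t0 h; lra].
  by rewrite max_l; [ring|have := mulr_ge0_le0 s0 (ltW h); lra].
have minE : (fun x => Num.min (F1 x) (F2 x)) = (fun x => f x + l x).
  apply/funext => x; rewrite /F1 /F2 /l /hinge; set y := dot u x.
  have [h|h] := leP 0 (y - c).
    by rewrite min_l; [ring|have := mulr_ge0 t0 h; lra].
  by rewrite min_r; [ring|have := mulr_ge0_le0 s0 (ltW h); lra].
have cmin : convex_fun (fun x => Num.min (F1 x) (F2 x)).
  by rewrite minE; apply: convexD => //; exact: convex_aff.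
have := val_valuation Psi cF1 cF2 cmin bB.
by rewrite maxE minE (val_affine Psi cF2' la bB) (val_affine Psi cf la bB).
Qed.

(** The increment in t is additive by [val_hinge_add], hence linear once continuity is available,
    which is the case for pairings and not for values on sets. *)
Lemma pair_hinge_affine f u c t phi : convex_fun f -> 0 <= t -> nntest phi ->
  pair (fun x => f x + t * hinge u c x) phi =
  (1 - t) * pair f phi + t * pair (fun x => f x + hinge u c x) phi.
Proof.
move=> cf t0 tphi; have ch := @convex_hinge u c.
pose U s := pair (fun x => f x + s * hinge u c x) phi - pair f phi.
have UD s r : 0 <= s -> 0 <= r -> U (s + r) = U s + U r.
  move=> s0 r0.
  have := @pair_lincomb [:: (1, fun x => f x + (s + r) * hinge u c x); (1, f);
    (-1, fun x => f x + s * hinge u c x); (-1, fun x => f x + r * hinge u c x)] phi tphi.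
  rewrite !big_cons big_nil /= => h; apply/eqP; rewrite -subr_eq0 /U; apply/eqP.
  rewrite -[RHS]h; first by ring.
  move=> B bB; have := val_hinge_add u c cf s0 r0 bB.
  rewrite !big_cons big_nil /=; lra.
have := additive_continuous_linear UD.
have Uc (ts : nat -> R) (s : R) : (forall j, 0 <= ts j) -> 0 <= s ->
    ts j @[j --> \oo] --> s -> U (ts j) @[j --> \oo] --> U s.
  move=> ts0 s0 tss; apply: cvgB; last exact: cvg_cst.
  apply: (@cvg_pair (fun j x => f x + ts j * hinge u c x)) => //.
  - by move=> j; apply: convexD => //; exact: convexZ.
  - by apply: convexD => //; exact: convexZ.
  - by apply: luc_scale => //; exact: loc_bounded_hinge.
move=> /(_ Uc t t0); rewrite /U.
have -> : (fun x => f x + 1 * hinge u c x) = (fun x => f x + hinge u c x).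
  by apply/funext => x; rewrite mul1r.
lra.
Qed.

(** Cut [B] along <u,x> = a1. On the open side g1 is affine and drops out. The other side is not
    open, so locality needs a neighbourhood of it on which g2 vanishes: this is the overlap between
    a1 and a2. *)
Lemma val_separated f g1 g2 u (a1 a2 : R) (l : V -> R) B : convex_fun f ->
  convex_fun g1 -> convex_fun g2 -> affine_fun l -> a1 < a2 ->
  (forall x, a1 < dot u x -> g1 x = l x) -> (forall x, dot u x < a2 -> g2 x = 0) ->
  bounded_borel B ->
  vl (fun x => f x + g1 x + g2 x) B + vl f B =
  vl (fun x => f x + g1 x) B + vl (fun x => f x + g2 x) B.
Proof.
move=> cf cg1 cg2 al a12 g1l g20 bB.
have c1 : convex_fun (fun x => f x + g1 x) by exact: convexD.
have c2 : convex_fun (fun x => f x + g2 x) by exact: convexD.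
have c12 : convex_fun (fun x => f x + g1 x + g2 x) by exact: convexD.
have cu : continuous (dot u) by exact: continuous_dot.
have oU1 : open [set x | a1 < dot u x].
  rewrite (_ : [set _ | _] = dot u @^-1` [set y | a1 < y])//.
  by apply: open_comp => [z _|]; [exact: cu|exact: open_gt].
have oU2 : open [set x | dot u x < a2].
  rewrite (_ : [set _ | _] = dot u @^-1` [set y | y < a2])//.
  by apply: open_comp => [z _|]; [exact: cu|exact: open_lt].
have bB1 : bounded_borel (B `&` [set x | a1 < dot u x]).
  by apply: bborelI => //; exact: open_borel.
have bB2 : bounded_borel (B `&` ~` [set x | a1 < dot u x]).
  by apply: bborelI => //; apply: measurableC; exact: open_borel.
have BE : B = (B `&` [set x | a1 < dot u x]) `|` (B `&` ~` [set x | a1 < dot u x]).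
  by rewrite -setIUr setUv setIT.
have dis : (B `&` [set x | a1 < dot u x]) `&` (B `&` ~` [set x | a1 < dot u x]) = set0.
  by rewrite setIACA setICr setI0.
have split F : vl F B = vl F (B `&` [set x | a1 < dot u x]) + vl F (B `&` ~` [set x | a1 < dot u x]).
  by rewrite -valU// -BE.
have E1 : vl (fun x => f x + g1 x + g2 x) (B `&` [set x | a1 < dot u x]) =
          vl (fun x => f x + g2 x) (B `&` [set x | a1 < dot u x]).
  rewrite -(val_affine Psi c2 al bB1).
  apply: (val_local Psi c12 _ oU1) => //; first by apply: convexD => //; exact: convex_aff.
  by move=> x /= /g1l ->; ring.
have E2 : vl (fun x => f x + g1 x) (B `&` [set x | a1 < dot u x]) =
          vl f (B `&` [set x | a1 < dot u x]).
  rewrite -(val_affine Psi cf al bB1).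
  apply: (val_local Psi c1 _ oU1) => //; first by apply: convexD => //; exact: convex_aff.
  by move=> x /= /g1l ->.
have sub2 : B `&` ~` [set x | a1 < dot u x] `<=` [set x | dot u x < a2].
  by move=> x [_ /=] /negP; rewrite -leNgt => h; apply: le_lt_trans a12.
have E3 : vl (fun x => f x + g1 x + g2 x) (B `&` ~` [set x | a1 < dot u x]) =
          vl (fun x => f x + g1 x) (B `&` ~` [set x | a1 < dot u x]).
  by apply: (val_local Psi c12 c1 oU2) => // x /= /g20 ->; rewrite addr0.
have E4 : vl (fun x => f x + g2 x) (B `&` ~` [set x | a1 < dot u x]) =
          vl f (B `&` ~` [set x | a1 < dot u x]).
  by apply: (val_local Psi c2 cf oU2) => // x /= /g20 ->; rewrite addr0.
rewrite (split (fun x => f x + g1 x + g2 x)) (split f) (split (fun x => f x + g1 x)).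
rewrite (split (fun x => f x + g2 x)) E1 E2 E3 E4; ring.
Qed.

End SignedValuations.

(** * Reading off coefficients from growth at infinity *)

Section PolyGrowth.
Variable R : realType.

Lemma cvg_harmonicX (m : nat) : (j.+1%:R^-1 ^+ m : R) @[j --> \oo] --> ((m == 0)%N%:R : R).
Proof.
elim: m => [|m IH].
  by under eq_fun do rewrite expr0; exact: cvg_cst.
under eq_fun do rewrite exprS.
rewrite (_ : ((m.+1 == 0)%N%:R : R) = 0 * (m == 0)%N%:R); last by rewrite mul0r.
by apply: cvgM => //; exact: cvg_harmonic.
Qed.

Lemma cvg_horner_lead (p : {poly R}) d : (size p <= d.+1)%N ->
  (p.[j.+1%:R] * j.+1%:R^-1 ^+ d) @[j --> \oo] --> p`_d.
Proof.
move=> sp.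
have -> : (fun j => p.[j.+1%:R] * j.+1%:R^-1 ^+ d) =
    (fun j : nat => \sum_(i < d.+1) p`_i * j.+1%:R^-1 ^+ (d - i)).
  apply/funext => j; rewrite (horner_coef_wide _ sp) mulr_suml; apply: eq_bigr => i _.
  have j0 : j.+1%:R != 0 :> R by rewrite pnatr_eq0.
  have id : (i <= d)%N by rewrite -ltnS.
  rewrite -mulrA; congr (_ * _); move: (nat_of_ord i) id => e ed.
  by rewrite -{1}(subnK ed) [_ ^+ (_ + e)]exprD mulrCA -exprMn mulfV// expr1n mulr1.
have -> : p`_d = \sum_(i < d.+1) p`_i * ((d - i == 0)%N%:R : R).
  rewrite big_ord_recr /= subnn eqxx mulr1 big1 ?add0r// => i _.
  by rewrite subn_eq0 leqNgt ltn_ord mulr0.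
by apply: cvg_rsum => i _; apply: cvgM; [exact: cvg_cst|exact: cvg_harmonicX].
Qed.

(** If the degree d exceeded k, dividing by N^d would produce the nonzero leading coefficient in the
    limit, whereas the hypothesis forces the limit 0. *)
Lemma horner_growth (p : {poly R}) k (b : R) :
  (p.[j.+1%:R] * j.+1%:R^-1 ^+ k) @[j --> \oo] --> b ->
  (forall i, (k < i)%N -> p`_i = 0) /\ p`_k = b.
Proof.
move=> pb; have sp : (size p <= k.+1)%N.
  rewrite leqNgt; apply/negP => ksp; pose d := (size p).-1.
  have dE : size p = d.+1 by rewrite /d prednK// (leq_trans _ ksp).
  have kd : (k < d)%N by rewrite -ltnS -dE.
  have h1 : (p.[j.+1%:R] * j.+1%:R^-1 ^+ d) @[j --> \oo] --> p`_d.
    by apply: cvg_horner_lead; rewrite dE.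
  have h2 : (p.[j.+1%:R] * j.+1%:R^-1 ^+ d) @[j --> \oo] --> b * ((d - k == 0)%N%:R : R).
    under eq_fun do rewrite -(subnKC (ltnW kd)) exprD mulrA.
    by apply: cvgM => //; exact: cvg_harmonicX.
  have : p`_d = b * ((d - k == 0)%N%:R : R) by apply: cvg_unique h1 h2.
  rewrite subn_eq0 leqNgt kd mulr0 => /eqP; rewrite -[d]/((size p).-1).
  by rewrite -lead_coefE lead_coef_eq0 -size_poly_eq0 dE.
split; first by move=> i ki; rewrite nth_default// (leq_trans sp).
by have h := cvg_horner_lead sp; apply: cvg_unique h pb.
Qed.

End PolyGrowth.

(** * The square as a sum of hinges in one variable *)

Section SquareSums.
Variable R : realType.

(** The piecewise affine function formed by the tangents of y^2 at the even multiples of [d]: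
    neighbouring tangents meet at odd multiples, and the slope jumps there by 4 d. The tangent at 2
    j d differs from y^2 by (y - 2 j d)^2, at most d^2 where it is active. *)
Definition hinge_sum (d y : R) (m : nat) : R :=
  \sum_(j < m) 4 * d * Num.max 0 (y - (2 * j%:R + 1) * d).

Lemma hinge_sum_closed (d y : R) (m : nat) : 0 < d -> (2 * m%:R - 1) * d <= y ->
  hinge_sum d y m = 4 * d * (m%:R * y - m%:R ^+ 2 * d).
Proof.
move=> d0; elim: m => [|m IH] h; first by rewrite /hinge_sum big_ord0; ring.
rewrite /hinge_sum big_ord_recr /= -/(hinge_sum d y m) IH; last first.
  by apply: le_trans h; rewrite ler_pM2r// lerD2r ler_pM2l// ler_nat.
rewrite max_r; last by move: h; rewrite -natr1 => h; lra.
by rewrite -natr1; ring.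
Qed.

Lemma hinge_sum_approx (d y : R) (m : nat) : 0 < d -> 0 <= y <= (2 * m%:R + 1) * d ->
  0 <= y ^+ 2 - hinge_sum d y m <= d ^+ 2.
Proof.
move=> d0; elim: m => [|m IH] /andP[y0 ym].
  rewrite /hinge_sum big_ord0 subr0 sqr_ge0 /=.
  by move: ym; rewrite mulr0 add0r mul1r => ym; nra.
have [h|h] := leP y ((2 * m%:R + 1) * d).
  rewrite /hinge_sum big_ord_recr /= -/(hinge_sum d y m) max_l; last by lra.
  by rewrite mulr0 addr0 IH// y0.
rewrite hinge_sum_closed//; last by rewrite -natr1; lra.
have -> : y ^+ 2 - 4 * d * (m.+1%:R * y - m.+1%:R ^+ 2 * d) = (y - 2 * m.+1%:R * d) ^+ 2.
  by ring.
rewrite sqr_ge0 /=; move: ym; rewrite -natr1 => ym; set z := y - _.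
have h1 : - d <= z by rewrite /z -natr1; lra.
have h2 : z <= d by rewrite /z -natr1; lra.
by nra.
Qed.

End SquareSums.

(** * Valuations along sums of parallel hinges *)

Section Squares.
Variables (R : realType) (n k : nat) (Psi : sMA R n k).
Notation V := 'rV[R]_n.
Notation vl := (val Psi).
Notation pr := (pair Psi).
Implicit Types (f g : V -> R) (phi : V -> R) (B : set V) (u : V).

Lemma pair_affine f l phi : convex_fun f -> affine_fun l -> nntest phi ->
  pr (fun x => f x + l x) phi = pr f phi.
Proof.
move=> cf al tphi.
have := @pair_lincomb _ _ _ Psi [:: (1, fun x => f x + l x); (-1, f)] phi tphi.
rewrite !big_cons big_nil /= => h; apply/eqP; rewrite -subr_eq0 -[eqbRHS]h.
  by apply/eqP; ring.
by move=> B bB; rewrite !big_cons big_nil /= (val_affine Psi cf al bB); ring.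
Qed.

Lemma pair_homogeneous f t phi : convex_fun f -> 0 < t -> nntest phi ->
  pr (fun x => t * f x) phi = t ^+ k * pr f phi.
Proof.
move=> cf t0 tphi.
have := @pair_lincomb _ _ _ Psi [:: (1, fun x => t * f x); (- t ^+ k, f)] phi tphi.
rewrite !big_cons big_nil /= => h; apply/eqP; rewrite -subr_eq0 -[eqbRHS]h.
  by apply/eqP; ring.
by move=> B bB; rewrite !big_cons big_nil /= (val_homogeneous Psi cf t0 bB); ring.
Qed.

Definition hsum u (rho d : R) (m : nat) : V -> R :=
  fun x => \sum_(j < m) 4 * d * hinge u ((2 * j%:R + 1) * d - rho) x.

Lemma hsumE u rho d m x : hsum u rho d m x = hinge_sum d (dot u x + rho) m.
Proof.
apply: eq_bigr => j _; rewrite /hinge; congr (_ * Num.max _ _); ring.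
Qed.

Lemma convex_hsum u rho d m : 0 <= d -> convex_fun (hsum u rho d m).
Proof.
move=> d0; apply: convex_sum => j _; apply: convexZ; first by rewrite mulr_ge0.
exact: convex_hinge.
Qed.

(** Past the node of the last old hinge the old sum is affine, and the new hinge vanishes up to its
    own node, 2 d further on. By [val_separated] they do not interact. *)
Lemma val_hsumS f u rho d m t B : convex_fun f -> 0 <= t -> 0 < d -> bounded_borel B ->
  vl (fun x => f x + t * hsum u rho d m.+1 x) B + vl f B =
  vl (fun x => f x + t * hsum u rho d m x) B +
  vl (fun x => f x + (t * (4 * d)) * hinge u ((2 * m%:R + 1) * d - rho) x) B.
Proof.
move=> cf t0 d0 bB.
have hS m' x : hsum u rho d m'.+1 x =
    hsum u rho d m' x + 4 * d * hinge u ((2 * m'%:R + 1) * d - rho) x.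
  by rewrite /hsum big_ord_recr.
case: m => [|m].
  have -> : (fun x => f x + t * hsum u rho d 0 x) = f.
    by apply/funext => x; rewrite /hsum big_ord0 mulr0 addr0.
  rewrite addrC; congr (_ + vl _ _); apply/funext => x.
  by rewrite hS /hsum big_ord0 add0r mulrA.
pose g1 x := t * hsum u rho d m.+1 x.
pose g2 x := (t * (4 * d)) * hinge u ((2 * m.+1%:R + 1) * d - rho) x.
have -> : (fun x => f x + t * hsum u rho d m.+2 x) = (fun x => f x + g1 x + g2 x).
  by apply/funext => x; rewrite hS /g1 /g2; ring.
pose l x := t * \sum_(j < m.+1) 4 * d * (dot u x - ((2 * j%:R + 1) * d - rho)).
apply: (@val_separated _ _ _ Psi f g1 g2 u ((2 * m%:R + 1) * d - rho)
   ((2 * m.+1%:R + 1) * d - rho) l B) => //.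
- by apply: convexZ => //; apply: convex_hsum; exact: ltW.
- by apply: convexZ; [rewrite !mulr_ge0// ltW|exact: convex_hinge].
- exists ((t * (4 * d) * m.+1%:R) *: u),
    (- (t * \sum_(j < m.+1) 4 * d * ((2 * j%:R + 1) * d - rho))) => x.
  rewrite -/(dot _ _) dotZl /l.
  under eq_bigr do rewrite mulrBr.
  by rewrite sumrB sumr_const card_ord -mulr_natr; ring.
- by rewrite -natr1; have := d0; lra.
- move=> x h; rewrite /g1 /l /hsum; congr (_ * _); apply: eq_bigr => j _.
  rewrite /hinge max_r//; suff : (2 * j%:R + 1) * d <= (2 * m%:R + 1) * d by lra.
  by rewrite ler_pM2r// lerD2r ler_pM2l// ler_nat -ltnS.
- by move=> x h; rewrite /g2 /hinge max_l ?mulr0// subr_le0 ltW.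
Qed.

(** Parallel hinges with distinct nodes contribute independently, so the increments, each linear in
    t, add up without cross terms. *)
Lemma pair_hsum_affine f u rho d m t phi : convex_fun f -> 0 <= t -> 0 < d -> nntest phi ->
  pr (fun x => f x + t * hsum u rho d m x) phi =
  (1 - t) * pr f phi + t * pr (fun x => f x + hsum u rho d m x) phi.
Proof.
move=> cf t0 d0 tphi.
have step m' s : 0 <= s -> pr (fun x => f x + s * hsum u rho d m'.+1 x) phi =
  pr (fun x => f x + s * hsum u rho d m' x) phi +
  s * (4 * d) * (pr (fun x => f x + hinge u ((2 * m'%:R + 1) * d - rho) x) phi - pr f phi).
  move=> s0; have sd : 0 <= s * (4 * d) by rewrite !mulr_ge0// ltW.
  have := @pair_hinge_affine _ _ _ Psi f u ((2 * m'%:R + 1) * d - rho) _ phi cf sd tphi.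
  have := @pair_lincomb _ _ _ Psi [:: (1, fun x => f x + s * hsum u rho d m'.+1 x); (1, f);
   (-1, fun x => f x + s * hsum u rho d m' x);
   (-1, fun x => f x + (s * (4 * d)) * hinge u ((2 * m'%:R + 1) * d - rho) x)] phi tphi.
  rewrite !big_cons big_nil /= => h1 h2.
  unshelve epose proof (h1 _) as h3.
    move=> B bB; have := val_hsumS u rho m' cf s0 d0 bB.
    by rewrite !big_cons big_nil /=; lra.
  by move: h2 h3; move: (pr _ phi) (pr _ phi) (pr _ phi) (pr _ phi) (pr _ phi)
      => a1 a2 a3 a4 a5; lra.
have one m' : (fun x => f x + hsum u rho d m' x) = (fun x => f x + 1 * hsum u rho d m' x).
  by apply/funext => x; rewrite mul1r.
rewrite one; elim: m => [|m IH].
  have E s : (fun x => f x + s * hsum u rho d 0 x) = f.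
    by apply/funext => x; rewrite /hsum big_ord0 mulr0 addr0.
  by rewrite !E; ring.
rewrite (step m t)// (step m 1)// IH; ring.
Qed.

End Squares.

(** * Affinity in squares and polynomial expansion along quadratic forms *)

Section Quadratics.
Variables (R : realType) (n k : nat) (Psi : sMA R n k).
Notation V := 'rV[R]_n.
Notation vl := (val Psi).
Notation pr := (pair Psi).
Implicit Types (f g : V -> R) (phi : V -> R) (B : set V) (u : V).

Definition sq u : V -> R := fun x => dot u x ^+ 2.

(** Approximates <u,x>^2 on |<u,x>| <= j: shift to y = <u,x> + j in [0, 2 j], approximate y^2 by
    hinges, then subtract the affine 2 j <u,x> + j^2. With d = 1/(j+1), j (j+1) hinges reach up to 2
    j + d. *)
Definition hsq u (j : nat) : V -> R := fun x =>
  hsum u j%:R j.+1%:R^-1 (j * j.+1) x + (- (2 * j%:R) * dot u x - j%:R ^+ 2).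

Lemma hsq_approx u j x : `|dot u x| <= j%:R -> `|hsq u j x - sq u x| <= j.+1%:R^-1 ^+ 2.
Proof.
rewrite ler_norml => /andP[h1 h2]; rewrite /hsq /sq hsumE.
have d0 : 0 < j.+1%:R^-1 :> R by rewrite invr_gt0 ltr0n.
have := @hinge_sum_approx R j.+1%:R^-1 (dot u x + j%:R) (j * j.+1) d0.
have j0 : j.+1%:R != 0 :> R by rewrite pnatr_eq0.
have -> : (2 * (j * j.+1)%:R + 1) * j.+1%:R^-1 = 2 * j%:R + j.+1%:R^-1 :> R.
  by rewrite natrM mulrDl mul1r mulrA mulfK.
move: (hinge_sum _ _ _) => H; move: (dot u x) h1 h2 => y h1 h2.
move: (j.+1%:R^-1) d0 => d d0 h.
have /h/andP[h3 h4] : 0 <= y + j%:R <= 2 * j%:R + d by apply/andP; split; lra.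
rewrite (_ : _ - y ^+ 2 = - ((y + j%:R) ^+ 2 - H)); last by ring.
by rewrite normrN ger0_norm.
Qed.

Lemma luc_hsq f u t : 0 <= t ->
  loc_unif_cvg (fun j x => f x + t * hsq u j x) (fun x => f x + t * sq u x).
Proof.
move=> t0 r e e0; have [C hC] := @loc_bounded_dot R n u r.
have : (t * j.+1%:R^-1 ^+ 2 : R) @[j --> \oo] --> (0 : R).
  rewrite -[X in _ --> X](mulr0 t); apply: cvgM; first exact: cvg_cst.
  exact: (@cvg_harmonicX R 2).
move=> /cvgrPdist_le /(_ e e0) [N1 _ hN1].
have [N2 _ hN2] : \forall j \near \oo, C <= j%:R by exact: nbhs_infty_ger.
exists (maxn N1 N2) => j; rewrite geq_max => /andP[j1 j2] x xr.
rewrite opprD addrACA subrr add0r -mulrBr normrM (ger0_norm t0).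
have := hN1 j j1; rewrite /= sub0r normrN; apply: le_trans.
rewrite [leRHS]ger0_norm; last by rewrite mulr_ge0// exprn_ge0// invr_ge0.
apply: ler_wpM2l => //; apply: hsq_approx; apply: le_trans (hC x xr) _; exact: hN2.
Qed.

(** Affine terms are invisible to Psi, so [hsq] inherits affinity in t from [pair_hsum_affine];
    local uniform convergence carries it to the square. *)
Lemma pair_sq_affine f u t phi : convex_fun f -> 0 <= t -> nntest phi ->
  pr (fun x => f x + t * sq u x) phi =
  (1 - t) * pr f phi + t * pr (fun x => f x + sq u x) phi.
Proof.
move=> cf t0 tphi.
have hsqE s j : 0 <= s -> pr (fun x => f x + s * hsq u j x) phi =
    (1 - s) * pr f phi + s * pr (fun x => f x + hsum u j%:R j.+1%:R^-1 (j * j.+1) x) phi.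
  move=> s0; have d0 : 0 < j.+1%:R^-1 :> R by rewrite invr_gt0 ltr0n.
  rewrite -(pair_hsum_affine Psi _ _ _ cf s0 d0 tphi).
  rewrite -[RHS](@pair_affine _ _ _ _ _ (fun x => s * (- (2 * j%:R) * dot u x - j%:R ^+ 2)))//.
  - by congr (pr _ _); apply/funext => x; rewrite /hsq; ring.
  - by apply: convexD => //; apply: convexZ => //; apply: convex_hsum; exact: ltW.
  - exists ((s * - (2 * j%:R)) *: u), (- (s * j%:R ^+ 2)) => x.
    by rewrite -/(dot _ _) dotZl; ring.
have chsq j : convex_fun (hsq u j).
  apply: convexD; first by apply: convex_hsum; rewrite invr_ge0.
  apply: convex_aff; exists (- (2 * j%:R) *: u), (- j%:R ^+ 2) => x.
  by rewrite -/(dot _ _) dotZl.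
have cv s : 0 <= s -> pr (fun x => f x + s * hsq u j x) phi @[j --> \oo] -->
    pr (fun x => f x + s * sq u x) phi.
  move=> s0; apply: (@cvg_pair _ _ _ Psi (fun j x => f x + s * hsq u j x)) => //.
  - by move=> j; apply: convexD => //; exact: convexZ.
  - by apply: convexD => //; apply: convexZ => //; exact: convex_sq.
  - exact: luc_hsq.
have h1 := cv t t0; have h2 := cv 1 ler01.
have E1 : (fun x => f x + 1 * sq u x) = (fun x => f x + sq u x).
  by apply/funext => x; rewrite mul1r.
rewrite E1 in h2.
have : pr (fun x => f x + t * hsq u j x) phi @[j --> \oo] -->
    (1 - t) * pr f phi + t * pr (fun x => f x + sq u x) phi.
  have -> : (fun j => pr (fun x => f x + t * hsq u j x) phi) =
     (fun j => (1 - t) * pr f phi + t * pr (fun x => f x + 1 * hsq u j x) phi).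
    by apply/funext => j; rewrite !hsqE//; ring.
  by apply: cvgD; [exact: cvg_cst|apply: cvgM => //; exact: cvg_cst].
by move=> h3; apply: cvg_unique h1 h3.
Qed.

Lemma val_sq_affine f u t a b : convex_fun f -> 0 <= t ->
  vl (fun x => f x + t * sq u x) (hbox a b) =
  (1 - t) * vl f (hbox a b) + t * vl (fun x => f x + sq u x) (hbox a b).
Proof.
move=> cf t0.
have := @box_lincomb _ _ _ Psi [:: (1, fun x => f x + t * sq u x); (- (1 - t), f);
   (- t, fun x => f x + sq u x)] a b.
rewrite !big_cons big_nil /= => h.
unshelve epose proof (h _) as h3.
  by move=> phi tphi; rewrite !big_cons big_nil /= pair_sq_affine//; ring.
by move: h3; move: (vl _ _) (vl _ _) (vl _ _) => a1 a2 a3; lra.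
Qed.

Definition quad (us : 'I_n -> V) (lam : 'I_n -> R) : V -> R :=
  fun x => \sum_(i < n) lam i * sq (us i) x.

Lemma convex_quad us lam : (forall i, 0 <= lam i) -> convex_fun (quad us lam).
Proof.
move=> lam0; apply: convex_sum => i _; apply: convexZ => //; exact: convex_sq.
Qed.

(** Common to pairing with a test function and to evaluation on a box, so that one expansion serves
    both. *)
Definition sq_affine (Phi : (V -> R) -> R) := forall f u t, convex_fun f -> 0 <= t ->
  Phi (fun x => f x + t * sq u x) = (1 - t) * Phi f + t * Phi (fun x => f x + sq u x).

Lemma multiaffine_quad Phi f us (cs : 'I_n -> R) : sq_affine Phi -> convex_fun f ->
  (forall i, 0 <= cs i) ->
  multiaffine (fun lam => Phi (fun x => f x + quad us (fun i => lam i * cs i) x)).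
Proof.
move=> aPhi cf cs0 lam i t lam0 t0.
pose f0 x := f x + quad us (fun j => upd lam i 0 j * cs j) x.
have cf0 : convex_fun f0.
  apply: convexD => //; apply: convex_quad => j; rewrite mulr_ge0//.
  by rewrite /upd; case: eqP.
have E s : (fun x => f x + quad us (fun j => upd lam i s j * cs j) x) =
    (fun x => f0 x + (s * cs i) * sq (us i) x).
  apply/funext => x; rewrite /f0 /quad (bigD1 i)//= [in RHS](bigD1 i)//= /upd eqxx.
  rewrite !mul0r add0r -!addrA; congr (_ + _); rewrite addrC; congr (_ + _).
  by apply: eq_bigr => j /negbTE ->.
rewrite !E aPhi ?mulr_ge0// (aPhi f0 _ (0 * cs i)) ?mul0r// (aPhi f0 _ (1 * cs i)) ?mul1r//.
ring.
Qed.

(** The Bernstein weight of the vertex [J] at the diagonal point (t, ..., t), as a polynomial in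
    t. *)
Definition bernc (J : {set 'I_n}) : {poly R} := \prod_(i < n) (if i \in J then 'X else 1 - 'X).

(** The coefficient of t^i in Phi (P + t quad), expressed through vertex values: a bound on these
    bounds the coefficient, and relations between coefficients are linear relations between values
    of Phi. *)
Definition quadcoef (Phi : (V -> R) -> R) P us cs (i : nat) : R :=
  \sum_(J : {set 'I_n}) (bernc J)`_i * Phi (fun x => P x + quad us (fun i => indv R J i * cs i) x).

Lemma size_bernc J : (size (bernc J) <= n.+1)%N.
Proof.
rewrite /bernc; apply: leq_trans (size_prod_leq _ _) _.
have sz (i : 'I_n) : (size ((if i \in J then 'X else 1 - 'X)%R : {poly R}) <= 2)%N.
  case: ifP => _; first by rewrite size_polyX.
  by apply: leq_trans (size_polyD _ _) _; rewrite size_polyN size_polyX size_polyC oner_eq0.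
rewrite leq_subLR card_ord addnS ltnS.
apply: leq_trans (_ : \sum_(i < n) 2 <= _)%N; first by apply: leq_sum.
by rewrite sum_nat_const card_ord muln2 addnn.
Qed.

Lemma quad_expansion Phi P us cs t : sq_affine Phi -> convex_fun P ->
  (forall i, 0 <= cs i) -> 0 <= t ->
  Phi (fun x => P x + t * quad us cs x) = \sum_(i < n.+1) quadcoef Phi P us cs i * t ^+ i.
Proof.
move=> aPhi cP cs0 t0.
have -> : (fun x => P x + t * quad us cs x) = (fun x => P x + quad us (fun i => t * cs i) x).
  apply/funext => x; congr (_ + _); rewrite /quad mulr_sumr.
  by apply: eq_bigr => i _; rewrite mulrA.
rewrite (@multiaffine_bernstein _ _ _ (multiaffine_quad us aPhi cP cs0) (fun=> t))//.
rewrite /quadcoef; under [RHS]eq_bigr do rewrite mulr_suml; rewrite exchange_big /=.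
apply: eq_bigr => J _; under [RHS]eq_bigr do rewrite mulrAC; rewrite -[RHS]mulr_suml; congr (_ * _).
rewrite -(horner_coef_wide _ (size_bernc J)) /bernc horner_prod; apply: eq_bigr => i _.
by case: ifP => _; rewrite !hornerE.
Qed.

(** By homogeneity the expansion at t = N, divided by N^k, is the pairing for quad + P / N, which
    converges to the pairing for quad. [horner_growth] then applies. *)
Lemma quadcoef_pair P us cs phi : convex_fun P -> loc_bounded P -> (forall i, 0 <= cs i) -> nntest phi ->
  (forall i, (k < i)%N -> quadcoef (pr^~ phi) P us cs i = 0) /\
  quadcoef (pr^~ phi) P us cs k = pr (quad us cs) phi.
Proof.
move=> cP lP cs0 tphi; have aPhi : sq_affine (pr^~ phi) by move=> f u t cf t0; exact: pair_sq_affine.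
have cq : convex_fun (quad us cs) by exact: convex_quad.
pose p := \poly_(i < n.+1) quadcoef (pr^~ phi) P us cs i.
have q0 i : (n < i)%N -> quadcoef (pr^~ phi) P us cs i = 0.
  by move=> ni; apply: big1 => J _; rewrite nth_default ?mul0r// (leq_trans (size_bernc J)).
have pE i : p`_i = quadcoef (pr^~ phi) P us cs i.
  by rewrite coef_poly; case: ltnP => // /q0 ->.
have [h1 h2] : (forall i, (k < i)%N -> p`_i = 0) /\ p`_k = pr (quad us cs) phi.
  apply: horner_growth.
  have -> : (fun j => p.[j.+1%:R] * j.+1%:R^-1 ^+ k) =
      (fun j : nat => pr (fun x => quad us cs x + j.+1%:R^-1 * P x) phi).
    apply/funext => j; have j0 : 0 < j.+1%:R :> R by rewrite ltr0n.
    rewrite horner_poly -quad_expansion// mulrC -pair_homogeneous ?invr_gt0//; last first.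
      by apply: convexD => //; exact: convexZ.
    congr (pr _ _); apply/funext => x.
    by rewrite mulrDr mulrA mulVf ?gt_eqF// mul1r addrC.
  rewrite [X in pr X phi](_ : quad us cs = (fun x => quad us cs x + 0 * P x)); last first.
    by apply/funext => x; rewrite mul0r addr0.
  apply: (@cvg_pair _ _ _ Psi (fun (j : nat) x => quad us cs x + j.+1%:R^-1 * P x)) => //.
  - by move=> j; apply: convexD => //; apply: convexZ => //; rewrite invr_ge0.
  - by apply: convexD => //; exact: convexZ.
  - by apply: luc_scale => //; exact: cvg_harmonic.
split; first by move=> i ki; rewrite -pE h1.
by rewrite -pE.
Qed.

(** The limit behind this exists for pairings only; the resulting relations are linear in values of
    Psi, so [box_lincomb] transports them. *)
Lemma quadcoef_val P us cs a b : convex_fun P -> loc_bounded P -> (forall i, 0 <= cs i) ->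
  (forall i, (k < i)%N -> quadcoef (vl^~ (hbox a b)) P us cs i = 0) /\
  quadcoef (vl^~ (hbox a b)) P us cs k = vl (quad us cs) (hbox a b).
Proof.
move=> cP lP cs0.
pose s (i : nat) := [seq ((bernc J)`_i, fun x => P x + quad us (fun i => indv R J i * cs i) x)
  | J <- index_enum {set 'I_n}].
split=> [i ki|].
  have := @box_lincomb _ _ _ Psi (s i) a b; rewrite /s big_map; apply => phi tphi.
  by rewrite big_map; have [h _] := quadcoef_pair us cP lP cs0 tphi; exact: h.
have := @box_lincomb _ _ _ Psi ((-1, quad us cs) :: s k) a b.
rewrite /s big_cons big_map /= => h.
unshelve epose proof (h _) as h3.
  move=> phi tphi; rewrite big_cons big_map /=.
  have [_] := quadcoef_pair us cP lP cs0 tphi; rewrite /quadcoef => ->; ring.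
by move: h3; rewrite -/(quadcoef (vl^~ (hbox a b)) P us cs k); lra.
Qed.

Definition bern_norm : R := \sum_(i < n.+1) \sum_(J : {set 'I_n}) `|(bernc J)`_i|.

Lemma bern_norm_ge0 : 0 <= bern_norm.
Proof. by apply: sumr_ge0 => i _; apply: sumr_ge0. Qed.

(** Write e P + quad = e (P + e^-1 quad). Homogeneity and the expansion in e^-1 give the sum of w_i
    e^k e^-i. Terms with i > k vanish, i = k is the unperturbed value, and for i < k the factor
    e^(k-i) is at most e. *)
Lemma val_perturbation P us cs a b (e D : R) : convex_fun P -> loc_bounded P ->
  (forall i, 0 <= cs i) -> 0 < e <= 1 ->
  (forall J : {set 'I_n},
     `|vl (fun x => P x + quad us (fun i => indv R J i * cs i) x) (hbox a b)| <= D) ->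
  `|vl (fun x => e * P x + quad us cs x) (hbox a b) - vl (quad us cs) (hbox a b)|
    <= e * (bern_norm * D).
Proof.
move=> cP lP cs0 /andP[e0 e1] hD.
have cq : convex_fun (quad us cs) by exact: convex_quad.
have aPhi : sq_affine (vl^~ (hbox a b)) by move=> f u t cf t0; exact: val_sq_affine.
have [h1 h2] := quadcoef_val us a b cP lP cs0.
pose w i := quadcoef (vl^~ (hbox a b)) P us cs i.
have -> : vl (fun x => e * P x + quad us cs x) (hbox a b) =
    e ^+ k * \sum_(i < n.+1) w i * e^-1 ^+ i.
  rewrite -quad_expansion ?invr_ge0 ?(ltW e0)// -val_homogeneous//; first last.
  - exact: bborel_hbox.
  - by apply: convexD => //; apply: convexZ => //; rewrite invr_ge0 ltW.
  congr (vl _ _); apply/funext => x.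
  by rewrite mulrDr mulrA mulfV ?gt_eqF// mul1r.
have -> : vl (quad us cs) (hbox a b) = \sum_(i < n.+1) (i == k :> nat)%:R * w i.
  (* For k > n the index k is outside the sum; the coefficient is then 0, since Bernstein weights
     have degree at most n. *)
  rewrite -h2 -/(w k); have [kn|nk] := leqP k n.
    rewrite (bigD1 (Ordinal (kn : (k < n.+1)%N)))//= eqxx mul1r big1 ?addr0// => i /negbTE ik.
    by rewrite (_ : (i == k :> nat) = false) ?mul0r.
  rewrite big1; last by move=> i _; rewrite (_ : (i == k :> nat) = false) ?mul0r// ltn_eqF// (leq_trans _ nk).
  by apply: big1 => J _; rewrite nth_default ?mul0r// (leq_trans (size_bernc J)).
rewrite mulr_sumr -sumrB /bern_norm !mulr_suml mulr_sumr.
apply: le_trans (ler_norm_sum _ _ _) _; apply: ler_sum => i _.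
have wD : `|w i| <= (\sum_(J : {set 'I_n}) `|(bernc J)`_i|) * D.
  rewrite mulr_suml; apply: le_trans (ler_norm_sum _ _ _) _; apply: ler_sum => J _.
  by rewrite normrM ler_wpM2l.
apply: le_trans (_ : e * `|w i| <= _); last by rewrite ler_pM2l.
case: (ltngtP i k) => ik.
- rewrite mul0r subr0 mulrCA normrM mulrC ler_wpM2r//.
  rewrite -(subnK (ltnW ik)) exprD -mulrA -exprMn mulfV ?gt_eqF// expr1n mulr1.
  rewrite -(prednK (_ : 0 < k - i)%N) ?subn_gt0// exprS normrM gtr0_norm//.
  by rewrite -[leRHS]mulr1 ler_pM2l// ger0_norm ?exprn_ge0 ?exprn_ile1// ltW.
- by rewrite /w h1// !(mul0r, mulr0) subrr normr0 ?mulr0.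
- rewrite -ik mul1r mulrCA -exprMn mulfV ?gt_eqF// expr1n mulr1 subrr normr0.
  by rewrite mulr_ge0// ltW.
Qed.

End Quadratics.

(** * Packing local pieces into one convex function *)

Section Packing.
Variables (R : realType) (n : nat).
Notation V := 'rV[R]_n.

(** Open, and wider by [r] on each side than the cube [0, r)^n, because locality can be used only on
    an open neighbourhood of the cube. *)
Definition cellN (r : R) : set V := [set y | forall i, - r < y ord0 i < 2 * r].

(* [G] plays the role of the gradient: [p] differs from a convex function by [kap |y|^2], and
   [p], [G] have the size allowed by scaling on a cell of side [r]. *)
Definition tame (kap r : R) (p : V -> R) (G : V -> V) : Prop :=
  forall y, cellN r y -> [/\ `|p y| <= kap * r ^+ 2, (forall i, `|G y ord0 i| <= kap * r) &
    forall w, cellN r w -> p y + dot (G y) (w - y) - kap * dot (w - y) (w - y) <= p w].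

(** Between different cells at displacement d, the penalty C |d|^2 must absorb kap |d|^2 from each
    of the two values of p and kap (n + 1) |d|^2 from the slope term. *)
Definition packC (kap : R) : R := (n%:R + 3) * kap.

Lemma dot_le_tame (kap r : R) (G d : V) : 0 <= kap -> 0 < r ->
  (forall i, `|G ord0 i| <= kap * r) -> dot G d <= kap * (n%:R * r ^+ 2 + dot d d).
Proof.
move=> k0 r0 hG; have -> : n%:R * r ^+ 2 = \sum_(i < n) r ^+ 2.
  by rewrite sumr_const card_ord mulr_natl.
rewrite /dot -big_split mulr_sumr; apply: ler_sum => i _.
apply: le_trans (ler_norm _) _; rewrite normrM.
apply: le_trans (_ : kap * r * `|d ord0 i| <= _); first by rewrite ler_wpM2r.
rewrite -mulrA ler_wpM2l//= -expr2 -[X in _ <= _ + X](real_normK (num_real _)).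
have := normr_ge0 (d ord0 i); move: `|_| => z z0; nra.
Qed.

(** E is the supremum of affine functions touching C |x|^2 + p in the cells, with slope 2 C x + G.
    Within a cell semiconvexity of p keeps them below the function. Between cells the penalty C
    |d|^2 does so, the distance being at least both scales. *)
Lemma packing (I : Type) (Pd : set I) (r : I -> R) (z : I -> V) (p : I -> V -> R)
    (G : I -> V -> V) (kap : R) : 0 <= kap -> Pd !=set0 ->
  (forall i, Pd i -> 0 < r i <= 1 /\ tame kap (r i) (p i) (G i)) ->
  (forall i j, Pd i -> Pd j -> i = j \/
     forall y w, cellN (r i) y -> cellN (r j) w ->
       exists c : 'I_n, r i <= `|(z j + w - (z i + y)) ord0 c| /\
                        r j <= `|(z j + w - (z i + y)) ord0 c|) ->
  exists E : V -> R, [/\ convex_fun E, loc_bounded E &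
    forall i, Pd i -> forall y, cellN (r i) y ->
      E (z i + y) = packC kap * dot (z i + y) (z i + y) + p i y].
Proof.
move=> k0 [i0 Pi0] hr sep; pose C := packC kap.
have C0 : 0 <= C by rewrite mulr_ge0// addr_ge0.
pose T (q : I * V) (x : V) := C * dot (z q.1 + q.2) (z q.1 + q.2) + p q.1 q.2 +
  dot (G q.1 q.2 + (2 * C) *: (z q.1 + q.2)) (x - (z q.1 + q.2)).
(* Completing the square: the tangent of C |x|^2 taken at Y falls short of it by C |x - Y|^2, the
   penalty used in every estimate below. *)
have TE q x : T q x = C * dot x x - C * dot (x - (z q.1 + q.2)) (x - (z q.1 + q.2)) +
    p q.1 q.2 + dot (G q.1 q.2) (x - (z q.1 + q.2)).
  rewrite /T; set Y := z _ + _; rewrite dotDl dotZl !dotBr !dotBl !(dotC _ Y); ring.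
pose S : set (I * V) := [set q | Pd q.1 /\ cellN (r q.1) q.2].
pose M (x : V) := C * dot x x + kap * (1 + n%:R).
have kn0 : 0 <= kap * n%:R by rewrite mulr_ge0.
have T_le q x : S q -> T q x <= M x.
  move=> [Pq hq]; have [/andP[r0 r1] tq] := hr _ Pq; have [hp hG _] := tq _ hq.
  rewrite TE /M; set d := x - _; have := dot_le_tame d k0 r0 hG.
  have := dot_ge0 d => d0; move: hp; rewrite ler_norml => /andP[_ hp].
  have r2 : r q.1 ^+ 2 <= 1 by rewrite expr_le1// ltW.
  have := ler_wpM2l k0 r2; have := ler_wpM2l kn0 r2.
  have : kap * dot d d <= C * dot d d.
    rewrite ler_wpM2r// /C /packC mulrDl; move: kn0; rewrite mulrC; lra.
  by move: (dot (G _ _) d) (dot d d) (dot x x) => ? ? ?; lra.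
have zero_cell s : 0 < s -> cellN s 0 by move=> s0 i; rewrite mxE; apply/andP; split; lra.
have S0 : S (i0, 0) by split => //=; apply: zero_cell; have [/andP[]] := hr _ Pi0.
pose E x := sup [set T q x | q in S].
have hsE x : has_sup [set T q x | q in S].
  split; first by exists (T (i0, 0) x), (i0, 0).
  by exists (M x) => _ [q Sq <-]; exact: T_le.
have T_leE q x : S q -> T q x <= E x by move=> Sq; apply: sup_upper_bound => //; exists q.
have E_le x c : (forall q, S q -> T q x <= c) -> E x <= c.
  by move=> h; apply: ge_sup; [have [] := hsE x|move=> _ [q Sq <-]; exact: h].
exists E; split.
- move=> x y t t0 t1; apply: E_le => q Sq.
  have -> : T q ((1 - t) *: x + t *: y) = (1 - t) * T q x + t * T q y.
    by rewrite /T !dotBr !dotDr !dotZr; ring.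
  have t1' : 0 <= 1 - t by rewrite subr_ge0.
  by rewrite lerD// ler_wpM2l// T_leE.
- have lx : loc_bounded (fun x : V => dot x x).
    move=> s; exists (n%:R * (s * s)) => x xs; apply: le_trans (dot_le_norm x x) _.
    by rewrite ler_wpM2l// ler_pM.
  have lT : loc_bounded (T (i0, 0)).
    rewrite /T /=; apply: loc_boundedD; first by move=> s; eexists => x _.
    under eq_fun do rewrite dotBr; apply: loc_boundedD; first exact: loc_bounded_dot.
    by move=> s; eexists => x _.
  move=> s; have [A hA] := lx s; have [B hB] := lT s.
  exists (C * A + kap * (1 + n%:R) + B) => x xs.
  have [h1 h2] := (hA x xs, hB x xs).
  have h3 := T_leE _ x S0; have h4 : E x <= M x by apply: E_le => q; exact: T_le.
  move: h1 h2; rewrite !ler_norml => /andP[_ h1] /andP[h2 h2'].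
  have := ler_wpM2l C0 h1; have := mulr_ge0 k0 (addr_ge0 ler01 (ler0n R n)).
  have := mulr_ge0 C0 (dot_ge0 x).
  by rewrite /M in h4; move=> ? ? ?; apply/andP; split; lra.
- move=> i Pi w hw; apply/eqP; rewrite eq_le; apply/andP; split; last first.
    have /(T_leE _ (z i + w)) : S (i, w) by [].
    by rewrite /T /= subrr dot0r addr0.
  apply: E_le => -[j y] [/= Pj hy]; rewrite TE /=; set d := z i + w - (z j + y).
  have [/andP[rj0 rj1] tj] := hr _ Pj; have [hp hG hpy] := tj _ hy.
  have [/andP[ri0 ri1] ti] := hr _ Pi; have [hp' _ _] := ti _ hw.
  rewrite -!addrA lerD2l addrC.
  have [eji|sepji] := sep j i Pj Pi.
    subst j; have := hpy _ hw.
    have -> : d = w - y by rewrite /d opprD addrACA subrr add0r.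
    have d0 := dot_ge0 (w - y).
    have : kap * dot (w - y) (w - y) <= C * dot (w - y) (w - y).
      rewrite ler_wpM2r// /C /packC mulrDl; move: kn0; rewrite mulrC; lra.
    by move: (dot (G _ _) _) (dot (w - y) _) => ? ?; lra.
  have [c [c1 c2]] := sepji y w hy hw.
  rewrite -/d in c1 c2.
  have sqle s : 0 < s -> s <= `|d ord0 c| -> s ^+ 2 <= dot d d.
    move=> s0 sd; apply: le_trans (_ : d ord0 c ^+ 2 <= _).
      by rewrite -[leRHS](real_normK (num_real _)) lerXn2r// nnegrE ltW.
    rewrite /dot (bigD1 c)//= -expr2 lerDl; apply: sumr_ge0 => l _.
    by rewrite -expr2 sqr_ge0.
  have := dot_le_tame d k0 rj0 hG.
  have := ler_wpM2l k0 (sqle _ ri0 c2).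
  have := ler_wpM2l k0 (sqle _ rj0 c1); have := ler_wpM2l kn0 (sqle _ rj0 c1).
  move: hp hp'; rewrite !ler_norml => /andP[_ hp] /andP[hp' _].
  rewrite /C /packC.
  by move: (dot (G _ _) d) (dot d d) => ? ?; lra.
Qed.

Lemma open_cellN r : open (cellN r).
Proof.
rewrite openE => y hy; apply: (@filter_forall _ _ (fun (i : 'I_n) (y : V) => - r < y ord0 i < 2 * r) (nbhs y)) => i.
apply: (@coord_continuous _ _ _ ord0 i y (`]- r, 2 * r[%classic)).
by apply: open_nbhs_nbhs; split; [exact: interval_open|rewrite /= in_itv /=; exact: hy].
Qed.

End Packing.

(** * Boxes made of grid cells *)

Section GridBoxes.
Variables (R : realType) (n : nat).
Notation V := 'rV[R]_n.
Implicit Types (a : V) (r : R) (l : 'I_n -> nat).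

Definition gbox a r l : set V := hbox a (a + \row_i (r * (l i)%:R)).

Definition updn l (i : 'I_n) (s : nat) : 'I_n -> nat := fun j => if j == i then s else l j.

Definition gshift a r (i : 'I_n) (s : nat) : V := a + (r * s%:R) *: delta_mx ord0 i.

Lemma gbox_empty a r l i : l i = 0%N -> gbox a r l = set0.
Proof.
move=> li; rewrite -subset0 => x /(_ i); rewrite !mxE li mulr0 addr0.
by move=> /andP[h1 h2]; have := le_lt_trans h1 h2; rewrite ltxx.
Qed.

Lemma gbox_split a r l i s t : 0 <= r ->
  gbox a r (updn l i (s + t)) = gbox a r (updn l i s) `|` gbox (gshift a r i s) r (updn l i t) /\
  gbox a r (updn l i s) `&` gbox (gshift a r i s) r (updn l i t) = set0.
Proof.
move=> r0; have rs0 : 0 <= r * s%:R by rewrite mulr_ge0.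
have rt0 : 0 <= r * t%:R by rewrite mulr_ge0.
split; last first.
  rewrite -subset0 => x [/(_ i) + /(_ i)]; rewrite !mxE /updn !eqxx mulr1.
  by move=> /andP[_ h1] /andP[h2 _]; have := lt_le_trans h1 h2; rewrite ltxx.
apply/seteqP; split => x.
  move=> h; have [hx|hx] := ltP (x ord0 i) (a ord0 i + r * s%:R); [left|right] => j;
    have := h j; rewrite !mxE /updn; case: (j =P i) => [->|_] //.
  - by rewrite hx andbT => /andP[].
  - by rewrite eqxx /= mulr1 natrD => /andP[h1 h2]; apply/andP; split; lra.
  - by rewrite eqxx /= mulr0 addr0.
move=> [] h j; have := h j; rewrite !mxE /updn; case: (j =P i) => [->|_] //.
- by rewrite natrD => /andP[h1 h2]; apply/andP; split; lra.
- by rewrite eqxx /= mulr1 natrD => /andP[h1 h2]; apply/andP; split; lra.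
- by rewrite eqxx /= mulr0 addr0.
Qed.

(** Stands in for summation over grid cells: a statement about single cells that survives gluing two
    boxes along a grid hyperplane holds for every grid box. *)
Lemma gbox_ind (P : V -> ('I_n -> nat) -> Prop) r :
  (forall a l i, l i = 0%N -> P a l) ->
  (forall a, P a (fun=> 1%N)) ->
  (forall a l i s t, (0 < s)%N -> (0 < t)%N -> P a (updn l i s) ->
     P (gshift a r i s) (updn l i t) -> P a (updn l i (s + t))) ->
  forall a l, P a l.
Proof.
move=> P0 P1 PS a l; have [m] := ubnP (\sum_i l i); elim: m a l => // m IH a l.
rewrite ltnS => lm.
have [/existsP[i /eqP li]|] := boolP [exists i, l i == 0%N]; first exact: P0 li.
rewrite negb_exists => /forallP lpos.
have [/existsP[i li]|] := boolP [exists i, (1 < l i)%N]; last first.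
  rewrite negb_exists => /forallP l1; have -> : l = fun=> 1%N; last exact: P1.
  by apply/funext => i; have := l1 i; have := lpos i; case: (l i) => [|[|]].
(* One layer of cells is cut off a side longer than 1; both parts then have a smaller sum of side
   counts. *)
have updl : l = updn l i (1 + (l i).-1).
  by apply/funext => j; rewrite /updn add1n prednK ?(ltnW li)//; case: eqP => [->|].
have sumu s : (\sum_j updn l i s j = s + \sum_(j | j != i) l j)%N.
  rewrite (bigD1 i)//= /updn eqxx; congr (_ + _)%N.
  by apply: eq_bigr => j /negbTE ->.
have suml : (\sum_j l j = l i + \sum_(j | j != i) l j)%N by rewrite (bigD1 i).
rewrite updl; apply: PS => //; first by rewrite -ltnS prednK ?(ltnW li).
  by apply: IH; apply: leq_trans lm; rewrite sumu suml ltn_add2r.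
apply: IH; apply: leq_trans lm; rewrite sumu suml ltn_add2r.
by rewrite prednK ?(ltnW li).
Qed.

Lemma prod_updnD l i s t :
  \prod_j ((updn l i (s + t) j)%:R : R) =
  \prod_j (updn l i s j)%:R + \prod_j (updn l i t j)%:R.
Proof.
have E u : \prod_j ((updn l i u j)%:R : R) = u%:R * \prod_(j | j != i) (l j)%:R.
  rewrite (bigD1 i)//= /updn eqxx; congr (_ * _).
  by apply: eq_bigr => j /negbTE ->.
by rewrite !E natrD mulrDl.
Qed.

Lemma prod_eq0 l i : l i = 0%N -> \prod_j ((l j)%:R : R) = 0.
Proof. by move=> li; rewrite (bigD1 i)//= li mul0r. Qed.

End GridBoxes.

(** * Mass of the valuation and transfer between cells *)

Section TameBound.
Variables (R : realType) (n k : nat) (Psi : sMA R n.+1 k).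
Notation V := 'rV[R]_n.+1.
Notation vl := (val Psi).

(** [pm] and [nm] need not be mutually singular, so this only bounds the total variation from above;
    it is monotone and finite on bounded sets, as the contradiction requires. *)
Definition mass (f : V -> R) (B : set V) : R := fine (pm Psi f B) + fine (nm Psi f B).

Lemma massU f B B' : bounded_borel B -> bounded_borel B' -> B `&` B' = set0 ->
  mass f (B `|` B') = mass f B + mass f B'.
Proof.
move=> bB bB' BB'; have [mB _] := bB; have [mB' _] := bB'.
rewrite /mass !measureU// !fineD; first ring; apply: lf_fin => //;
  by [exact: pm_lf|exact: nm_lf].
Qed.

Lemma mass_ge0 f B : 0 <= mass f B.
Proof. by rewrite addr_ge0// fine_ge0. Qed.

Lemma le_mass f B B' : bounded_borel B -> bounded_borel B' -> B `<=` B' ->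
  mass f B <= mass f B'.
Proof.
move=> bB bB' BB'; have [mB _] := bB; have [mB' _] := bB'.
by apply: lerD; apply: fine_le; rewrite ?lf_fin//;
  [exact: pm_lf|exact: pm_lf|apply: le_measure; rewrite ?inE|exact: nm_lf|exact: nm_lf|
   apply: le_measure; rewrite ?inE].
Qed.

Lemma val_le_mass f B : `|vl f B| <= mass f B.
Proof.
apply: le_trans (ler_normB _ _) _.
by rewrite !ger0_norm// fine_ge0.
Qed.

Definition hp (m : nat) : R := 2^-1 ^+ m.

Lemma hp_gt0 m : 0 < hp m.
Proof. by rewrite exprn_gt0// invr_gt0. Qed.

Lemma hpD m m' : hp (m + m') = hp m * hp m'.
Proof. by rewrite /hp exprD. Qed.

Lemma hp_le m m' : (m <= m')%N -> hp m' <= hp m.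
Proof.
by move=> mm'; rewrite /hp ler_wiXn2l// ?invr_ge0// invf_le1// ler1n.
Qed.

Lemma hp_le1 m : hp m <= 1.
Proof. by have := hp_le (leq0n m); rewrite /hp expr0. Qed.

Lemma hpK t m : (2 ^ t)%:R * hp (m + t) = hp m.
Proof.
rewrite hpD mulrCA natrX -[X in _ * X]exprMn mulfV ?pnatr_eq0// expr1n mulr1 //.
Qed.

Definition cube (r : R) : set V := hbox 0 (const_mx r).

Lemma cube_cellN r : 0 < r -> cube r `<=` cellN r.
Proof.
move=> r0 x hx i; have /andP[] := hx i; rewrite !mxE => h1 h2.
by apply/andP; split; lra.
Qed.

Lemma val_translate_box f z a b : convex_fun f ->
  vl (fun x => f (x + z)) (hbox a b) = vl f (hbox (a + z) (b + z)).
Proof.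
move=> cf; rewrite val_translation//; last exact: bborel_hbox.
congr (vl f _); apply/seteqP; split => x.
  by move=> [y hy <-] i; have := hy i; rewrite !mxE !lerD2r !ltrD2r.
move=> hx; exists (x - z); last by rewrite subrK.
by move=> i; have := hx i; rewrite !mxE lerBrDr ltrBlDr.
Qed.

(** After translation by z the two functions differ near the cube by the cross terms of C |z + y|^2,
    which are affine in y. *)
Lemma val_cell E e C p z r : convex_fun E -> convex_fun e -> 0 < r ->
  (forall y, cellN r y -> E (z + y) = C * dot (z + y) (z + y) + p y) ->
  (forall y, cellN r y -> e y = C * dot y y + p y) ->
  vl E (hbox z (z + const_mx r)) = vl e (cube r).
Proof.
move=> cE ce r0 hE he.
have -> : hbox z (z + const_mx r) = hbox (0 + z) (const_mx r + z).
  by rewrite add0r addrC.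
rewrite -val_translate_box//.
have al : affine_fun (fun x => C * (2 * dot z x + dot z z)).
  exists ((C * 2) *: z), (C * dot z z) => x; rewrite -/(dot _ _) dotZl; ring.
have bc : bounded_borel (cube r) by exact: bborel_hbox.
rewrite -[RHS](val_affine Psi ce al bc).
apply: (val_local Psi (convex_comp_add _ cE) _ (@open_cellN _ _ r)) => //.
- by apply: convexD => //; exact: convex_aff.
- by move=> y hy; rewrite addrC hE// he// dotDr !dotDl (dotC y z); ring.
- exact: cube_cellN.
Qed.

End TameBound.

(** * The gliding hump *)

Section TameBoundTheorem.
Variables (R : realType) (n k : nat) (Psi : sMA R n.+1 k).
Notation V := 'rV[R]_n.+1.
Notation vl := (val Psi).
Notation hp := (hp R).

(* Bad functions for constants growing with [J] are packed, at scale [hp (ms J)], into a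
   region of side [hp (J + 2)] around [hp J e_0]; the resulting measure would have
   infinite mass on a bounded set. *)
Theorem tame_bound (kap : R) : 0 <= kap -> exists C m0, forall m (e p : V -> R) (G : V -> V),
  (m0 <= m)%N -> convex_fun e -> tame kap (hp m) p G ->
  (forall y, cellN (hp m) y -> e y = packC n.+1 kap * dot y y + p y) ->
  `|vl e (@cube R n (hp m))| <= C * hp m ^+ n.+1.
Proof.
move=> k0; apply: contrapT => notb.
(* Block J will contain NJ^(n+1) cubes, where NJ times the side [hp (ms J)] is [hp (J + 4)]; with
   this constant their total mass is at least J. *)
pose Cst (J : nat) : R := J%:R * (2 ^+ (J + 4)) ^+ n.+1.
have /choice[F HF] (J : nat) : exists q : nat * (V -> R) * (V -> R) * (V -> V),
    [/\ (J + 4 <= q.1.1.1)%N, convex_fun q.1.1.2, tame kap (hp q.1.1.1) q.1.2 q.2,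
     forall y, cellN (hp q.1.1.1) y -> q.1.1.2 y = packC n.+1 kap * dot y y + q.1.2 y &
     Cst J * hp q.1.1.1 ^+ n.+1 < `|vl q.1.1.2 (@cube R n (hp q.1.1.1))|].
  apply: contrapT => noq; apply: notb; exists (Cst J), (J + 4)%N => m e p G Jm ce tp he.
  rewrite leNgt; apply/negP => hlt; apply: noq.
  by exists (m, e, p, G).
pose ms J := (F J).1.1.1; pose es J := (F J).1.1.2; pose ps J := (F J).1.2; pose Gs J := (F J).2.
have mJ J : (J + 4 <= ms J)%N by have [] := HF J.
have ce J : convex_fun (es J) by have [] := HF J.
have tp J : tame kap (hp (ms J)) (ps J) (Gs J) by have [] := HF J.
have he J y : cellN (hp (ms J)) y -> es J y = packC n.+1 kap * dot y y + ps J y.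
  by have [_ _ _ h _] := HF J; exact: h.
have bad J : Cst J * hp (ms J) ^+ n.+1 < `|vl (es J) (@cube R n (hp (ms J)))|.
  by have [] := HF J.
pose NJ J := (2 ^ (ms J - (J + 4)))%N.
have NJE J : (NJ J)%:R * hp (ms J) = hp (J + 4).
  by rewrite /NJ -{2}(subnKC (mJ J)) hpK.
pose base J : V := \row_i ((i == ord0)%:R * hp J).
(* Cells have side 3 r; spacing 4 r leaves a gap of r between neighbours. A whole block thus has
   side 4 [hp (J + 4)] = [hp (J + 2)]. *)
pose zs (q : nat * ('I_n.+1 -> nat)) : V :=
  base q.1 + \row_i (4 * hp (ms q.1) * (q.2 i)%:R).
pose Pd : set (nat * ('I_n.+1 -> nat)) := [set q | forall i, (q.2 i < NJ q.1)%N].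
have r_le J : hp (ms J) <= hp J / 16.
  apply: le_trans (hp_le _ (mJ J)) _; rewrite hpD ler_wpM2l ?(ltW (hp_gt0 R J))//.
  by rewrite /hp; lra.
have hp1 m : hp m <= 1 by have := hp_le R (leq0n m); rewrite /hp expr0.
(* Blocks of different levels are apart in the first coordinate: block J starts at hp J >= 2 hp J',
   while block J' extends only hp J' / 4 beyond hp J'. *)
have sepJ J J' kv kv' y w : (J < J')%N -> Pd (J', kv') ->
    cellN (hp (ms J)) y -> cellN (hp (ms J')) w ->
    hp (ms J) <= (zs (J, kv) + y - (zs (J', kv') + w)) ord0 ord0 /\
    hp (ms J') <= (zs (J, kv) + y - (zs (J', kv') + w)) ord0 ord0.
  move=> JJ' Pd' hy hw; rewrite !mxE eqxx !mul1r /=.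
  have /andP[y1 _] := hy ord0; have /andP[_ w1] := hw ord0.
  have kv1 : (kv' ord0)%:R + 1 <= (NJ J')%:R :> R by rewrite natr1 ler_nat Pd'.
  have r0 := hp_gt0 R (ms J); have r0' := hp_gt0 R (ms J').
  have := ler_wpM2r (ltW r0') kv1; rewrite NJE hpD mulrDl mul1r.
  have := mulr_ge0 (ltW r0) (ler0n R (kv ord0)).
  have hJ' : hp J' <= hp J / 2.
    apply: le_trans (hp_le R JJ') _; rewrite -addn1 hpD /hp expr1; lra.
  have := r_le J; have := r_le J'; have := hp_gt0 R J; have := hp_gt0 R J'.
  rewrite (_ : hp 4 = 16^-1); last by rewrite /hp; lra.
  move: (hp (ms J)) (hp (ms J')) (hp J) (hp J') y1 w1 r0 r0' hJ' => r r' h h' y1 w1 r0 r0' hJ'.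
  rewrite (mulrC _ r') -!(mulrA 4).
  move: (r * _) (r' * (kv' ord0)%:R) => a a' ? ? ? ? ? ?; split; lra.
have [E [cE _ hE]] : exists E : V -> R, [/\ convex_fun E, loc_bounded E &
    forall q, Pd q -> forall y, cellN (hp (ms q.1)) y ->
      E (zs q + y) = packC n.+1 kap * dot (zs q + y) (zs q + y) + ps q.1 y].
  apply: (@packing R n.+1 _ Pd (fun q => hp (ms q.1)) zs (fun q => ps q.1) (fun q => Gs q.1)) => //.
  - by exists (0%N, fun=> 0%N) => i /=; rewrite /NJ expn_gt0.
  - by move=> q _; rewrite hp_gt0 hp1; split.
  - move=> [J kv] [J' kv'] Pq Pq'; case: (ltngtP J J') => JJ'.
    + right=> y w hy hw; exists ord0.
      have [h1 h2] := sepJ J J' kv kv' y w JJ' Pq' hy hw.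
      have -> : (zs (J', kv') + w - (zs (J, kv) + y)) ord0 ord0 =
          - (zs (J, kv) + y - (zs (J', kv') + w)) ord0 ord0 by rewrite -opprB [LHS]mxE.
      rewrite normrN.
      by split; [apply: le_trans h1 _|apply: le_trans h2 _]; exact: ler_norm.
    + right=> y w hy hw; exists ord0.
      have [h1 h2] := sepJ J' J kv' kv w y JJ' Pq hw hy.
      by split; [apply: le_trans h2 _|apply: le_trans h1 _]; exact: ler_norm.
    + subst J'; have [->|neq] := pselect (kv = kv'); [by left|right].
      move=> y w hy hw; have [i kvi] : exists i, kv i <> kv' i.
        by apply/existsNP => h; apply: neq; apply/funext.
      exists i; rewrite !mxE /=; have r0 := hp_gt0 R (ms J).
      have /andP[y1 y2] := hy i; have /andP[w1 w2] := hw i.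
      rewrite /= in y1 y2 w1 w2.
      move: (hp (ms J)) r0 y1 y2 w1 w2 => r r0 y1 y2 w1 w2.
      set D := (X in _ <= `|X| /\ _); suff : r <= `|D| by [].
      rewrite ler_normr /D; apply/orP.
      have [lt|lt] : (kv i < kv' i)%N \/ (kv' i < kv i)%N.
        by case: (ltngtP (kv i) (kv' i)) => // ?; [left|right].
      * left; have /(ler_wpM2l (ltW r0)) : (kv i)%:R + 1 <= (kv' i)%:R :> R by rewrite natr1 ler_nat.
        rewrite mulrDr mulr1 -!(mulrA 4); move: (r * _) (r * _) => ? ? ?; lra.
      * right; have /(ler_wpM2l (ltW r0)) : (kv' i)%:R + 1 <= (kv i)%:R :> R by rewrite natr1 ler_nat.
        rewrite mulrDr mulr1 -!(mulrA 4); move: (r * _) (r * _) => ? ? ?; lra.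
pose K : set V := hbox (const_mx 0) (const_mx 2).
have main J : J%:R <= mass Psi E K.
  pose r := hp (ms J); have r0 : 0 < r := hp_gt0 R (ms J).
  pose beta := Cst J * r ^+ n.+1.
  have b0 : 0 <= beta by rewrite !mulr_ge0// ?exprn_ge0// ?(ltW r0).
  (* Induction over boxes of the lattice of spacing 4 r, each of whose cells contains one bad cube.
     [kv] records the lattice position, so that the parts of a split stay in the block. *)
  have ind : forall a l, (forall kv, a = zs (J, kv) -> (forall i, kv i + l i <= NJ J)%N ->
      beta * \prod_i (l i)%:R <= mass Psi E (gbox a (4 * r) l)).
    apply: (@gbox_ind _ _ _ (4 * r)).
    - by move=> a l i li kv _ _; rewrite (prod_eq0 _ li) mulr0 mass_ge0.
    - move=> a kv -> hkv; rewrite big1// mulr1.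
      have Pq : Pd (J, kv) by move=> i; have := hkv i; rewrite addn1.
      have hc := val_cell Psi cE (ce J) r0 (hE _ Pq) (he J).
      apply: le_trans (ltW (bad J)) _; rewrite -hc.
      apply: le_trans (val_le_mass Psi _ _) _; apply: le_mass; try exact: bborel_hbox.
      move=> x hx i; have := hx i; rewrite !mxE => /andP[-> h] /=.
      by apply: lt_le_trans h _; rewrite lerD2l mulr1 /r; have := hp_gt0 R (ms J); lra.
    - move=> a l i s t s0 t0 IHs IHt kv aE hkv.
      have r4 : 0 <= 4 * r by rewrite mulr_ge0// ltW.
      have [-> dis] := gbox_split a l i s t r4.
      rewrite massU//; try exact: bborel_hbox.
      rewrite prod_updnD mulrDr; apply: lerD.
        apply: IHs aE _ => j; have := hkv j; rewrite /updn; case: eqP => // _ h.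
        by apply: leq_trans h; rewrite leq_add2l leq_addr.
      apply: (IHt (fun j => if j == i then (kv j + s)%N else kv j)) => [|j].
        rewrite /gshift aE; apply/rowP => j; rewrite !mxE /=.
        case: (j =P i) => [->|_]; last by rewrite ?eqxx /= mulr0 addr0.
        by rewrite ?eqxx /= mulr1 natrD mulrDr !addrA.
      have := hkv j; rewrite /updn; case: eqP => // _; by rewrite addnA.
  have base0 : base J = zs (J, fun=> 0%N).
    by apply/rowP => i; rewrite !mxE /= mulr0 addr0.
  have := ind (base J) (fun=> NJ J) (fun=> 0%N) base0 (fun=> leqnn _).
  rewrite prodr_const card_ord /beta /Cst -!mulrA -!exprMn (mulrC r) NJE.
  rewrite /hp -exprMn mulfV ?pnatr_eq0// !expr1n mulr1 => h.
  apply: le_trans h _; apply: le_mass; try exact: bborel_hbox.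
  move=> x hx i; have := hx i; rewrite !mxE.
  have := NJE J; rewrite hpD -/r => NE.
  have h0 := hp_gt0 R J; have h1 := hp1 J.
  have h4 : hp 4 = 16^-1 by rewrite /hp; lra.
  rewrite -mulrA (mulrC r) NE h4.
  by case: (i == ord0); rewrite ?mul1r ?mul0r => /andP[? ?]; apply/andP; split; lra.
have [J hJ] : exists J : nat, mass Psi E K < J%:R.
  by exists (Num.truncn (mass Psi E K)).+1; exact: truncnS_gt.
by have := main J; rewrite leNgt hJ.
Qed.

End TameBoundTheorem.

(** * Measures with a continuous density *)

Section Density.
Variables (R : realType) (n : nat).
Notation V := 'rV[R]_n.
Notation meas := {measure set (Rn_borel R n) -> \bar R}.
Local Open Scope ereal_scope.

(** The proofs of measurability and nonnegativity are arguments, so that the measure structure can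
    be attached to the term itself. *)
Definition density (mu : meas) (g : V -> R)
    of (measurable_fun [set: Rn_borel R n] (g : Rn_borel R n -> R))
    & (forall x, (0 <= g x)%R) : set (Rn_borel R n) -> \bar R :=
  fun A => \int[mu]_(x in A) (g x)%:E.

Variables (mu : meas) (g : V -> R)
  (mg : measurable_fun [set: Rn_borel R n] (g : Rn_borel R n -> R))
  (g0 : forall x, (0 <= g x)%R).

Let density0 : density mu mg g0 set0 = 0.
Proof. by rewrite /density integral_set0. Qed.

Let density_ge0 A : 0 <= density mu mg g0 A.
Proof. by apply: integral_ge0 => x _; rewrite lee_fin. Qed.

Let density_sigma_additive : semi_sigma_additive (density mu mg g0).
Proof.
move=> F mF tF mUF; rewrite /density ge0_integral_bigcup//.
- by apply: is_cvg_ereal_nneg_natsum_cond => k _ _; exact: density_ge0.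
- by apply/measurable_EFinP; apply: measurable_funS mg.
- by move=> x _; rewrite lee_fin.
Qed.

HB.instance Definition _ := isMeasure.Build _ _ _ (density mu mg g0)
  density0 density_ge0 density_sigma_additive.

End Density.

(** * Dyadic boxes determine a measure *)

Section Uniqueness.
Variables (R : realType) (n : nat).
Notation V := 'rV[R]_n.
Notation meas := {measure set (Rn_borel R n) -> \bar R}.

Definition dyadic (x : R) : Prop := exists (m : nat) (z : int), x = z%:~R * hp R m.

Definition dyvec (a : V) : Prop := forall i, dyadic (a ord0 i).

Definition dybox : set (set V) := [set B | exists a b, [/\ dyvec a, dyvec b & B = hbox a b]].

Lemma hbox_setI (a b a' b' : V) : hbox a b `&` hbox a' b' =
  hbox (\row_i Num.max (a ord0 i) (a' ord0 i)) (\row_i Num.min (b ord0 i) (b' ord0 i)).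
Proof.
apply/seteqP; split => x /=.
  move=> [h h'] i; have := h i; have := h' i; rewrite !mxE ge_max lt_min.
  by move=> /andP[-> ->] /andP[-> ->].
by move=> h; split=> i; have := h i; rewrite !mxE ge_max lt_min;
  move=> /andP[/andP[? ?] /andP[? ?]]; apply/andP.
Qed.

Lemma dybox_setI : setI_closed dybox.
Proof.
move=> _ _ [a [b [da db ->]]] [a' [b' [da' db' ->]]]; rewrite hbox_setI.
eexists _, _; split; last reflexivity.
  by move=> i; rewrite mxE /Num.max; case: ifP.
by move=> i; rewrite mxE /Num.min; case: ifP.
Qed.

Definition dycube (m : nat) (z : 'rV[int]_n) : set V :=
  hbox (\row_i ((z ord0 i)%:~R * hp R m)) (\row_i ((z ord0 i + 1)%:~R * hp R m)).

Lemma dybox_dycube m z : dybox (dycube m z).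
Proof.
eexists _, _; split; last reflexivity; move=> i; rewrite mxE; by eexists _, _.
Qed.

Lemma cvg_hp : hp R m @[m --> \oo] --> (0 : R).
Proof. by apply: cvg_expr; rewrite ger0_norm ?invr_ge0// invf_lt1// ltr1n. Qed.

Lemma dycube_mem m (x : V) : dycube m (\row_i Num.floor (x ord0 i / hp R m)) x.
Proof.
move=> i; rewrite !mxE; have h0 := hp_gt0 R m.
by rewrite -ler_pdivlMr// -ltr_pdivrMr// floor_itv.
Qed.

Lemma dycube_near m (x y : V) (z : 'rV[int]_n) : dycube m z x -> dycube m z y -> `|x - y| <= hp R m.
Proof.
move=> hx hy; apply: norm_le_coord => [|i]; first exact: ltW (hp_gt0 R m).
have := hx i; have := hy i; rewrite !mxE intrD mulrDl mul1r ler_norml.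
by move=> /andP[? ?] /andP[? ?]; apply/andP; split; lra.
Qed.

(** An open set is the union of the dyadic cubes that it contains, and there are countably many
    dyadic cubes. *)
Lemma dybox_generates : @measurable _ (Rn_borel R n) = <<s dybox >>.
Proof.
rewrite eqEsubset; split; last first.
  by apply: smallest_sub; [exact: sigma_algebra_measurable|move=> _ [a [b [_ _ ->]]]; exact: borel_hbox].
apply: smallest_sub; first exact: smallest_sigma_algebra.
move=> U oU.
(* Cubes are enumerated by their [pickle] codes; a number that codes no cube inside [U] contributes
   the empty set. *)
pose C (j : nat) : set V := if unpickle j is Some (m, z) then
  (if `[< dycube m z `<=` U >] then dycube m z else set0) else set0.
have -> : U = \bigcup_j C j.
  apply/seteqP; split => x; last first.
    move=> [j _]; rewrite /C; case: unpickle => // -[m z]; case: asboolP => // h; exact: h.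
  move=> Ux; have /nbhs_ballP[e /= e0 he] : nbhs x U by apply: open_nbhs_nbhs.
  have [m _ hm] : \forall m \near \oo, hp R m < e.
    have /cvgrPdist_lt/(_ e e0) := cvg_hp; apply: filterS => m.
    by rewrite sub0r normrN ger0_norm// ltW// hp_gt0.
  pose z : 'rV[int]_n := \row_i Num.floor (x ord0 i / hp R m).
  have xz : dycube m z x := dycube_mem m x.
  exists (pickle (m, z)) => //; rewrite /C pickleK; case: asboolP => // nsub; exfalso; apply: nsub.
  move=> y yz; apply: he; rewrite -ball_normE /=; apply: le_lt_trans (hm m (leqnn _)).
  exact: (dycube_near xz yz).
have [s0 _ sU] := @smallest_sigma_algebra _ (@setT (Rn_borel R n)) dybox.
apply: sU => j; rewrite /C; case: unpickle => [[m z]|] //.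
case: ifP => _ //; apply: sub_sigma_algebra; exact: dybox_dycube.
Qed.

Lemma measure_dybox_unique (m1 m2 : meas) : locally_finite m1 ->
  (forall B, dybox B -> m1 B = m2 B) -> forall B, borel_set B -> m1 B = m2 B.
Proof.
move=> lf1 h B mB.
pose g (j : nat) : set V := hbox (const_mx (- j%:R)) (const_mx j%:R).
apply: (@measure_unique _ R (Rn_borel R n) dybox g) => //.
- exact: dybox_generates.
- exact: dybox_setI.
- move=> j; eexists _, _; split; last reflexivity.
    move=> i; rewrite mxE; exists 0%N, (- j%:Z); rewrite /hp expr0 mulr1 intrN.
    by rewrite pmulrn.
  by move=> i; rewrite mxE; exists 0%N, j%:Z; rewrite /hp expr0 mulr1.
- apply/seteqP; split => // x _.
  exists (Num.truncn `|x|).+1 => // i; rewrite !mxE.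
  have := coord_le_norm x i; have := truncnS_gt `|x|.
  by rewrite ler_norml => ? /andP[? ?]; apply/andP; split; lra.
- by move=> j; apply: lf1; exact: bborel_hbox.
Qed.

(** Uniqueness is available for nonnegative measures, so the signed identity is rearranged as p = q
    + c nu for c >= 0 and as q = p + |c| nu for c < 0. *)
Lemma sval_dybox_unique (p q nu : meas) (c : R) : locally_finite p -> locally_finite q ->
  locally_finite nu ->
  (forall a b, dyvec a -> dyvec b -> sval p q (hbox a b) = c * fine (nu (hbox a b))) ->
  forall B, bounded_borel B -> sval p q B = c * fine (nu B).
Proof.
move=> lfp lfq lfn h B bB; have [mB _] := bB.
pose a : {nonneg R} := NngNum (normr_ge0 c).
have fin (m : meas) A : locally_finite m -> bounded_borel A -> m A = (fine (m A))%:E.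
  by move=> lf bA; rewrite fineK// lf_fin.
have key (m1 m2 : meas) : locally_finite m1 -> locally_finite m2 ->
    (forall a' b, dyvec a' -> dyvec b -> fine (m1 (hbox a' b)) =
       fine (m2 (hbox a' b)) + `|c| * fine (nu (hbox a' b))) ->
    fine (m1 B) = fine (m2 B) + `|c| * fine (nu B).
  move=> lf1 lf2 h12; pose m3 : meas := measure_add m2 (mscale a nu).
  have m3E A : m3 A = (m2 A + `|c|%:E * nu A)%E by exact: measure_addE.
  have -> : m1 B = m3 B.
    apply: measure_dybox_unique => // _ [a' [b [da db ->]]].
    have bQ := bborel_hbox a' b.
    by rewrite m3E (fin m1)// (fin m2)// (fin nu)// -EFinM -EFinD h12.
  by rewrite m3E (fin m2)// (fin nu)// -EFinM -EFinD.
have [c0|c0] := leP 0 c.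
  have := @key p q lfp lfq; rewrite ger0_norm// => k1; rewrite /sval k1; first ring.
  by move=> a' b da db; have := h a' b da db; rewrite /sval; lra.
have := @key q p lfq lfp; rewrite ltr0_norm// => k1; rewrite /sval k1; first ring.
by move=> a' b da db; have := h a' b da db; rewrite /sval; lra.
Qed.

End Uniqueness.

(** * Lebesgue measure on half-open boxes *)

Section Lebesgue.
Variables (R : realType) (n : nat).
Notation V := 'rV[R]_n.
Notation meas := {measure set (Rn_borel R n) -> \bar R}.
Variables (mu : meas) (lmu : is_lebesgue_n mu).

Lemma lebesgue_lf : locally_finite mu.
Proof.
move=> B [mB /bounded_setP[r hr]]; pose s := `|r|.
apply: (@le_lt_trans _ _ (mu (box (const_mx (- s)) (const_mx s)))); last first.
  by rewrite lmu ?ltry// => i; rewrite !mxE; have := normr_ge0 r; rewrite /s; lra.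
have mb : measurable (box (const_mx (- s)) (const_mx s) : set (Rn_borel R n)).
  have -> : box (const_mx (- s)) (const_mx s) =
      \bigcap_(i in [set: 'I_n]) [set x : V | x ord0 i \in `[- s, s]].
    apply/seteqP; split => x /=.
      by move=> h i _; have := h i; rewrite !mxE /= in_itv.
    by move=> h i; have := h i Logic.I; rewrite !mxE /= in_itv.
  by apply: fin_bigcap_measurable => [|i _]; [exact: finite_finset|exact: borel_coord_itv].
apply: le_measure; rewrite ?inE// => x /hr xr i; rewrite !mxE -ler_norml.
by apply: le_trans (coord_le_norm x i) _; apply: le_trans xr _; exact: ler_norm.
Qed.

(** Squeeze between the closed box and closed boxes whose upper faces are pulled in slightly. *)
Lemma lebesgue_hbox (a b : V) : (forall i, a ord0 i <= b ord0 i) ->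
  fine (mu (hbox a b)) = \prod_i (b ord0 i - a ord0 i).
Proof.
move=> ab; have fin := lf_fin lebesgue_lf (bborel_hbox a b).
have mbox (c d : V) : (forall i, c ord0 i <= d ord0 i) -> measurable (box c d : set (Rn_borel R n)).
  move=> cd; have -> : box c d =
      \bigcap_(i in [set: 'I_n]) [set x : V | x ord0 i \in `[c ord0 i, d ord0 i]].
    apply/seteqP; split => x /=.
      by move=> h i _; have := h i; rewrite /= in_itv.
    by move=> h i; have := h i Logic.I; rewrite /= in_itv.
  by apply: fin_bigcap_measurable => [|i _]; [exact: finite_finset|exact: borel_coord_itv].
apply/eqP; rewrite eq_le; apply/andP; split.
  rewrite -lee_fin fineK// -(lmu ab); apply: le_measure; rewrite ?inE.
  - exact: borel_hbox.
  - exact: mbox.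
  - by move=> x hx i; have /andP[-> /ltW ->] := hx i.
pose bs (t : nat) : V := \row_i (a ord0 i + (1 - t.+1%:R^-1) * (b ord0 i - a ord0 i)).
have cv : \prod_i (bs t ord0 i - a ord0 i) @[t --> \oo] --> \prod_i (b ord0 i - a ord0 i).
  apply: cvg_prod => i.
  have -> : (fun t => bs t ord0 i - a ord0 i) =
    (fun t : nat => (1 - t.+1%:R^-1) * (b ord0 i - a ord0 i)).
    by apply/funext => t; rewrite mxE addrC addKr.
  have -> : b ord0 i - a ord0 i = (1 - 0) * (b ord0 i - a ord0 i) by rewrite subr0 mul1r.
  rewrite {1}subr0 mul1r; apply: cvgM; last exact: cvg_cst.
  by apply: cvgB; [exact: cvg_cst|exact: cvg_harmonic].
(* If some side is degenerate, the pulled-in box is not contained in the half-open one; the product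
   is then 0 and the bound trivial. *)
have [/existsP[i /eqP abi]|/existsPn nab] := boolP [exists i, a ord0 i == b ord0 i].
  by rewrite (bigD1 i)//= -abi subrr mul0r fine_ge0.
have cst_cv : fine (mu (hbox a b)) @[_ --> \oo] --> fine (mu (hbox a b)) by exact: cvg_cst.
apply: ler_cvg_to cv cst_cv _; apply: nearW => t.
have t0 : 0 <= 1 - t.+1%:R^-1 :> R by rewrite subr_ge0 invf_le1 ?ltr0n// ler1n.
have abs i : a ord0 i <= bs t ord0 i.
  by rewrite mxE lerDl mulr_ge0// subr_ge0.
rewrite -lee_fin fineK// -(lmu abs); apply: le_measure; rewrite ?inE.
- exact: mbox.
- exact: borel_hbox.
- move=> x hx i; have /andP[-> h] := hx i; apply: le_lt_trans h _.
  have abi : 0 < b ord0 i - a ord0 i by rewrite subr_gt0 lt_neqAle nab ab.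
  have : 0 < t.+1%:R^-1 :> R by rewrite invr_gt0 ltr0n.
  by rewrite mxE; move: (_^-1) => u u0; nra.
Qed.

End Lebesgue.

(** * Dyadic boxes as grid boxes; affine functions *)

Section Dyadic.
Variables (R : realType) (n : nat).
Notation V := 'rV[R]_n.

Lemma dyvec_common (a : V) : dyvec a ->
  exists m0, forall m, (m0 <= m)%N -> exists z : 'I_n -> int, forall i, a ord0 i = (z i)%:~R * hp R m.
Proof.
move=> /choice[ms /choice[zs hz]]; exists (\max_i ms i)%N => m hm.
exists (fun i => zs i * (2 ^ (m - ms i))%:Z) => i; rewrite hz intrM -mulrA; congr (_ * _).
have mi : (ms i <= m)%N by apply: leq_trans hm; exact: leq_bigmax.
by rewrite -{2}(subnKC mi) -[LHS](hpK R (m - ms i)) -pmulrn.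
Qed.

(** Stated for every sufficiently fine scale, because the mesh is later refined inside a fixed
    box. *)
Lemma dybox_gbox (a b : V) : dyvec a -> dyvec b -> (forall i, a ord0 i <= b ord0 i) ->
  exists m0, forall m, (m0 <= m)%N -> exists l : 'I_n -> nat, b = a + \row_i (hp R m * (l i)%:R).
Proof.
move=> /dyvec_common[m1 h1] /dyvec_common[m2 h2] ab; exists (maxn m1 m2) => m.
rewrite geq_max => /andP[/h1[z hz] /h2[w hw]]; have h0 := hp_gt0 R m.
exists (fun i => `|w i - z i|%N); apply/rowP => i; rewrite !mxE hw hz.
have zw : z i <= w i by have := ab i; rewrite hz hw ler_pM2r// ler_int.
have -> : (`|w i - z i|%N)%:R = (w i - z i)%:~R :> R.
  by rewrite pmulrn gez0_abs// subr_ge0.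
by rewrite intrB; ring.
Qed.

Lemma affineD (l l' : V -> R) : affine_fun l -> affine_fun l' -> affine_fun (fun x => l x + l' x).
Proof.
move=> [a [b h]] [a' [b' h']]; exists (a + a'), (b + b') => x.
by rewrite h h' -!/(dot _ _) dotDl; ring.
Qed.

Lemma affine_sum (I : Type) (s : seq I) (F : I -> V -> R) :
  (forall i, affine_fun (F i)) -> affine_fun (fun x => \sum_(i <- s) F i x).
Proof.
move=> aF; elim: s => [|i s IH].
  by exists 0, 0 => x; rewrite big_nil -/(dot _ _) dotC dot0r addr0.
by under eq_fun do rewrite big_cons; exact: affineD.
Qed.

Lemma quad_shift (us : 'I_n -> V) cs z : exists2 l, affine_fun l &
  forall x, quad us cs (x + z) = quad us cs x + l x.
Proof.
exists (fun x => \sum_(i < n) cs i * (2 * dot (us i) z * dot (us i) x + dot (us i) z ^+ 2)).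
  apply: affine_sum => i; exists ((cs i * (2 * dot (us i) z)) *: us i), (cs i * dot (us i) z ^+ 2).
  by move=> x; rewrite -/(dot _ _) dotZl; ring.
move=> x; rewrite /quad -big_split; apply: eq_bigr => i _ /=.
by rewrite /sq dotDr; ring.
Qed.

End Dyadic.

(** * The valuation on quadratic forms *)

Section QuadraticDensity.
Variables (R : realType) (n k : nat) (Psi : sMA R n.+1 k).
Notation V := 'rV[R]_n.+1.
Notation vl := (val Psi).
Notation meas := {measure set (Rn_borel R n.+1) -> \bar R}.
Implicit Types (us : 'I_n.+1 -> V) (cs : 'I_n.+1 -> R).

Definition qdens us cs : R := vl (quad us cs) (@cube R n 1).

Lemma val_quad_translate us cs a b z : (forall i, 0 <= cs i) ->
  vl (quad us cs) (hbox (a + z) (b + z)) = vl (quad us cs) (hbox a b).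
Proof.
move=> cs0; have cq : convex_fun (quad us cs) by exact: convex_quad.
rewrite -val_translate_box//; have [l al hl] := quad_shift us cs z.
rewrite -(val_affine Psi cq al (bborel_hbox a b)); congr (vl _ _).
by apply/funext => x; rewrite hl.
Qed.

Lemma val_gbox_translate us cs r a l : 0 <= r -> (forall i, 0 <= cs i) ->
  vl (quad us cs) (gbox a r l) = \prod_i (l i)%:R * vl (quad us cs) (@cube R n r).
Proof.
move=> r0 cs0; move: a l; apply: (@gbox_ind _ _ _ r).
- by move=> a l i li; rewrite (prod_eq0 _ li) mul0r (gbox_empty _ _ li) val0.
- move=> a; rewrite big1// mul1r -(val_quad_translate us 0 (const_mx r) a cs0) add0r.
  congr (vl _ (hbox _ _)); by apply/rowP => i; rewrite !mxE mulr1 addrC.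
- move=> a l i s t _ _ IHs IHt; have [-> dis] := gbox_split a l i s t r0.
  by rewrite valU ?IHs ?IHt ?prod_updnD ?mulrDl//; exact: bborel_hbox.
Qed.

Lemma val_quad_cube us cs m : (forall i, 0 <= cs i) ->
  vl (quad us cs) (@cube R n (hp R m)) = qdens us cs * hp R m ^+ n.+1.
Proof.
move=> cs0; have h0 := hp_gt0 R m.
have := val_gbox_translate us 0 (fun=> (2 ^ m)%N) (ltW h0) cs0.
have -> : gbox 0 (hp R m) (fun=> (2 ^ m)%N) = @cube R n 1.
  congr hbox; apply/rowP => i; rewrite !mxE add0r mulrC.
  by have := hpK R m 0; rewrite add0n /hp expr0.
rewrite -/(qdens us cs) prodr_const card_ord => ->.
by rewrite mulrAC -exprMn natrX -exprMn mulfV ?pnatr_eq0// !expr1n mul1r.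
Qed.

Variables (mu : meas) (lmu : is_lebesgue_n mu).

(** Translating a quadratic form changes it by an affine function, so the measure is translation
    invariant and, on dyadic grid boxes, proportional to the number of cells. *)
Lemma val_quad_borel us cs B : (forall i, 0 <= cs i) -> bounded_borel B ->
  vl (quad us cs) B = qdens us cs * fine (mu B).
Proof.
move=> cs0; apply: sval_dybox_unique.
- exact: pm_lf.
- exact: nm_lf.
- exact: lebesgue_lf.
move=> a b da db; rewrite -/(vl (quad us cs) _).
have [ab|] := boolP [forall i, a ord0 i <= b ord0 i]; last first.
  move=> /forallPn [j]; rewrite -ltNge => bai.
  have -> : hbox a b = set0.
    rewrite -subset0 => x /(_ j) /andP[h1 h2].
    by have := lt_trans (le_lt_trans h1 h2) bai; rewrite ltxx.
  by rewrite val0 measure0 mulr0.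
move/forallP in ab; have [m /(_ m (leqnn _)) [l bE]] := dybox_gbox da db ab.
rewrite lebesgue_hbox// {1}bE -/(gbox _ _ _) val_gbox_translate ?(ltW (hp_gt0 R m))//.
rewrite val_quad_cube// mulrCA; congr (_ * _).
have -> : hp R m ^+ n.+1 = \prod_(i < n.+1) hp R m by rewrite prodr_const card_ord.
rewrite -big_split; apply: eq_bigr => i _ /=.
by rewrite bE !mxE; ring.
Qed.

(** A set of positive measure preserved by rotations, as cubes are not; on it equivariance compares
    the densities of a form and of its rotation. *)
Definition eball : set V := [set x | dot x x < 1].

Lemma bborel_eball : bounded_borel eball.
Proof.
split.
  apply: open_borel; rewrite (_ : eball = (fun x : V => dot x x) @^-1` [set y | y < 1])//.
  apply: open_comp => [x _|]; last exact: open_lt.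
  apply: (@cvg_rsum _ _ _ (nbhs x) _ _ _ (fun i (x : V) => x ord0 i * x ord0 i)) => i _.
  by apply: cvgM; exact: coord_continuous.
apply/bounded_setP; exists 1 => x /= h; apply: norm_le_coord => // i.
rewrite -(@ler_pXn2r _ 2)// ?nnegrE// real_normK ?num_real// expr1n.
apply: le_trans (ltW h); rewrite /dot (bigD1 i)//= -expr2 lerDl.
by apply: sumr_ge0 => j _; rewrite -expr2 sqr_ge0.
Qed.

Lemma lebesgue_eball_gt0 : 0 < fine (mu eball).
Proof.
pose s : R := (n.+2%:R)^-1; have s0 : 0 < s by rewrite invr_gt0 ltr0n.
apply: (@lt_le_trans _ _ (fine (mu (hbox 0 (const_mx s) : set V)))).
  rewrite lebesgue_hbox//; last by move=> i; rewrite !mxE ltW.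
  by apply: prodr_gt0 => i _; rewrite !mxE subr0.
have [mb _] := bborel_eball.
apply: fine_le; rewrite ?lf_fin//; try exact: lebesgue_lf; try exact: bborel_hbox;
  try exact: bborel_eball.
apply: le_measure; rewrite ?inE//; first exact: borel_hbox.
move=> x hx; rewrite /eball /= /dot.
apply: (@le_lt_trans _ _ (\sum_(i < n.+1) s ^+ 2)).
  apply: ler_sum => i _; have /andP[] := hx i; rewrite !mxE => h1 h2.
  by nra.
rewrite sumr_const card_ord -mulr_natl expr2 mulrA.
have h : n.+1%:R * s < 1 by rewrite /s ltr_pdivrMr ?ltr0n// mul1r ltr_nat.
have : s <= 1 by rewrite invf_le1 ?ltr0n// ler1n.
have : 0 <= n.+1%:R * s by rewrite mulr_ge0// ltW.
by move: (_ * s) h s0 => u; nra.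
Qed.

Definition evec (i : 'I_n.+1) : V := delta_mx ord0 i.

Lemma dot_evec i (x : V) : dot (evec i) x = x ord0 i.
Proof.
rewrite /dot (bigD1 i)//= mxE !eqxx mul1r big1 ?addr0// => j ji.
by rewrite mxE (negbTE ji) mul0r.
Qed.

Lemma qdens_SO (U : 'M[R]_n.+1) cs : U *m U^T = 1%:M -> \det U = 1 -> (forall i, 0 <= cs i) ->
  qdens (fun i => row i U) cs = qdens evec cs.
Proof.
move=> UU dU cs0; have gSO : special_orthogonal U^T.
  by split; rewrite ?trmxK ?det_tr//; exact: mulmx1C.
have := val_SO Psi gSO (convex_quad evec cs0) bborel_eball.
have -> : [set x | eball (x *m U^T)] = eball.
  have dE (x : V) : dot x x = (x *m x^T) ord0 ord0.
    by rewrite /dot mxE; apply: eq_bigr => i _; rewrite mxE.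
  apply/seteqP; split => x /=; rewrite /eball /= !dE trmx_mul trmxK mulmxA -(mulmxA x) (mulmx1C UU);
    by rewrite mulmx1.
have -> : (fun x => quad evec cs (x *m U^T)) = quad (fun i => row i U) cs.
  apply/funext => x; apply: eq_bigr => i _; rewrite /sq dot_evec; congr (_ * _ ^+ 2).
  by rewrite mxE dotC; apply: eq_bigr => j _; rewrite !mxE.
rewrite !val_quad_borel//; try exact: bborel_eball.
by move/mulIf; apply; rewrite gt_eqF// lebesgue_eball_gt0.
Qed.

(** The form sees each frame vector only up to sign, so flipping one row of [U] changes the
    determinant from -1 to 1 and leaves the form unchanged. *)
Lemma qdens_O (U : 'M[R]_n.+1) cs : U *m U^T = 1%:M -> (forall i, 0 <= cs i) ->
  qdens (fun i => row i U) cs = qdens evec cs.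
Proof.
move=> UU cs0; have : \det U ^+ 2 = 1 by rewrite expr2 -{2}det_tr -det_mulmx UU det1.
move/eqP; rewrite sqrf_eq1 => /orP[/eqP dU|/eqP dU]; first exact: qdens_SO.
pose D : 'M[R]_n.+1 := diag_mx (\row_i (if i == ord0 then -1 else 1)).
have DD : D *m D^T = 1%:M.
  rewrite tr_diag_mx mulmx_diag; apply/matrixP => i j; rewrite !mxE.
  by case: (i == ord0); rewrite ?mulrNN mulr1.
rewrite -(@qdens_SO (D *m U))//.
- congr (vl _ _); apply/funext => x; apply: eq_bigr => i _; congr (_ * _).
  rewrite mul_diag_mx /sq; have -> : row i (\matrix_(i, j) ((\row_i0 (if i0 == ord0 then -1 else 1)) ord0 i * U i j)) =
    (if i == ord0 then -1 else 1) *: row i U.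
    by apply/rowP => j; rewrite !mxE.
  by rewrite dotZl; case: (i == ord0); rewrite ?mulN1r ?sqrrN ?mul1r.
- by rewrite trmx_mul mulmxA -(mulmxA D) UU mulmx1.
- rewrite det_mulmx dU det_diag (bigD1 ord0)//= mxE eqxx big1 ?mulr1 ?mulrNN ?mulr1//.
  by move=> i /negbTE i0; rewrite mxE i0.
Qed.

Lemma qdens_perm (s : 'S_n.+1) cs : (forall i, 0 <= cs i) ->
  qdens evec (fun i => cs (s i)) = qdens evec cs.
Proof.
move=> cs0; rewrite -(@qdens_O (perm_mx s^-1) cs)//; last first.
  by rewrite tr_perm_mx invgK -perm_mxM mulVg perm_mx1.
congr (vl _ _); apply/funext => x; rewrite /quad.
rewrite [RHS](reindex_inj (@perm_inj _ s)) /=; apply: eq_bigr => i _; congr (_ * sq _ _).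
by apply/rowP => j; rewrite !mxE permK eqxx /= eq_sym.
Qed.

Lemma multiaffine_qdens : multiaffine (qdens evec).
Proof.
move=> lam i t lam0 t0.
have aPhi : sq_affine (vl^~ (@cube R n 1)) by move=> f u s cf s0; exact: val_sq_affine.
have := @multiaffine_quad R n.+1 _ (fun=> 0) evec (fun=> 1) aPhi (@convex_cst _ _ 0) (fun=> ler01) lam i t lam0 t0.
have E l : (fun x => 0 + quad evec (fun j => l j * 1) x) = quad evec l.
  by apply/funext => x; rewrite add0r; apply: eq_bigr => j _; rewrite mulr1.
by rewrite !E.
Qed.

Lemma qdens_homogeneous cs (t : R) : (forall i, 0 <= cs i) -> 0 < t ->
  qdens evec (fun i => t * cs i) = t ^+ k * qdens evec cs.
Proof.
move=> cs0 t0; rewrite /qdens -val_homogeneous//; last exact: bborel_hbox.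
  congr (vl _ _); apply/funext => x; rewrite /quad mulr_sumr.
  by apply: eq_bigr => i _; rewrite mulrA.
exact: convex_quad.
Qed.

(** A transposition trades an element of J outside J' for one of J' outside J. It is odd, which is
    why invariance under all of O(n) was needed. *)
Lemma qdens_indv_card (J J' : {set 'I_n.+1}) : #|J| = #|J'| ->
  qdens evec (indv R J) = qdens evec (indv R J').
Proof.
have [m] := ubnP #|J :\: J'|; elim: m J => // m IH J JJ' cJ.
have [sub|] := boolP (J \subset J').
  suff -> : J = J' by [].
  by apply/eqP; rewrite eqEcard sub cJ /=.
move=> /fintype.subsetPn[x xJ xJ'].
have /fintype.subsetPn[y yJ' yJ] : ~~ (J' \subset J).
  apply/negP => sub; have /eqP E : J' == J by rewrite eqEcard sub cJ /=.
  by rewrite E xJ in xJ'.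
pose J1 := (y |: J) :\ x.
have yx : y != x by apply: contraNneq yJ => ->.
have cJ1 : #|J1| = #|J'|.
  by rewrite -cJ; have := cardsD1 x (y |: J); rewrite cardsU1 yJ inE xJ orbT; move=> /eqP; rewrite eqn_add2l => /eqP.
rewrite -(IH J1)//; last first.
  rewrite -ltnS; apply: leq_trans JJ'; rewrite ltnS; apply: proper_card.
  apply/properP; split; last by exists x; rewrite !inE ?eqxx ?xJ ?xJ'.
  apply/fintype.subsetP => z; rewrite !inE => /andP[zJ' /andP[zx /orP[/eqP zy|zJ]]].
    by rewrite zy yJ' in zJ'.
  by rewrite zJ' zJ.
rewrite -(@qdens_perm (tperm x y) (indv R J)); last by move=> i; rewrite ler0n.
congr (qdens _ _); apply/funext => z; rewrite /indv !inE; congr (_%:R); congr nat_of_bool.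
case: tpermP => [->|->|zx zy].
- by rewrite eqxx (negbTE yJ).
- by rewrite eqxx xJ yx.
- by move/eqP/negbTE: zx => ->; move/eqP/negbTE: zy => ->.
Qed.

Definition qconst : R := qdens evec (indv R [set i : 'I_n.+1 | (i < k)%N]%SET).

(** Both sides are multi-affine and k-homogeneous, so they are compared on indicators of k-element
    sets only, where symmetry leaves a single constant. *)
Lemma qdens_esym cs : (forall i, 0 <= cs i) -> qdens evec cs = Defs.esym k cs * qconst.
Proof.
move=> cs0; apply/eqP; rewrite -subr_eq0; apply/eqP.
apply: (@multiaffine_homog_eq0 R n.+1 (fun cs => qdens evec cs - Defs.esym k cs * qconst) k) => //.
- apply: multiaffineB; first exact: multiaffine_qdens.
  by apply: multiaffineZ; exact: multiaffine_esym.
- by move=> lam t lam0 t0; rewrite qdens_homogeneous// esymZ; ring.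
- move=> J cJ; rewrite esym_indv// mul1r /qconst (@qdens_indv_card J [set i : 'I_n.+1 | (i < k)%N]%SET) ?subrr//.
  rewrite cJ; have kn : (k <= n.+1)%N by have := max_card (mem J); rewrite card_ord cJ.
  rewrite cardsE -sum1_card big_mkcond /= -(big_mkord xpredT (fun i => if (i < k)%N then 1%N else 0%N)).
  rewrite (big_cat_nat (n := k))//= [X in (X + _)%N](_ : _ = k).
    rewrite big_nat_cond big1 ?addn0// => i; rewrite andbT => /andP[ki _].
    by rewrite ltnNge ki.
  rewrite big_nat (eq_bigr (fun=> 1%N)); last by move=> i /= ->.
  by rewrite -big_nat sum_nat_const_nat subn0 muln1.
Qed.

Lemma val_quad_ortho (U : 'M[R]_n.+1) cs m : U *m U^T = 1%:M -> (forall i, 0 <= cs i) ->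
  vl (quad (fun i => row i U) cs) (@cube R n (hp R m)) = qconst * Defs.esym k cs * hp R m ^+ n.+1.
Proof.
by move=> UU cs0; rewrite val_quad_cube// qdens_O// qdens_esym// (mulrC _ qconst).
Qed.

End QuadraticDensity.

(** * Mean value theorems from partial derivatives *)

Section Taylor.
Variables (R : realType) (n : nat).
Notation V := 'rV[R]_n.
Notation e_ := (@unitv R n).
Implicit Types (f g : V -> R) (x y w : V).

Lemma is_derive_line f x (e : V) (s : R) : derivable f (x + s *: e) e ->
  is_derive s 1 (fun s => f (x + s *: e)) ('D_e f (x + s *: e)).
Proof.
move=> df.
have E : (fun h : R => h^-1 *: (((fun s => f (x + s *: e)) \o shift s) (h *: 1) - f (x + s *: e))) =
    (fun h : R => h^-1 *: ((f \o shift (x + s *: e)) (h *: e) - f (x + s *: e))).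
  apply/funext => h /=; congr (_ *: (f _ - _)).
  by rewrite [h *: 1]mulr1 scalerDl addrCA.
by split; [rewrite /derivable E|rewrite /derive E].
Qed.

Lemma MVT_line f x (e : V) (t : R) : (forall z, derivable f z e) ->
  exists c, 0 <= c <= 1 /\ f (x + t *: e) - f x = t * 'D_e f (x + (c * t) *: e).
Proof.
move=> df; pose g (s : R) := f (x + s *: e).
have dg (s : R) : is_derive s 1 g ('D_e f (x + s *: e)) by apply: is_derive_line; exact: df.
have cg (a b : R) : {within `[a, b], continuous g}.
  by apply: derivable_within_continuous => s _; have [] := dg s.
have g0 : g 0 = f x by rewrite /g scale0r addr0.
have [t0|t0] := leP 0 t.
  have [c] := MVT_segment t0 (fun s _ => dg s) (cg _ _).
  rewrite in_itv /= => /andP[c0 ct]; rewrite g0 subr0 => E.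
  have [tz|tz] := eqVneq t 0.
    by exists 0; rewrite lexx ler01; split => //; rewrite tz scale0r addr0 subrr mul0r.
  exists (c / t); split.
    by rewrite divr_ge0//= ler_pdivrMr ?mul1r// lt_neqAle eq_sym tz.
  by rewrite divfK// mulrC -E.
have [c] := MVT_segment (ltW t0) (fun s _ => dg s) (cg _ _).
rewrite in_itv /= => /andP[ct c0]; rewrite g0 sub0r => E.
exists (c / t); split.
  by rewrite ler_ndivlMr// mul0r c0 /= ler_ndivrMr// mul1r.
rewrite divfK ?lt_eqF//; move: E; rewrite -/(g t); set D := 'D_e f _ => E; lra.
Qed.

(** [C2] provides partial derivatives only, so the way from y to w is travelled one coordinate at a
    time; the mean value points stay in the box spanned by y and w. *)
Lemma telescoping_MVT f y w : (forall i z, derivable f z (e_ i)) ->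
  exists th : 'I_n -> 'I_n -> R, (forall m j, 0 <= th m j <= 1) /\
   f w - f y = \sum_m (w ord0 m - y ord0 m) *
     partial m f (\row_j (y ord0 j + th m j * (w ord0 j - y ord0 j))).
Proof.
move=> df; pose p (m : nat) : V := \row_j (if (j < m)%N then w ord0 j else y ord0 j).
have p0 : p 0%N = y by apply/rowP => j; rewrite mxE.
have pn : p n = w by apply/rowP => j; rewrite mxE ltn_ord.
have pS (m : 'I_n) : p m.+1 = p m + (w ord0 m - y ord0 m) *: e_ m.
  apply/rowP => j; rewrite !mxE eqxx /= ltnS leq_eqVlt.
  have [->|jm] := eqVneq j m; first by rewrite eqxx ltnn /=; ring.
  rewrite (_ : (j == m :> nat) = false) /= ?mulr0 ?addr0//.
  by apply/negbTE; apply: contra jm => /eqP h; apply/eqP/val_inj.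
have /choice[c hc] (m : 'I_n) := MVT_line (p m) (w ord0 m - y ord0 m) (df m).
(* On leg m the coordinates before m have already moved, coordinate m is at its mean value point,
   and the later ones have not moved. *)
exists (fun m j : 'I_n => if (j < m)%N then 1 else if j == m then c m else 0); split.
  move=> m j; case: ifP => _; first by rewrite ler01 lexx.
  by case: ifP => _; [have [] := hc m|rewrite lexx ler01].
rewrite -{1}pn -{1}p0 -(telescope_sumr (fun m => f (p m)) (leq0n n)) big_mkord.
apply: eq_bigr => m _; rewrite pS; have [_ E] := hc m; rewrite {}E /partial.
set x1 := p m + _; set x2 := \row_j _; suff -> : x1 = x2 by [].
apply/rowP => j; rewrite !mxE eqxx /=.
have [jm|jm] := ltnP j m.
  rewrite (_ : (j == m) = false) ?mulr0 ?addr0; first by ring.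
  by apply/negbTE; rewrite -val_eqE /= ltn_eqF.
by case: (j =P m) => [->|_]; rewrite /= ?mulr1 ?mulr0 ?mul0r.
Qed.

Lemma MVT_bound f y w (eps : R) : (forall i z, derivable f z (e_ i)) ->
  (forall z : V, (forall j, exists2 t, 0 <= t <= 1 & z ord0 j = y ord0 j + t * (w ord0 j - y ord0 j)) ->
     forall i, `|partial i f z| <= eps) ->
  `|f w - f y| <= eps * \sum_j `|w ord0 j - y ord0 j|.
Proof.
move=> df hS; have [th [th01 ->]] := telescoping_MVT y w df.
apply: le_trans (ler_norm_sum _ _ _) _; rewrite mulr_sumr; apply: ler_sum => m _.
rewrite normrM mulrC ler_wpM2r//; apply: hS => j; exists (th m j) => //.
by rewrite mxE.
Qed.

(** Differentiates quadratic expressions from their exact expansion along a line: the difference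
    quotient is D + s E. *)
Lemma is_derive_expansion (Q : V -> R) x (e : V) (D E : R) :
  (forall s : R, Q (s *: e + x) = Q x + s * D + s ^+ 2 * E) -> is_derive x e Q D.
Proof.
move=> h.
have cv : (fun s : R => s^-1 *: ((Q \o shift x) (s *: e) - Q x)) @ 0^' --> D.
  have : (D + s * E) @[s --> (0 : R)^'] --> (D + 0 * E).
    apply: cvgD; first exact: cvg_cst.
    apply: cvgM; last exact: cvg_cst.
    by apply: cvg_within_filter; exact: cvg_id.
  rewrite mul0r addr0 => cv'.
  apply: cvg_trans cv'; apply: near_eq_cvg; near=> s.
  have s0 : s != 0 by near: s; exact: nbhs_dnbhs_neq.
  by rewrite /= h /GRing.scale /=; field.
by split; [apply/cvg_ex; exists D|apply/cvg_lim].
Unshelve. all: by end_near.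
Qed.

End Taylor.

(** * Symmetry of the Hessian and second-order Taylor estimates *)

Section SecondOrder.
Variables (R : realType) (n : nat).
Notation V := 'rV[R]_n.
Notation e_ := (@unitv R n).
Implicit Types (f g : V -> R) (x y w : V).

Lemma is_derive_translate f (z y e : V) : derivable f (y + z) e ->
  is_derive y e (fun y => f (y + z)) ('D_e f (y + z)).
Proof.
move=> df.
have E : (fun h : R => h^-1 *: (((fun y => f (y + z)) \o shift y) (h *: e) - f (y + z))) =
    (fun h : R => h^-1 *: ((f \o shift (y + z)) (h *: e) - f (y + z))).
  by apply/funext => h /=; rewrite addrA.
by split; [rewrite /derivable E|rewrite /derive E].
Qed.

(** The mean value theorem twice: for x -> f (x + s e_j) - f x in direction e_i, then for
    [partial i f] in direction e_j. The left side is symmetric in i and j, whence [schwarz]. *)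
Lemma second_difference f i j x (s : R) : C2 f ->
  exists c c', [/\ 0 <= c <= 1, 0 <= c' <= 1 &
    f (x + s *: e_ i + s *: e_ j) - f (x + s *: e_ i) - (f (x + s *: e_ j) - f x) =
    s * (s * partial j (partial i f) (x + (c * s) *: e_ i + (c' * s) *: e_ j))].
Proof.
move=> C2f; have [dfi [_ [dfij _]]] := C2f i j.
pose F y := f (y + s *: e_ j) - f y.
have dF y : is_derive y (e_ i) F (partial i f (y + s *: e_ j) - partial i f y).
  have h1 := is_derive_translate (dfi (y + s *: e_ j)).
  have h2 : is_derive y (e_ i) f (partial i f y) by split; [exact: dfi|].
  by have := is_deriveB h1 h2.
have dF' y : derivable F y (e_ i) by have [] := dF y.
have [c [c01 E]] := MVT_line x s dF'.
have [_ E'] := dF (x + (c * s) *: e_ i); rewrite E' in E.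
have dfij' z : derivable (partial i f) z (e_ j) by exact: dfij.
have [c' [c01' E2]] := MVT_line (x + (c * s) *: e_ i) s dfij'.
exists c, c'; split => //; rewrite -/(F x) -/(F (x + s *: e_ i)) E; congr (_ * _).
exact: E2.
Qed.

Lemma coord_norm_lt (x : V) (d : R) : 0 < d -> (forall i, `|x ord0 i| < d) -> `|x| < d.
Proof.
move=> d0 h; rewrite /Num.norm /= mx_normrE; apply: bigmax_lt => // -[i j] _ /=.
by rewrite ord1.
Qed.

Lemma schwarz f : C2 f -> forall i j x, partial j (partial i f) x = partial i (partial j f) x.
Proof.
move=> C2f i j x; apply/eqP; rewrite -subr_eq0 -normr_le0; apply/ler_addgt0Pl => e e0.
rewrite addr0.
have [_ [_ [_ ca]]] := C2f i j; have [_ [_ [_ cb]]] := C2f j i.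
have e2 : 0 < e / 2 by rewrite divr_gt0.
have /cvgrPdist_lt/(_ _ e2)/nbhs_ballP[d1 /= d10 h1] := ca x.
have /cvgrPdist_lt/(_ _ e2)/nbhs_ballP[d2 /= d20 h2] := cb x.
(* The mean value points are within 2 s of x in the maximum norm, so both continuity estimates apply
   to them. *)
pose s := Num.min d1 d2 / 4.
have m0 : 0 < Num.min d1 d2 by rewrite lt_min d10 d20.
have s0 : 0 < s by rewrite divr_gt0.
have near_pt d c c' (p q : 'I_n) : Num.min d1 d2 <= d -> 0 <= c <= 1 -> 0 <= c' <= 1 ->
    ball x d (x + (c * s) *: e_ p + (c' * s) *: e_ q).
  move=> hd /andP[c0 c1] /andP[c0' c1']; rewrite -ball_normE /=.
  rewrite -addrA opprD addrA subrr add0r normrN; apply: lt_le_trans hd.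
  apply: coord_norm_lt => // l; rewrite !mxE !eqxx /=.
  have hc : 0 <= c * s <= s by rewrite mulr_ge0 ?(ltW s0)//= -[leRHS]mul1r ler_pM2r.
  have hc' : 0 <= c' * s <= s by rewrite mulr_ge0 ?(ltW s0)//= -[leRHS]mul1r ler_pM2r.
  have sE : Num.min d1 d2 = 4 * s by rewrite /s mulrC divfK.
  rewrite sE; move: hc hc' => /andP[? ?] /andP[? ?].
  by case: (l == p); case: (l == q); rewrite ?mulr1 ?mulr0 ?addr0 ?add0r ?normr0 ?ger0_norm; lra.
have [c [c' [c1 c1' E1]]] := second_difference i j x s C2f.
have [b [b' [b1 b1' E2]]] := second_difference j i x s C2f.
have EE : partial j (partial i f) (x + (c * s) *: e_ i + (c' * s) *: e_ j) =
          partial i (partial j f) (x + (b * s) *: e_ j + (b' * s) *: e_ i).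
  apply: (@mulfI _ s); first by rewrite gt_eqF.
  apply: (@mulfI _ s); first by rewrite gt_eqF.
  apply: etrans (esym E1) (etrans _ E2).
  rewrite (addrAC x (s *: e_ j) (s *: e_ i)).
  by move: (f _) (f _) (f _) (f _) => a1 a2 a3 a4; ring.
have hm1 : Num.min d1 d2 <= d1 by rewrite ge_min lexx.
have hm2 : Num.min d1 d2 <= d2 by rewrite ge_min lexx orbT.
have H1 := h1 _ (near_pt _ _ _ i j hm1 c1 c1').
have H2 := h2 _ (near_pt _ _ _ j i hm2 b1 b1').
rewrite /= EE in H1; rewrite /= in H2; clear E1 E2 EE; move: H1 H2.
move: (partial i (partial j f) (_ + _ + _)) (partial j (partial i f) x) (partial i (partial j f) x).
move=> u a1 a2 H1 H2; rewrite (_ : a1 - a2 = (a1 - u) - (a2 - u)); last by ring.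
by apply: le_trans (ler_normB _ _) _; lra.
Qed.

Lemma hessian_sym f x : C2 f -> (hessian f x)^T = hessian f x.
Proof. by move=> C2f; apply/matrixP => i j; rewrite !mxE schwarz. Qed.

Lemma dot_mulmx (u v : V) (A : 'M[R]_n) : dot u (v *m A) = dot (u *m A^T) v.
Proof.
rewrite /dot; under eq_bigr do rewrite mxE mulr_sumr.
rewrite exchange_big /=; apply: eq_bigr => j _; rewrite mxE mulr_suml.
by apply: eq_bigr => i _; rewrite mxE; ring.
Qed.

Definition grad f x : V := \row_i partial i f x.

Definition hrem f x0 x : R :=
  f x - (f x0 + dot (grad f x0) (x - x0) + 2^-1 * dot (x - x0) ((x - x0) *m hessian f x0)).

(** By symmetry of the Hessian this is the gradient of [hrem f x0]; see [is_derive_hrem]. *)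
Definition grem f x0 x : V := grad f x - grad f x0 - (x - x0) *m hessian f x0.

Lemma dot_unitv (u : V) i : dot u (e_ i) = u ord0 i.
Proof.
rewrite /dot (bigD1 i)//= mxE !eqxx mulr1 big1 ?addr0// => j ji.
by rewrite mxE (negbTE ji) mulr0.
Qed.

Lemma is_derive_hrem f x0 x i : C2 f -> is_derive x (e_ i) (hrem f x0) (grem f x0 x ord0 i).
Proof.
move=> C2f; have [dfi _] := C2f i i.
pose A := hessian f x0; have symA : A^T = A := hessian_sym x0 C2f.
pose Q x := f x0 + dot (grad f x0) (x - x0) + 2^-1 * dot (x - x0) ((x - x0) *m A).
have dQ : is_derive x (e_ i) Q (grad f x0 ord0 i + ((x - x0) *m A) ord0 i).
  apply: (@is_derive_expansion _ _ _ _ _ _ (2^-1 * dot (e_ i) (e_ i *m A))) => s.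
  rewrite /Q; have -> : s *: e_ i + x - x0 = s *: e_ i + (x - x0) by rewrite addrA.
  move: (x - x0) => d; rewrite mulmxDl -scalemxAl !dotDr !dotDl !dotZr !dotZl dot_unitv.
  have -> : dot d (e_ i *m A) = dot (e_ i) (d *m A) by rewrite dot_mulmx symA dotC.
  by rewrite (dotC (e_ i) (d *m A)) dot_unitv; field.
have df : is_derive x (e_ i) f (partial i f x) by split; [exact: dfi|].
have := is_deriveB df dQ.
rewrite (_ : _ - (_ + _) = grem f x0 x ord0 i) //.
by rewrite /grem -/A; move: ((x - x0) *m A) => M; rewrite !mxE; ring.
Qed.

Lemma is_derive_grem f x0 x i j : C2 f ->
  is_derive x (e_ j) (fun x => grem f x0 x ord0 i) (hessian f x i j - hessian f x0 i j).
Proof.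
move=> C2f; have [_ [_ [dfij _]]] := C2f i j.
pose A := hessian f x0; have symA : A^T = A := hessian_sym x0 C2f.
pose Q x := grad f x0 ord0 i + ((x - x0) *m A) ord0 i.
have dQ : is_derive x (e_ j) Q (A i j).
  apply: (@is_derive_expansion _ _ _ _ _ _ 0) => s.
  rewrite /Q; have -> : s *: e_ j + x - x0 = s *: e_ j + (x - x0) by rewrite addrA.
  move: (x - x0) => d; rewrite mulmxDl -scalemxAl.
  have -> : (s *: (e_ j *m A) + d *m A) ord0 i = s * A j i + (d *m A) ord0 i.
    by rewrite -rowE; move: (d *m A) => M; rewrite !mxE.
  have -> : A j i = A i j by rewrite -{1}symA mxE.
  by ring.
have df : is_derive x (e_ j) (partial i f) (partial j (partial i f) x) by split; [exact: dfij|].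
have := is_deriveB df dQ.
rewrite (_ : partial i f - Q = (fun x => grem f x0 x ord0 i)); last first.
  apply/funext => z; have -> : (partial i f - Q) z = partial i f z - Q z by [].
  by rewrite /grem -/A /Q; move: ((z - x0) *m A) => M; rewrite !mxE; ring.
move=> H; apply: is_derive_eq H _; congr (_ - _).
by apply: esym; exact: mxE.
Qed.

(** Partial derivatives of [grem] are differences of Hessian entries, those of [hrem] are entries of
    [grem]; coordinate paths produce the sums of absolute values. The form with two free points y, w
    is what the tangent inequality in [tame] asks for. *)
Lemma taylor_bound f x0 (rho eps : R) : C2 f -> 0 <= eps ->
  (forall z, `|z - x0| <= rho -> forall i j, `|hessian f z i j - hessian f x0 i j| <= eps) ->
  forall y w, `|y - x0| <= rho -> `|w - x0| <= rho ->
    (forall i, `|grem f x0 w ord0 i - grem f x0 y ord0 i| <= eps * \sum_j `|w ord0 j - y ord0 j|) /\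
    `|hrem f x0 w - hrem f x0 y - dot (grem f x0 y) (w - y)|
      <= eps * (\sum_j `|w ord0 j - y ord0 j|) ^+ 2.
Proof.
move=> C2f eps0 hes.
have inball (y w z : V) : `|y - x0| <= rho -> `|w - x0| <= rho ->
    (forall j, exists2 t, 0 <= t <= 1 & z ord0 j = y ord0 j + t * (w ord0 j - y ord0 j)) ->
    `|z - x0| <= rho.
  move=> hy hw hz; apply: norm_le_coord; first by apply: le_trans hy.
  move=> j; have := coord_le_norm (y - x0) j; have := coord_le_norm (w - x0) j.
  move=> /le_trans /(_ hw) + /le_trans /(_ hy); rewrite !mxE !ler_norml.
  have [t /andP[t0 t1] ->] := hz j => /andP[a1 a2] /andP[b1 b2].
  have t1' : 0 <= 1 - t by rewrite subr_ge0.
  have := ler_wpM2l t0 a1; have := ler_wpM2l t0 a2.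
  have := ler_wpM2l t1' b1; have := ler_wpM2l t1' b2.
  by move=> *; apply/andP; split; lra.
have gbound y w : `|y - x0| <= rho -> `|w - x0| <= rho -> forall i,
    `|grem f x0 w ord0 i - grem f x0 y ord0 i| <= eps * \sum_j `|w ord0 j - y ord0 j|.
  move=> hy hw i; apply: (@MVT_bound _ _ (fun x => grem f x0 x ord0 i)).
    by move=> j z; have [] := is_derive_grem x0 z i j C2f.
  move=> z hz j; rewrite /partial; have [_ ->] := is_derive_grem x0 z i j C2f.
  by apply: hes; exact: inball hy hw hz.
move=> y w hy hw; split; first exact: gbound.
have dh i z : derivable (hrem f x0) z (e_ i) by have [] := is_derive_hrem x0 z i C2f.
have [th [th01 ->]] := telescoping_MVT y w dh.
rewrite dotC /dot -sumrB expr2 mulrA mulr_sumr.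
apply: le_trans (ler_norm_sum _ _ _) _; apply: ler_sum => m _.
set z := \row_j _; rewrite /partial; have [_ ->] := is_derive_hrem x0 z m C2f.
have -> : (w - y) ord0 m = w ord0 m - y ord0 m by rewrite !mxE.
rewrite -mulrBr normrM mulrC ler_wpM2r//.
have hz : `|z - x0| <= rho.
  by apply: inball hy hw _ => j; exists (th m j) => //; rewrite mxE.
apply: le_trans (gbound _ _ hy hz m) _; rewrite ler_wpM2l//; apply: ler_sum => j _.
rewrite mxE addrC addKr normrM -[leRHS]mul1r ler_wpM2r//.
by have /andP[t0 t1] := th01 m j; rewrite ger0_norm.
Qed.

End SecondOrder.

(** * Compactness, Lipschitz bounds, continuity of characteristic coefficients *)

Section Regularity.
Variables (R : realType) (n : nat).
Notation V := 'rV[R]_n.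

Lemma compact_cball (rho : R) : compact [set x : V | `|x| <= rho].
Proof.
apply: bounded_closed_compact; first by apply/bounded_setP; exists rho.
rewrite (_ : [set _ | _] = Num.norm @^-1` [set y | y <= rho])//.
by apply: closed_comp => [y _|]; [exact: norm_continuous|exact: closed_le].
Qed.

(** [z] may leave the ball: only the centres [x] range over a compact set, on which a near-covering
    argument makes the radius uniform. *)
Lemma unif_cont (D : V -> R) (rho eps : R) : continuous D -> 0 < eps ->
  \forall d \near (0 : R)^'+, forall x z : V, `|x| <= rho -> `|z - x| <= d -> `|D z - D x| <= eps.
Proof.
move=> cD e0; have e2 : 0 < eps / 2 by rewrite divr_gt0.
pose P (d : R) (x : V) := forall z, `|z - x| <= d -> `|D z - D x| <= eps.
have cover (x : V) : `|x| <= rho -> \forall x' \near x & d \near (0 : R)^'+, P d x'.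
  move=> _; have /cvgrPdist_lt/(_ _ e2)/nbhs_ballP[r /= r0 hr] := cD x.
  have r2 : 0 < r / 2 by rewrite divr_gt0.
  exists (ball x (r / 2), [set d | d < r / 2]) => /=.
    by split; [exact: nbhsx_ballx|exact: nbhs_right_lt].
  move=> [x' d] /= [xx' dr] z zx'; move: xx'; rewrite -ball_normE /= => xx'.
  have b1 : ball x r x' by rewrite -ball_normE /=; lra.
  have b2 : ball x r z.
    rewrite -ball_normE /=; have -> : x - z = (x - x') - (z - x') by rewrite opprB addrA subrK.
    by apply: le_lt_trans (ler_normB _ _) _; lra.
  have := hr _ b1; have := hr _ b2 => /= h1 h2.
  have -> : D z - D x' = (D x - D x') - (D x - D z) by ring.
  by apply: le_trans (ler_normB _ _) _; lra.
have FF : Filter (0 : R)^'+ by typeclasses eauto.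
have KP := (@compact_near_coveringP _ _).1 (@compact_cball rho) R _ P FF cover.
by apply: filterS KP => d KP x z xr; exact: KP.
Qed.

Lemma cont_bounded (D : V -> R) (rho : R) : continuous D ->
  exists M, forall x : V, `|x| <= rho -> `|D x| <= M.
Proof.
move=> cD.
have /compact_bounded[M [_ hM]] : compact (D @` [set x : V | `|x| <= rho]).
  by apply: continuous_compact; [exact: continuous_subspaceT|exact: compact_cball].
by exists (M + 1) => x xr; apply: (hM (M + 1)); [rewrite ltrDl|exists x].
Qed.

Lemma prod_lip (s : seq 'I_n) (a b : 'I_n -> R) (D tau : R) : 1 <= D -> 0 <= tau ->
  (forall i, 0 <= a i <= b i) -> (forall i, b i <= D) -> (forall i, b i - a i <= tau) ->
  0 <= \prod_(i <- s) b i - \prod_(i <- s) a i <= (size s)%:R * D ^+ size s * tau.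
Proof.
move=> D1 t0 ab bD bt; have D0 : 0 <= D by lra.
elim: s => [|i s /andP[IH1 IH2]]; first by rewrite !big_nil subrr mul0r mul0r lexx.
rewrite !big_cons /= -natr1 exprS.
have a0 : 0 <= \prod_(j <- s) a j.
  by apply: prodr_ge0 => j _; have /andP[] := ab j.
have bX : 0 <= \prod_(j <- s) b j <= D ^+ size s.
  elim: (s) => [|j t /andP[h1 h2]]; first by rewrite big_nil ler01 lexx.
  have /andP[aj bj] := ab j; have b0 : 0 <= b j by lra.
  by rewrite big_cons /= exprS mulr_ge0//= ler_pM.
move: bX => /andP[bX0 bX]; have /andP[ai bi] := ab i; have := bt i; have := bD i.
have Ds : 0 <= D ^+ size s by rewrite exprn_ge0.
have Ds1 : D ^+ size s <= D * D ^+ size s by rewrite -[leLHS]mul1r ler_wpM2r.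
move: (\prod_(j <- s) a j) (\prod_(j <- s) b j) (D ^+ size s) (size s)%:R a0 bX0 bX IH1 IH2 Ds Ds1.
move=> A B X N a0 bX0 bX IH1 IH2 Ds Ds1 biD bit.
have -> : b i * B - a i * A = (b i - a i) * B + a i * (B - A) by ring.
have h1 : 0 <= (b i - a i) * B by rewrite mulr_ge0// subr_ge0.
have h2 : 0 <= a i * (B - A) by rewrite mulr_ge0.
apply/andP; split; first exact: addr_ge0.
have h3 : (b i - a i) * B <= tau * (D * X).
  by apply: ler_pM => //; [rewrite subr_ge0|exact: le_trans Ds1].
have h4 : a i * (B - A) <= D * (N * X * tau).
  by apply: ler_pM => //; lra.
by lra.
Qed.

(** The order a <= b fits the application, where b is a shifted by a nonnegative amount. *)
Lemma esym_lip k (a b : 'I_n -> R) (D tau : R) : 1 <= D -> 0 <= tau ->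
  (forall i, 0 <= a i <= b i) -> (forall i, b i <= D) -> (forall i, b i - a i <= tau) ->
  `|Defs.esym k b - Defs.esym k a| <=
    (\sum_(I : {set 'I_n} | #|I| == k) (size (enum I))%:R * D ^+ size (enum I)) * tau.
Proof.
move=> D1 t0 ab bD bt; rewrite /Defs.esym -sumrB mulr_suml.
apply: le_trans (ler_norm_sum _ _ _) _; apply: ler_sum => I _.
have := prod_lip (enum I) D1 t0 ab bD bt; rewrite !big_enum /= => /andP[h1 h2].
by rewrite ger0_norm.
Qed.

Definition coefs_continuous (T : topologicalType) (p : T -> {poly R}) :=
  forall i, continuous (fun x => (p x)`_i).

Lemma coefs_continuous_sum (T : topologicalType) (I : Type) (s : seq I) (p : I -> T -> {poly R}) :
  (forall i, coefs_continuous (p i)) -> coefs_continuous (fun x => \sum_(i <- s) p i x).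
Proof.
move=> cp i.
have -> : (fun x => (\sum_(j <- s) p j x)`_i) = (fun x => \sum_(j <- s) (p j x)`_i).
  by apply/funext => x; rewrite coef_sum.
move=> x.
by apply: (@cvg_rsum _ _ _ (nbhs x) _ _ _ (fun l x => (p l x)`_i)) => l _; exact: cp.
Qed.

Lemma coefs_continuousM (T : topologicalType) (p q : T -> {poly R}) :
  coefs_continuous p -> coefs_continuous q -> coefs_continuous (fun x => p x * q x).
Proof.
move=> cp cq i.
have -> : (fun x => (p x * q x)`_i) = (fun x => \sum_(j < i.+1) (p x)`_j * (q x)`_(i - j)).
  by apply/funext => x; rewrite coefM.
move=> x.
apply: (@cvg_rsum _ _ _ (nbhs x) _ _ _ (fun (j : 'I_i.+1) x => (p x)`_j * (q x)`_(i - j))) => l _.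
by apply: cvgM; [exact: cp|exact: cq].
Qed.

Lemma coefs_continuous_prod (T : topologicalType) (I : Type) (s : seq I) (p : I -> T -> {poly R}) :
  (forall i, coefs_continuous (p i)) -> coefs_continuous (fun x => \prod_(i <- s) p i x).
Proof.
move=> cp; elim: s => [|j s IH] i.
  have -> : (fun x => (\prod_(j <- [::]) p j x)`_i) = (fun=> (1 : {poly R})`_i).
    by apply/funext => x; rewrite big_nil.
  by move=> x; exact: cvg_cst.
have -> : (fun x => (\prod_(l <- j :: s) p l x)`_i) = (fun x => (p j x * \prod_(l <- s) p l x)`_i).
  by apply/funext => x; rewrite big_cons.
exact: (coefs_continuousM (cp j) IH).
Qed.

Lemma char_poly_continuous (T : topologicalType) (A : T -> 'M[R]_n) :
  (forall i j, continuous (fun x => A x i j)) -> coefs_continuous (fun x => char_poly (A x)).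
Proof.
move=> cA; rewrite /char_poly /determinant; apply: coefs_continuous_sum => s.
apply: coefs_continuousM; first by move=> i x; exact: cvg_cst.
apply: coefs_continuous_prod => j l.
have -> : (fun x => (char_poly_mx (A x) j (s j))`_l) =
    (fun x => ('X%:M j (s j) : {poly R})`_l - (if l == 0%N then A x j (s j) else 0)).
  by apply/funext => x; rewrite /char_poly_mx !mxE coefB coefC.
move=> x; apply: cvgB; first exact: cvg_cst.
by case: (l == 0%N); [exact: cA|exact: cvg_cst].
Qed.

End Regularity.

(** * Hessians of convex functions *)

Section Hessian.
Variables (R : realType) (n : nat).
Notation V := 'rV[R]_n.
Implicit Types (f : V -> R).

Lemma hessian_continuous f i j : C2 f -> continuous (fun x => hessian f x i j).
Proof.
move=> C2f; have [_ [_ [_ c]]] := C2f i j.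
have -> : (fun x => hessian f x i j) = partial j (partial i f); last exact: c.
by apply/funext => x; rewrite mxE.
Qed.

Lemma hessian_unif f (rho eps : R) : C2 f -> 0 < eps ->
  exists2 d, 0 < d & forall x z : V, `|x| <= rho -> `|z - x| <= d ->
    forall i j, `|hessian f z i j - hessian f x i j| <= eps.
Proof.
move=> C2f e0.
have H : \forall d \near (0 : R)^'+, forall i j, forall x z : V, `|x| <= rho -> `|z - x| <= d ->
    `|hessian f z i j - hessian f x i j| <= eps.
  apply: filter_forall => i; apply: filter_forall => j.
  by apply: (@unif_cont _ _ (fun x => hessian f x i j)) => //; exact: hessian_continuous.
have [d [hd d0]] := filter_ex (filterI H (nbhs_right_gt 0)).
by exists d => // x z xr zx i j; exact: hd.
Qed.

Lemma hessian_bounded f (rho : R) : C2 f ->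
  exists2 M, 0 <= M & forall x : V, `|x| <= rho -> forall i j, `|hessian f x i j| <= M.
Proof.
move=> C2f.
have /choice[M hM] (p : 'I_n * 'I_n) : exists M, forall x : V, `|x| <= rho -> `|hessian f x p.1 p.2| <= M.
  by apply: (@cont_bounded _ _ (fun x => hessian f x p.1 p.2)); exact: hessian_continuous.
exists (\sum_p `|M p|); first exact: sumr_ge0.
move=> x xr i j; apply: le_trans (hM (i, j) x xr) _; apply: le_trans (ler_norm _) _.
by rewrite (bigD1 (i, j))//= lerDl sumr_ge0.
Qed.

Lemma hrem0 f x0 : hrem f x0 x0 = 0.
Proof. by rewrite /hrem subrr mul0mx !dot0r mulr0 !addr0 subrr. Qed.

Lemma grem0 f x0 : grem f x0 x0 = 0.
Proof. by rewrite /grem !subrr mul0mx subr0. Qed.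

(** Convexity at the midpoint of x0 + s v and x0 - s v: first-order terms cancel, and the Hessian
    term survives against a Taylor error of order eps s^2. *)
Lemma hessian_psd f x0 (v : V) : convex_fun f -> C2 f -> 0 <= dot v (v *m hessian f x0).
Proof.
move=> cf C2f; rewrite -oppr_le0; apply/ler_addgt0Pl => e e0; rewrite addr0.
pose S := \sum_j `|v ord0 j|; have S0 : 0 <= S by exact: sumr_ge0.
(* Chosen so that 2 eps S^2 <= e; the summand 1 covers v = 0. *)
pose eps := e / (2 * (S ^+ 2 + 1)).
have den : 0 < 2 * (S ^+ 2 + 1) by rewrite mulr_gt0// ltr_wpDl// sqr_ge0.
have eps0 : 0 < eps by rewrite divr_gt0.
have [d d0 hd] := hessian_unif `|x0| C2f eps0.
pose s := d / (`|v| + 1); have v1 : 0 < `|v| + 1 by rewrite ltr_wpDl.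
have s0 : 0 < s by rewrite divr_gt0.
have sv : s * `|v| <= d.
  by rewrite /s mulrAC ler_pdivrMr// ler_pM2l//; lra.
have tb := taylor_bound C2f (ltW eps0) (fun z => hd x0 z (lexx _)).
have xx : `|x0 - x0| <= d by rewrite subrr normr0 ltW.
have est t : `|t| = s -> `|hrem f x0 (x0 + t *: v)| <= eps * (s * S) ^+ 2.
  move=> ts; have hw : `|x0 + t *: v - x0| <= d by rewrite addrC addKr normrZ ts.
  have [_] := tb x0 (x0 + t *: v) xx hw.
  rewrite hrem0 grem0 dotC dot0r !subr0; congr (_ <= _ * _ ^+ 2).
  rewrite /S mulr_sumr; apply: eq_bigr => j _.
  have -> : (x0 + t *: v) ord0 j - x0 ord0 j = t * v ord0 j by rewrite !mxE; ring.
  by rewrite normrM ts.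
have h1 := est s (gtr0_norm s0).
have h2 := est (- s) (etrans (normrN _) (gtr0_norm s0)).
have cv := cf (x0 + s *: v) (x0 + (- s) *: v) 2^-1.
have cv' : f x0 <= (1 - 2^-1) * f (x0 + s *: v) + 2^-1 * f (x0 + (- s) *: v).
  have -> : f x0 = f ((1 - 2^-1) *: (x0 + s *: v) + 2^-1 *: (x0 + (- s) *: v)).
    congr f; rewrite !scalerDr !scalerA addrACA -scalerDl subrK scale1r -scalerDl.
    by rewrite (_ : _ + _ = 0 :> R) ?scale0r ?addr0//; field.
  by apply: cv; lra.
move: h1 h2; rewrite !ler_norml => /andP[_ h1] /andP[_ h2].
move: h1 h2; rewrite /hrem !(addrC x0) !addrK -!scalemxAl !dotZl !dotZr.
move: cv'; rewrite !(addrC x0); set q := dot v _; set g := dot _ v.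
move: (f (s *: v + x0)) (f (- s *: v + x0)) => f1 f2 cv' h1 h2.
have h3 : - (s * (s * q)) <= 2 * (eps * (s * S) ^+ 2) by lra.
have s2 : 0 < s ^+ 2 by rewrite exprn_gt0.
have h4 : - q <= 2 * eps * S ^+ 2.
  by rewrite -(ler_pM2l s2); move: h3; rewrite exprMn expr2; lra.
apply: le_trans h4 _; rewrite /eps.
have -> : 2 * (e / (2 * (S ^+ 2 + 1))) * S ^+ 2 = e * (S ^+ 2 / (S ^+ 2 + 1)).
  by field; rewrite gt_eqF// ltr_wpDl// sqr_ge0.
rewrite -[leRHS]mulr1 ler_pM2l// ler_pdivrMr ?mul1r; first by lra.
by rewrite ltr_wpDl// sqr_ge0.
Qed.

Lemma dot_mx (u v : V) : dot u v = (u *m v^T) ord0 ord0.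
Proof. by rewrite mxE; apply: eq_bigr => i _; rewrite mxE. Qed.

Lemma mulmx_trE (U : 'M[R]_n) (v : V) i : (v *m U^T) ord0 i = dot (row i U) v.
Proof. by rewrite mxE dotC; apply: eq_bigr => j _; rewrite !mxE. Qed.

Lemma dot_ortho (U : 'M[R]_n) (v : V) : U *m U^T = 1%:M ->
  dot v v = \sum_i sq (row i U) v.
Proof.
move=> UU; rewrite dot_mx -[v in v *m _]mulmx1 -(mulmx1C UU) mulmxA -mulmxA -[U *m v^T]trmxK.
by rewrite trmx_mul trmxK -dot_mx; apply: eq_bigr => i _; rewrite mulmx_trE -expr2.
Qed.

Lemma dot_spectral (U : 'M[R]_n) (lam : 'rV[R]_n) (v : V) :
  dot v (v *m (U^T *m diag_mx lam *m U)) = \sum_i lam ord0 i * sq (row i U) v.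
Proof.
rewrite !mulmxA dot_mulmx dotC; apply: eq_bigr => i _.
rewrite mul_mx_diag [in LHS]mxE [X in X * _ * _]mulmx_trE mulmx_trE /sq; ring.
Qed.

Lemma row_ortho (U : 'M[R]_n) i : U *m U^T = 1%:M -> dot (row i U) (row i U) = 1.
Proof.
move=> UU; have := congr1 (fun M : 'M[R]_n => M i i) UU; rewrite !mxE eqxx => E.
by apply: etrans E; apply: eq_bigr => j _; rewrite !mxE.
Qed.

Lemma row_ortho_le1 (U : 'M[R]_n) i j : U *m U^T = 1%:M -> `|U i j| <= 1.
Proof.
move=> UU; rewrite -(@ler_pXn2r _ 2)// ?nnegrE// real_normK ?num_real// expr1n.
rewrite -(row_ortho i UU) /dot (bigD1 j)//= !mxE -expr2 lerDl.
by apply: sumr_ge0 => l _; rewrite -expr2 sqr_ge0.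
Qed.

Lemma hessian_spectral f x0 : convex_fun f -> C2 f ->
  exists (U : 'M[R]_n) (lam : 'I_n -> R), [/\ U *m U^T = 1%:M, (forall i, 0 <= lam i),
    (forall v, dot v (v *m hessian f x0) = \sum_i lam i * sq (row i U) v),
    eigenvalues_of (hessian f x0) lam &
    forall M, (forall i j, `|hessian f x0 i j| <= M) -> forall i, lam i <= n%:R ^+ 2 * M].
Proof.
move=> cf C2f; have [U [lam [UU AE]]] := real_spectral (hessian_sym x0 C2f).
have dE v : dot v (v *m hessian f x0) = \sum_i lam ord0 i * sq (row i U) v.
  by rewrite AE; exact: dot_spectral.
have lamE i : lam ord0 i = dot (row i U) (row i U *m hessian f x0).
  rewrite dE (bigD1 i)//= /sq row_ortho// expr1n mulr1 big1 ?addr0// => j ji.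
  suff -> : dot (row j U) (row i U) = 0 by rewrite expr0n mulr0.
  have := congr1 (fun M : 'M[R]_n => M j i) UU; rewrite !mxE (negbTE ji) => E.
  by apply: etrans E; apply: eq_bigr => l _; rewrite !mxE.
exists U, (fun i => lam ord0 i); split => //.
- by move=> i; rewrite lamE; exact: hessian_psd.
- by rewrite AE; exact: eigenvalues_of_spectral.
move=> M hM i; rewrite lamE; apply: le_trans (ler_norm _) _.
have M0 : 0 <= M by apply: le_trans (hM i i).
apply: le_trans (ler_norm_sum _ _ _) _.
have -> : n%:R ^+ 2 * M = \sum_(j < n) \sum_(l < n) M.
  by rewrite !sumr_const !card_ord -mulrnA -[RHS]mulr_natr natrM expr2 mulrC.
apply: ler_sum => j _; rewrite [(_ *m _) _ _]mxE mulr_sumr.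
apply: le_trans (ler_norm_sum _ _ _) _; apply: ler_sum => l _.
rewrite ![row _ _ _ _]mxE !normrM -[leRHS]mul1r ler_pM// ?row_ortho_le1//.
by rewrite -[leRHS]mul1r ler_pM// ?row_ortho_le1.
Qed.

(** Goes through coefficients of the characteristic polynomial, which avoids a continuous choice of
    eigenvalues. *)
Lemma sigma_k_continuous f k : convex_fun f -> C2 f ->
  continuous (fun x => sigma_k k (hessian f x)).
Proof.
move=> cf C2f; have [kn|nk] := leqP k n.
  have -> : (fun x => sigma_k k (hessian f x)) =
      (fun x => (-1) ^+ k * (char_poly (hessian f x))`_(n - k)).
    apply/funext => x; have [U [lam [_ _ _ eig _]]] := hessian_spectral x cf C2f.
    exact: sigma_k_char_poly eig.
  have cg : coefs_continuous (fun x => char_poly (hessian f x)).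
    by apply: char_poly_continuous => i j; exact: hessian_continuous.
  move=> x; apply: (@continuousM _ _ (fun=> (-1) ^+ k) _ x); first exact: cst_continuous.
  exact: cg.
have -> : (fun x => sigma_k k (hessian f x)) = (fun=> 0); last exact: cst_continuous.
apply/funext => x; have [U [lam [_ _ _ eig _]]] := hessian_spectral x cf C2f.
by rewrite (sigma_kE _ eig) esym_gt.
Qed.

Lemma sigma_k_ge0 f k x : convex_fun f -> C2 f -> 0 <= sigma_k k (hessian f x).
Proof.
move=> cf C2f; have [U [lam [_ lam0 _ eig _]]] := hessian_spectral x cf C2f.
by rewrite (sigma_kE _ eig); apply: sumr_ge0 => I _; apply: prodr_ge0.
Qed.

End Hessian.

(** * Taylor remainders and quadratic forms are tame *)

Section TameExamples.
Variables (R : realType) (n : nat).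
Notation V := 'rV[R]_n.+1.
Notation dd := (n.+1%:R : R).

Lemma tameD (k1 k2 r : R) p q (G H : V -> V) : tame k1 r p G -> tame k2 r q H ->
  tame (k1 + k2) r (fun y => p y + q y) (fun y => G y + H y).
Proof.
move=> tp tq y hy; have [p1 p2 p3] := tp y hy; have [q1 q2 q3] := tq y hy; split.
- by rewrite mulrDl; apply: le_trans (ler_normD _ _) _; exact: lerD.
- by move=> i; rewrite mxE mulrDl; apply: le_trans (ler_normD _ _) _; exact: lerD.
- move=> w hw; rewrite dotDl; have := p3 w hw; have := q3 w hw => *; lra.
Qed.

Lemma tame_mono (k1 k2 r : R) p (G : V -> V) : 0 <= r -> k1 <= k2 -> tame k1 r p G -> tame k2 r p G.
Proof.
move=> r0 k12 tp y hy; have [p1 p2 p3] := tp y hy; split.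
- by apply: le_trans p1 _; rewrite ler_wpM2r// exprn_ge0.
- by move=> i; apply: le_trans (p2 i) _; rewrite ler_wpM2r.
- move=> w hw; apply: le_trans (p3 w hw); rewrite lerD2l lerN2 ler_wpM2r//.
  exact: dot_ge0.
Qed.

Lemma dd_ge1 : 1 <= dd. Proof. by rewrite ler1n. Qed.

Lemma cellN_coord r (y : V) j : cellN r y -> `|y ord0 j| <= 2 * r.
Proof. by move=> /(_ j) /andP[h1 h2]; rewrite ler_norml; apply/andP; split; lra. Qed.

Lemma cellN_sum r (y : V) : cellN r y -> \sum_j `|y ord0 j| <= 2 * r * dd.
Proof.
move=> hy; have -> : 2 * r * dd = \sum_(j < n.+1) 2 * r by rewrite sumr_const card_ord mulr_natr.
by apply: ler_sum => j _; exact: cellN_coord.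
Qed.

Lemma sum_sq_le (d : V) : (\sum_j `|d ord0 j|) ^+ 2 <= 2 * dd * dot d d.
Proof.
have -> : 2 * dd * dot d d = \sum_(i < n.+1) \sum_(j < n.+1) (d ord0 i ^+ 2 + d ord0 j ^+ 2).
  under eq_bigr do rewrite big_split /= sumr_const card_ord.
  rewrite big_split /= sumr_const card_ord sumrMnl.
  have -> : \sum_(i < n.+1) d ord0 i ^+ 2 = dot d d by apply: eq_bigr => i _; rewrite expr2.
  by rewrite -mulr_natl; ring.
rewrite expr2 mulr_suml; apply: ler_sum => i _; rewrite mulr_sumr; apply: ler_sum => j _.
rewrite -[d ord0 i ^+ 2](real_normK (num_real _)) -[d ord0 j ^+ 2](real_normK (num_real _)).
have := normr_ge0 (d ord0 i); have := normr_ge0 (d ord0 j).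
by move: `|_| `|_| => a b a0 b0; nra.
Qed.

(** Sums of absolute coordinates on a cell are at most 2 r dd, so hrem / eps is at most (2 r dd)^2.
    The constant involves neither eps nor r, so one tame bound serves all small cubes. *)
Lemma tame_hrem f a (r eps : R) : C2 f -> 0 < r -> 0 < eps ->
  (forall z : V, `|z - a| <= 2 * r -> forall i j, `|hessian f z i j - hessian f a i j| <= eps) ->
  tame (4 * dd ^+ 2) r (fun y => hrem f a (a + y) / eps) (fun y => eps^-1 *: grem f a (a + y)).
Proof.
move=> C2f r0 e0 hes; have d1 := dd_ge1.
have inb y : cellN r y -> `|a + y - a| <= 2 * r.
  move=> hy; rewrite addrC addKr; apply: norm_le_coord => [|j]; first by lra.
  exact: cellN_coord.
have tb := taylor_bound C2f (ltW e0) hes.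
have ab : `|a - a| <= 2 * r by rewrite subrr normr0; lra.
have subE (y w : V) j : (a + w) ord0 j - (a + y) ord0 j = (w - y) ord0 j.
  by rewrite !mxE; ring.
have sub0E (y : V) j : (a + y) ord0 j - a ord0 j = y ord0 j by rewrite !mxE; ring.
have S0 (y : V) : 0 <= \sum_j `|y ord0 j| by exact: sumr_ge0.
move=> y hy; have [h1 h2] := tb a (a + y) ab (inb y hy).
have E0 : \sum_j `|(a + y) ord0 j - a ord0 j| = \sum_j `|y ord0 j|.
  by apply: eq_bigr => j _; rewrite sub0E.
rewrite E0 in h1 h2; split.
- move: h2; rewrite hrem0 grem0 dotC dot0r !subr0 normrM normfV (gtr0_norm e0) => h2.
  rewrite ler_pdivrMr//; apply: le_trans h2 _; rewrite mulrC ler_pM2r//.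
  have := cellN_sum hy; have := S0 y; move: (\sum_j _) => S S0' hS.
  have : S ^+ 2 <= (2 * r * dd) ^+ 2 by rewrite lerXn2r// nnegrE//; lra.
  by rewrite !exprMn; lra.
- move=> i; move: (h1 i); rewrite grem0 [X in _ - X]mxE subr0 => h1i.
  rewrite mxE normrM normfV (gtr0_norm e0) mulrC ler_pdivrMr//.
  apply: le_trans h1i _; rewrite mulrC ler_pM2r//; apply: le_trans (cellN_sum hy) _.
  have : r * dd <= r * dd ^+ 2 by rewrite ler_pM2l// expr2 -[leLHS]mul1r ler_wpM2r// ler0n.
  have : 0 <= r * dd ^+ 2 by rewrite mulr_ge0 ?exprn_ge0// ltW.
  by lra.
- move=> w hw; have [_ ] := tb (a + y) (a + w) (inb y hy) (inb w hw).
  have -> : a + w - (a + y) = w - y by rewrite opprD addrACA subrr add0r.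
  have -> : \sum_j `|(a + w) ord0 j - (a + y) ord0 j| = \sum_j `|(w - y) ord0 j|.
    by apply: eq_bigr => j _; rewrite subE.
  rewrite ler_norml => /andP[h _]; have hs := sum_sq_le (w - y); have dp := dot_ge0 (w - y).
  rewrite dotZl -(ler_pM2l e0) mulrBr mulrDr [eps * (eps^-1 * _)]mulrA mulfV ?gt_eqF// mul1r.
  rewrite ![eps * (_ / eps)]mulrC !divfK ?gt_eqF//.
  have := ler_wpM2l (ltW e0) hs.
  have : eps * (2 * dd * dot (w - y) (w - y)) <= eps * (4 * dd ^+ 2 * dot (w - y) (w - y)).
    rewrite ler_pM2l// ler_wpM2r//; nra.
  move: h; move: (dot (grem _ _ _) _) (hrem _ _ _) (hrem _ _ _) (\sum_j _) => g h1' h2' S.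
  by move: (eps * (2 * dd * _)) (eps * (4 * _ * _)) => *; lra.
Qed.

Lemma dot_suml (I : Type) (s : seq I) (F : I -> V) (x : V) :
  dot (\sum_(i <- s) F i) x = \sum_(i <- s) dot (F i) x.
Proof.
elim: s => [|i s IH]; first by rewrite !big_nil dotC dot0r.
by rewrite !big_cons dotDl IH.
Qed.

(** With nonnegative coefficients the form lies above its tangents, so the constant only has to
    cover sizes: dd terms of size T (2 r dd)^2. *)
Lemma tame_quad (us : 'I_n.+1 -> V) (cs : 'I_n.+1 -> R) (r T : R) : 0 < r -> 0 <= T ->
  (forall i j, `|us i ord0 j| <= 1) -> (forall i, 0 <= cs i <= T) ->
  tame (4 * dd ^+ 3 * T) r (quad us cs)
    (fun y => \sum_(i < n.+1) (2 * cs i * dot (us i) y) *: us i).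
Proof.
move=> r0 T0 us1 csT; have d1 := dd_ge1.
have du i (y : V) : cellN r y -> `|dot (us i) y| <= 2 * r * dd.
  move=> hy; apply: le_trans (ler_norm_sum _ _ _) _; apply: le_trans (cellN_sum hy).
  by apply: ler_sum => j _; rewrite normrM -[leRHS]mul1r ler_wpM2r.
have rd0 : 0 <= 2 * r * dd by rewrite !mulr_ge0// ltW.
move=> y hy; split.
- apply: le_trans (ler_norm_sum _ _ _) _.
  have -> : 4 * dd ^+ 3 * T * r ^+ 2 = \sum_(i < n.+1) T * (2 * r * dd) ^+ 2.
    by rewrite sumr_const card_ord -mulr_natl; ring.
  apply: ler_sum => i _; have /andP[c0 cT] := csT i; rewrite normrM ger0_norm//.
  apply: ler_pM => //; rewrite /sq normrX lerXn2r// ?nnegrE//; exact: du.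
- move=> j; rewrite summxE; apply: le_trans (ler_norm_sum _ _ _) _.
  apply: le_trans (_ : \sum_(i < n.+1) 2 * T * (2 * r * dd) <= _).
    apply: ler_sum => i _; have /andP[c0 cT] := csT i; rewrite mxE normrM.
    have h : `|2 * cs i * dot (us i) y| <= 2 * T * (2 * r * dd).
      rewrite normrM ger0_norm ?mulr_ge0//; apply: ler_pM; rewrite ?mulr_ge0//; first by rewrite ler_pM2l.
      exact: du.
    by rewrite -[leRHS]mulr1; apply: ler_pM.
  have -> : \sum_(i < n.+1) 2 * T * (2 * r * dd) = dd * (2 * T * (2 * r * dd)).
    by rewrite sumr_const card_ord -[LHS]mulr_natl.
  have : 0 <= T * r * dd ^+ 2 by rewrite !mulr_ge0 ?exprn_ge0// ltW.
  have -> : 4 * dd ^+ 3 * T * r = 4 * ((T * r * dd ^+ 2) * dd) by ring.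
  have -> : dd * (2 * T * (2 * r * dd)) = 4 * (T * r * dd ^+ 2) by ring.
  move: (T * r * dd ^+ 2) => X X0; rewrite ler_pM2l// -[leLHS]mulr1 ler_wpM2l//.
- move=> w hw; rewrite dot_suml.
  have k0 : 0 <= 4 * dd ^+ 3 * T * dot (w - y) (w - y).
    by rewrite !mulr_ge0 ?exprn_ge0 ?dot_ge0.
  suff : quad us cs y + \sum_(i < n.+1) dot ((2 * cs i * dot (us i) y) *: us i) (w - y) <= quad us cs w.
    by lra.
  rewrite /quad -big_split; apply: ler_sum => i _ /=; have /andP[c0 _] := csT i.
  rewrite dotZl dotBr /sq; move: (dot _ w) (dot _ y) (cs i) c0 => u v c c0.
  by have := mulr_ge0 c0 (sqr_ge0 (u - v)); lra.
Qed.

End TameExamples.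

(** * The valuation on a small cube *)

Section CubeEstimate.
Variables (R : realType) (n k : nat) (Psi : sMA R n.+1 k).
Notation V := 'rV[R]_n.+1.
Notation vl := (val Psi).
Notation meas := {measure set (Rn_borel R n.+1) -> \bar R}.
Notation dd := (n.+1%:R : R).
Notation hp := (hp R).
Implicit Types (f : V -> R) (a : V).

(** A packing with a single cell: the local function becomes a global convex one at the price of a
    multiple of |y|^2. *)
Lemma tame_extension (kap r : R) p (G : V -> V) : 0 <= kap -> 0 < r <= 1 -> tame kap r p G ->
  exists P : V -> R, [/\ convex_fun P, loc_bounded P &
    forall y, cellN r y -> P y = packC n.+1 kap * dot y y + p y].
Proof.
move=> k0 r01 tp.
have [||| P [cP lP PE]] :=
    @packing R n.+1 unit setT (fun=> r) (fun=> 0) (fun=> p) (fun=> G) kap k0.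
- by exists tt.
- by split.
- by move=> [] [] _ _; left.
- by exists P; split=> // y hy; have := PE tt I y hy; rewrite !add0r.
Qed.

(** Near a, up to an affine function, f + delta |x|^2 is eps P + quad cs, where P extends hrem /
    eps. The term eps packC |y|^2 hidden in P is taken out of cs, and the halves of lam come from
    Taylor's formula. [kap] adds the tame constants of remainder and form, so that the bound applies
    to P + quad at every vertex. *)
Lemma cube_perturbation f a (kap T C r eps delta : R) (U : 'M[R]_n.+1) (lam cs : 'I_n.+1 -> R) :
  convex_fun f -> C2 f -> 0 < r <= 1 -> 0 < eps <= 1 -> 0 <= T -> 0 <= delta ->
  kap = 4 * dd ^+ 2 + 4 * dd ^+ 3 * T ->
  (forall (e p : V -> R) G, convex_fun e -> tame kap r p G ->
    (forall y, cellN r y -> e y = packC n.+1 kap * dot y y + p y) ->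
    `|vl e (@cube R n r)| <= C) ->
  (forall z : V, `|z - a| <= 2 * r -> forall i j, `|hessian f z i j - hessian f a i j| <= eps) ->
  U *m U^T = 1%:M ->
  (forall v, dot v (v *m hessian f a) = \sum_i lam i * sq (row i U) v) ->
  (forall i, cs i = lam i / 2 + delta - eps * packC n.+1 kap) ->
  (forall i, 0 <= cs i <= T) ->
  `|vl (fun x => f x + delta * dot x x) (hbox a (a + const_mx r)) -
    vl (quad (fun i => row i U) cs) (@cube R n r)| <= eps * (bern_norm R n.+1 * C).
Proof.
move=> cf C2f r01 e01 T0 dl0 kapE tb hes UU HE csE csT.
have /andP[r0 r1] := r01; have /andP[e0 e1] := e01; have d1 := dd_ge1 R n.
have cs0 i : 0 <= cs i by have /andP[] := csT i.
set us := fun i => row i U.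
have us1 i j : `|us i ord0 j| <= 1 by rewrite mxE; exact: row_ortho_le1.
have d20 : 0 <= 4 * dd ^+ 2 by rewrite mulr_ge0// exprn_ge0.
have d30 : 0 <= 4 * dd ^+ 3 * T by rewrite !mulr_ge0// exprn_ge0.
have k0 : 0 <= kap by rewrite kapE addr_ge0.
have th := tame_hrem C2f r0 e0 hes.
set p := (fun y => _ / _) in th; set G := (fun y => _ *: _) in th.
have [|P [cP lP PE]] := tame_extension k0 r01 (tame_mono (k2 := kap) (ltW r0) _ th).
  by rewrite kapE lerDl.
have hD (J : {set 'I_n.+1}) :
    `|vl (fun x => P x + quad us (fun i => indv R J i * cs i) x) (@cube R n r)| <= C.
  have Jcs i : 0 <= indv R J i * cs i <= T.
    have /andP[c0 cT] := csT i; rewrite /indv; case: (i \in J); rewrite ?mul1r ?mul0r ?lexx ?csT//.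
  have tq := tame_quad r0 T0 us1 Jcs.
  have := tameD th tq; rewrite -kapE => tpq; apply: tb tpq _.
    by apply: convexD => //; apply: convex_quad => i; have /andP[] := Jcs i.
  by move=> y hy; rewrite PE// addrA.
have := @val_perturbation _ _ _ Psi P us cs 0 (const_mx r) eps C cP lP cs0 e01 hD.
suff -> : vl (fun x => f x + delta * dot x x) (hbox a (a + const_mx r)) =
    vl (fun x => eps * P x + quad us cs x) (hbox 0 (const_mx r)) by [].
have cF : convex_fun (fun x => f x + delta * dot x x).
  apply: convexD => //; apply: convexZ => //.
  under eq_fun do rewrite (dot_ortho _ UU).
  by apply: convex_sum => i _; exact: convex_sq.
have cE : convex_fun (fun x => eps * P x + quad us cs x).
  by apply: convexD; [apply: convexZ => //; exact: ltW|exact: convex_quad].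
have := @affine_dot R n.+1 (grad f a + (2 * delta) *: a) (f a + delta * dot a a).
set l := (fun x : V => _ + _) => la.
have -> : hbox a (a + const_mx r) = hbox (0 + a) (const_mx r + a) by rewrite add0r addrC.
rewrite -(val_translate_box Psi _ _ _ cF) -(val_affine Psi cE la (bborel_hbox _ _)).
apply: (val_local Psi _ _ (@open_cellN R n.+1 r) _ (bborel_hbox _ _)); first last.
- exact: cube_cellN.
- move=> y hy; rewrite PE// /l /p.
  have fE : f (y + a) = hrem f a (a + y) +
      (f a + dot (grad f a) y + 2^-1 * \sum_i lam i * sq (row i U) y).
    by rewrite /hrem -HE [a + y]addrC addrK; ring.
  have qE : quad us cs y = 2^-1 * (\sum_i lam i * sq (row i U) y) +
      (delta - eps * packC n.+1 kap) * dot y y.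
    rewrite (dot_ortho _ UU) !mulr_sumr -big_split; apply: eq_bigr => i _ /=.
    by rewrite csE; ring.
  rewrite fE qE !dotDl dotZl !dotDr [dot y a]dotC.
  have : eps * (hrem f a (a + y) / eps) = hrem f a (a + y) by rewrite mulrC divfK// gt_eqF.
  move: (\sum_i _) (hrem _ _ _) (hrem _ _ _ / _) => S h2 h1 <-; ring.
- by apply: convexD => //; exact: convex_aff.
- exact: (convex_comp_add a cF).
Qed.

Variables (mu : meas) (lmu : is_lebesgue_n mu).

(** The Taylor polynomial contains half of the Hessian, and e_k is k-homogeneous. *)
Definition hconst : R := qconst Psi * 2^-1 ^+ k.

(** [L] comes from the Lipschitz bound for e_k between lam / 2 and cs. It is fixed before delta and
    eps, so that delta can be sent to 0 after the mesh. *)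
Lemma cube_estimate f (rho : R) : convex_fun f -> C2 f ->
  exists2 L, 0 <= L & forall delta eps, 0 < delta <= 1 -> 0 < eps ->
  exists m0, forall m a, (m0 <= m)%N -> `|a| <= rho ->
  `|vl (fun x => f x + delta * dot x x) (hbox a (a + const_mx (hp m))) -
    hconst * sigma_k k (hessian f a) * hp m ^+ n.+1| <= (eps + L * delta) * hp m ^+ n.+1.
Proof.
move=> cf C2f; have [M M0 hM] := hessian_bounded rho C2f; have d1 := dd_ge1 R n.
have dM0 : 0 <= dd ^+ 2 * M by rewrite mulr_ge0// exprn_ge0.
(* Bounds all cs over the ball: half of the eigenvalue bound dd^2 M, plus delta <= 1. *)
pose T := dd ^+ 2 * M / 2 + 1; have T1 : 1 <= T by rewrite /T; lra.
pose kap := 4 * dd ^+ 2 + 4 * dd ^+ 3 * T.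
have k0 : 0 <= kap by rewrite /kap addr_ge0// !mulr_ge0 ?exprn_ge0//; lra.
pose C1 := packC n.+1 kap; have C10 : 0 <= C1 by rewrite /C1 /packC mulr_ge0// addr_ge0.
pose Ls := \sum_(I : {set 'I_n.+1} | #|I| == k) (size (enum I))%:R * T ^+ size (enum I).
have Ls0 : 0 <= Ls by apply: sumr_ge0 => I _; rewrite mulr_ge0// exprn_ge0//; lra.
exists (`|qconst Psi| * Ls); first exact: mulr_ge0.
move=> delta eps /andP[dl0 dl1] e0.
have [C [m1 hC]] := tame_bound Psi k0.
have bC0 : 0 <= bern_norm R n.+1 * `|C| by rewrite mulr_ge0// bern_norm_ge0.
(* Three demands: at most 1 for [val_perturbation], e1 C1 <= delta so that cs >= lam / 2, and a
   perturbation error of at most eps per unit volume. *)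
pose e1 := Num.min 1 (Num.min (delta / (C1 + 1)) (eps / (bern_norm R n.+1 * `|C| + 1))).
have e10 : 0 < e1 by rewrite /e1 !lt_min ltr01/= !divr_gt0// ltr_wpDl.
have e11 : e1 <= 1 by rewrite /e1 ge_min lexx.
have e1C : e1 * C1 <= delta.
  apply: le_trans (_ : e1 * (C1 + 1) <= _); first by rewrite ler_pM2l// lerDl.
  by rewrite -ler_pdivlMr ?ltr_wpDl// /e1 !ge_min lexx orbT.
have e1B : e1 * (bern_norm R n.+1 * `|C|) <= eps.
  apply: le_trans (_ : e1 * (bern_norm R n.+1 * `|C| + 1) <= _); first by rewrite ler_pM2l// lerDl.
  by rewrite -ler_pdivlMr ?ltr_wpDl// /e1 !ge_min lexx !orbT.
have [d d0 hd] := hessian_unif rho C2f e10.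
have /cvgrPdist_le/(_ (d / 2)) := @cvg_hp R; rewrite divr_gt0// => /(_ isT)[m2 _ hm2].
exists (maxn m1 m2) => m a; rewrite geq_max => /andP[m1m m2m] ar.
have h0 := hp_gt0 R m.
have h1 := hp_le1 R m.
have hd2 : 2 * hp m <= d.
  by have := hm2 m m2m; rewrite /= sub0r normrN gtr0_norm//; lra.
have hes z : `|z - a| <= 2 * hp m -> forall i j, `|hessian f z i j - hessian f a i j| <= e1.
  by move=> za; apply: hd => //; exact: le_trans za hd2.
have [U [lam [UU lam0 HE eig lamM]]] := hessian_spectral a cf C2f.
have lM i : lam i <= dd ^+ 2 * M by apply: lamM; exact: hM.
pose cs i := lam i / 2 + delta - e1 * C1.
have csT i : 0 <= cs i <= T.
  have := lam0 i; have := lM i; have : 0 <= e1 * C1 by rewrite mulr_ge0// ltW.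
  rewrite /cs /T; move: (e1 * C1) (dd ^+ 2 * M) e1C dl1 => x y h1' h2' h3' h4' h5'.
  by clear -h1' h2' h3' h4' h5' dl0; apply/andP; split; lra.
have tb (e p : V -> R) (G : V -> V) : convex_fun e -> tame kap (hp m) p G ->
    (forall y, cellN (hp m) y -> e y = packC n.+1 kap * dot y y + p y) ->
    `|vl e (@cube R n (hp m))| <= `|C| * hp m ^+ n.+1.
  move=> ce tp eE; apply: le_trans (hC m e p G m1m ce tp eE) _.
  by rewrite ler_wpM2r ?ler_norm// exprn_ge0// ltW.
have T0 : 0 <= T by lra.
have := @cube_perturbation f a kap T (`|C| * hp m ^+ n.+1) (hp m) e1 delta U lam cs cf C2f.
rewrite h0 h1 e10 e11 (ltW dl0) T0 => /(_ isT isT isT isT erefl tb hes UU HE (fun=> erefl) csT).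
have cs0 i : 0 <= cs i by have /andP[] := csT i.
rewrite (val_quad_ortho Psi lmu m UU cs0) (sigma_kE k eig).
have -> : hconst * Defs.esym k lam = qconst Psi * Defs.esym k (fun i => 2^-1 * lam i).
  by rewrite esymZ /hconst mulrA.
have := @esym_lip R n.+1 k (fun i => 2^-1 * lam i) cs T delta T1 (ltW dl0).
rewrite -/Ls; set q := qconst Psi; set s1 := Defs.esym k cs; set s0 := Defs.esym k _.
have xx0 : 0 < hp m ^+ n.+1 by rewrite exprn_gt0.
move: (hp m ^+ n.+1) xx0 => X X0.
have hlip : (forall i, 0 <= 2^-1 * lam i <= cs i) /\ (forall i, cs i <= T) /\
    (forall i, cs i - 2^-1 * lam i <= delta).
  have w0 : 0 <= e1 * C1 by rewrite mulr_ge0// ltW.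
  split=> [i|]; last split=> i; first by rewrite mulr_ge0 ?lam0//= /cs [_ * lam i]mulrC -addrA lerDl subr_ge0.
    by have /andP[] := csT i.
  have -> : cs i - 2^-1 * lam i = delta - e1 * C1 by rewrite /cs; ring.
  by rewrite lerBlDr lerDl.
case: hlip => h2 [h3 h4] /(_ h2 h3 h4) hl hp1.
set W := vl _ _ in hp1 *.
have -> : W - q * s0 * X = (W - q * s1 * X) + q * (s1 - s0) * X by ring.
apply: le_trans (ler_normD _ _) _; rewrite [leRHS]mulrDl; apply: lerD.
  apply: le_trans hp1 _; rewrite !mulrA ler_pM2r// -mulrA; exact: e1B.
rewrite !normrM (gtr0_norm X0) ler_pM2r// -mulrA ler_wpM2l//.
Qed.

End CubeEstimate.

(** * From small cubes to all bounded Borel sets *)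

Section HessianMeasure.
Variables (R : realType) (n k : nat) (Psi : sMA R n.+1 k).
Notation V := 'rV[R]_n.+1.
Notation vl := (val Psi).
Notation meas := {measure set (Rn_borel R n.+1) -> \bar R}.
Notation hp := (hp R).
Variables (mu : meas) (lmu : is_lebesgue_n mu) (f : V -> R) (cf : convex_fun f) (C2f : C2 f).

Definition hdens (x : V) : R := sigma_k k (hessian f x).

Lemma hdens_continuous : continuous hdens.
Proof. exact: sigma_k_continuous. Qed.

Definition hmeas : meas :=
  density mu (continuous_borel hdens_continuous) (fun x => sigma_k_ge0 k x cf C2f).

Lemma hmeas_le (B : set V) (c : R) : borel_set B -> 0 <= c -> (forall x, B x -> hdens x <= c) ->
  (hmeas B <= c%:E * mu B)%E.
Proof.
move=> mB c0 h; rewrite -integral_cst//; apply: ge0_le_integral => //.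
- by move=> x _; rewrite lee_fin; exact: sigma_k_ge0.
- apply/measurable_EFinP; apply: measurable_funTS; exact: continuous_borel hdens_continuous.
Qed.

Lemma hmeas_ge (B : set V) (c : R) : borel_set B -> 0 <= c -> (forall x, B x -> c <= hdens x) ->
  (c%:E * mu B <= hmeas B)%E.
Proof.
move=> mB c0 h; rewrite -integral_cst//; apply: ge0_le_integral => //.
- apply/measurable_EFinP; apply: measurable_funTS; exact: continuous_borel hdens_continuous.
Qed.

Lemma hmeas_lf : locally_finite hmeas.
Proof.
move=> B bB; have [mB /bounded_setP[r hr]] := bB.
have [M hM] := cont_bounded r hdens_continuous.
apply: (@le_lt_trans _ _ (`|M|%:E * mu B)%E).
  apply: hmeas_le => // x /hr /hM h; apply: le_trans (ler_norm _) _.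
  by apply: le_trans h (ler_norm _).
have := lf_fin (lebesgue_lf lmu) bB; move: (mu B) => [y| |]// _; by rewrite -EFinM ltry.
Qed.

Lemma hmeasU B B' : bounded_borel B -> bounded_borel B' -> B `&` B' = set0 ->
  fine (hmeas (B `|` B')) = fine (hmeas B) + fine (hmeas B').
Proof.
move=> bB bB' BB'; have [mB _] := bB; have [mB' _] := bB'.
by rewrite measureU// fineD//; apply: lf_fin => //; exact: hmeas_lf.
Qed.

Lemma hmeas_cube a (r eta : R) : 0 <= r -> 0 <= eta ->
  (forall z, `|z - a| <= r -> `|hdens z - hdens a| <= eta) ->
  `|fine (hmeas (hbox a (a + const_mx r))) - hdens a * r ^+ n.+1| <= eta * r ^+ n.+1.
Proof.
move=> r0 e0 h; set Q := hbox _ _; have bQ : bounded_borel Q by exact: bborel_hbox.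
have [mQ _] := bQ.
have muQ : fine (mu Q) = r ^+ n.+1.
  rewrite (lebesgue_hbox lmu); last by move=> i; rewrite !mxE lerDl.
  under eq_bigr do rewrite !mxE addrAC subrr add0r.
  by rewrite prodr_const card_ord.
have hQ x : Q x -> `|hdens x - hdens a| <= eta.
  move=> Qx; apply: h; apply: norm_le_coord => // i; have := Qx i; rewrite !mxE => /andP[h1 h2].
  by rewrite ger0_norm ?subr_ge0// lerBlDl ltW.
have muE : mu Q = (r ^+ n.+1)%:E by rewrite -muQ fineK// lf_fin//; exact: lebesgue_lf.
have nuE : hmeas Q = (fine (hmeas Q))%:E by rewrite fineK// lf_fin//; exact: hmeas_lf.
have X0 : 0 <= r ^+ n.+1 by rewrite exprn_ge0.
have a0 : 0 <= hdens a by exact: sigma_k_ge0.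
have := @hmeas_le Q (hdens a + eta) mQ; rewrite muE nuE -EFinM lee_fin => up.
(* The lower constant is cut off at 0 because [hmeas_ge] takes a nonnegative one; positivity of the
   density makes this harmless. *)
have := @hmeas_ge Q (Num.max 0 (hdens a - eta)) mQ; rewrite muE nuE -EFinM lee_fin => lo.
have {}up : fine (hmeas Q) <= (hdens a + eta) * r ^+ n.+1.
  apply: up; first exact: addr_ge0.
  by move=> x /hQ; rewrite ler_norml => /andP[_]; rewrite lerBlDl.
have {}lo : (hdens a - eta) * r ^+ n.+1 <= fine (hmeas Q).
  apply: le_trans (_ : Num.max 0 (hdens a - eta) * r ^+ n.+1 <= _).
    by rewrite ler_wpM2r// le_max lexx orbT.
  apply: lo; first by rewrite le_max lexx.
  move=> x /hQ; rewrite ler_norml ge_max => /andP[hx _]; apply/andP; split; first exact: sigma_k_ge0.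
  by move: hx; clear; move: (hdens x) (hdens a) => s t; lra.
rewrite ler_norml lerBrDr lerBlDr -mulNr -!mulrDl ![_ + hdens a]addrC; exact/andP.
Qed.

(** Both terms are additive over cells, so errors add up to the number of cells times the error of
    one, and containment in the ball passes to parts. *)
Lemma gbox_estimate delta (rho r E : R) : 0 < r -> 0 <= E -> 0 <= delta ->
  (forall a, `|a| <= rho ->
    `|vl (fun x => f x + delta * dot x x) (hbox a (a + const_mx r)) -
      hconst Psi * fine (hmeas (hbox a (a + const_mx r)))| <= E * r ^+ n.+1) ->
  forall a l, gbox a r l `<=` [set x | `|x| <= rho] ->
    `|vl (fun x => f x + delta * dot x x) (gbox a r l) - hconst Psi * fine (hmeas (gbox a r l))|
      <= E * r ^+ n.+1 * \prod_j (l j)%:R.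
Proof.
move=> r0 E0 d0 h; apply: gbox_ind.
- move=> a l i li _; rewrite (gbox_empty _ _ li) val0 measure0 mulr0 subr0 normr0.
  by rewrite (prod_eq0 R li) mulr0.
- move=> a sub; have gE : gbox a r (fun=> 1%N) = hbox a (a + const_mx r).
    by congr (hbox a (a + _)); apply/rowP => i; rewrite !mxE mulr1.
  rewrite gE in sub *; rewrite big1 ?mulr1//; apply: h; apply: sub => i.
  by rewrite !mxE lexx ltrDl.
- move=> a l i s t s0 t0 h1 h2 sub; have [gU g0] := gbox_split a l i s t (ltW r0).
  rewrite gU in sub *; rewrite valU ?hmeasU//; try exact: bborel_hbox.
  rewrite prod_updnD [leRHS]mulrDr [hconst _ * _]mulrDr opprD addrACA.
  have {}h1 := h1 (fun x hx => sub x (or_introl hx)).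
  have {}h2 := h2 (fun x hx => sub x (or_intror hx)).
  exact: le_trans (ler_normD _ _) (lerD h1 h2).
Qed.

(** With delta fixed, the mesh tends to 0: the eps part of the cell error and the oscillation of the
    density become negligible relative to the volume, and L delta remains. *)
Lemma val_dybox_delta a b : dyvec a -> dyvec b -> (forall i, a ord0 i <= b ord0 i) ->
  exists L, forall delta, 0 < delta <= 1 ->
  `|vl (fun x => f x + delta * dot x x) (hbox a b) - hconst Psi * fine (hmeas (hbox a b))|
    <= L * delta.
Proof.
move=> da db ab; have [_ /bounded_setP[rho hrho]] := bborel_hbox a b.
have [L L0 hL] := cube_estimate Psi lmu rho cf C2f.
pose K := \prod_i (b ord0 i - a ord0 i).
have K0 : 0 <= K by apply: prodr_ge0 => i _; rewrite subr_ge0.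
exists (L * K) => delta dl; apply/ler_addgt0Pr => eps e0; have /andP[dl0 _] := dl.
have c0 : 0 <= `|hconst Psi| * K by rewrite mulr_ge0.
pose e1 := eps / (K + `|hconst Psi| * K + 1).
have e10 : 0 < e1 by rewrite divr_gt0// ltr_wpDl// addr_ge0.
have [m1 h1] := hL delta e1 dl e10.
have : \forall d \near (0 : R)^'+, 0 < d /\ forall x z : V, `|x| <= rho -> `|z - x| <= d -> `|hdens z - hdens x| <= e1.
  by near=> d; split; near: d; [exact: nbhs_right_gt|apply: unif_cont => //; exact: hdens_continuous].
move=> /filter_ex[d [d0 hd]].
have /cvgrPdist_le/(_ d d0)[m2 _ hm2] := @cvg_hp R.
have [m3 hm3] := dybox_gbox da db ab.
pose m := maxn m1 (maxn m2 m3).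
have [l lE] := hm3 m ltac:(by rewrite /m !leq_max leqnn !orbT).
have h0 := hp_gt0 R m.
have hmd : hp m <= d.
  by have := hm2 m; rewrite /= sub0r normrN gtr0_norm//; apply; rewrite /m !leq_max leqnn !orbT.
have KE : K = hp m ^+ n.+1 * \prod_j (l j)%:R.
  rewrite /K lE; under eq_bigr do rewrite !mxE addrAC subrr add0r.
  by rewrite big_split /= prodr_const card_ord.
pose E := e1 + L * delta + `|hconst Psi| * e1.
have E0 : 0 <= E.
  by apply: addr_ge0; [apply: addr_ge0; [exact: ltW|]|]; apply: mulr_ge0 => //; exact: ltW.
have := @gbox_estimate delta rho (hp m) E h0 E0 (ltW dl0) _ a l.
rewrite /gbox -lE -mulrA -KE => h; apply: le_trans (h _ hrho) _; last first.
  have : e1 * (K + `|hconst Psi| * K) <= eps.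
    apply: le_trans (_ : e1 * (K + `|hconst Psi| * K + 1) <= _); first by rewrite ler_pM2l// lerDl.
    by rewrite divfK// gt_eqF// ltr_wpDl// addr_ge0.
  by rewrite /E; move: (hconst Psi) => c; lra.
move=> x xr; have m1m : (m1 <= m)%N by rewrite /m leq_max leqnn.
have H1 := h1 m x m1m xr.
have H2 := @hmeas_cube x (hp m) e1 (ltW h0) (ltW e10) (fun z hz => hd x z xr (le_trans hz hmd)).
move: H1 H2; rewrite -/(hdens x) /E.
move: (vl _ _) (fine _) (hconst Psi) (hp m ^+ n.+1) => v w c X H1 H2.
have -> : v - c * w = (v - c * hdens x * X) - c * (w - hdens x * X) by ring.
apply: le_trans (ler_normB _ _) _; rewrite [leRHS]mulrDl; apply: lerD => //.
by rewrite normrM -[leRHS]mulrA ler_wpM2l.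
Unshelve. all: by end_near.
Qed.

(** Weak* continuity does not justify delta -> 0 on a fixed box. By [quad_expansion] the value there
    is a polynomial in delta, hence continuous at 0. *)
Lemma val_dybox a b : dyvec a -> dyvec b ->
  vl f (hbox a b) = hconst Psi * fine (hmeas (hbox a b)).
Proof.
move=> da db; have [ab|/existsNP[i /negP]] := pselect (forall i, a ord0 i <= b ord0 i); last first.
  rewrite -ltNge => ba; have -> : hbox a b = set0.
    rewrite -subset0 => x /(_ i)/andP[h1 h2].
    by have := lt_trans (le_lt_trans h1 h2) ba; rewrite ltxx.
  by rewrite val0 measure0 mulr0.
have [L hL] := val_dybox_delta da db ab.
have aPhi : sq_affine (vl^~ (hbox a b)) by move=> g u t cg t0; exact: val_sq_affine.
pose w i := quadcoef (vl^~ (hbox a b)) f (evec R (n := n)) (fun=> 1) i.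
have dotE x : dot x x = quad (evec R (n := n)) (fun=> 1) x.
  by apply: eq_bigr => i _; rewrite mul1r /sq dot_evec expr2.
have vE t : 0 <= t -> vl (fun x => f x + t * dot x x) (hbox a b) = \sum_(i < n.+2) w i * t ^+ i.
  move=> t0; rewrite -(@quad_expansion _ _ (vl^~ (hbox a b)) f (evec R (n := n)) (fun=> 1) t aPhi cf)//.
  by congr (vl _ _); apply/funext => x; rewrite dotE.
have c1 : vl (fun x => f x + hp m * dot x x) (hbox a b) @[m --> \oo] --> vl f (hbox a b).
  have -> : vl f (hbox a b) = \sum_(i < n.+2) w i * 0 ^+ i.
    by rewrite -vE//; congr (vl _ _); apply/funext => x; rewrite mul0r addr0.
  under eq_fun do rewrite vE ?(ltW (hp_gt0 _ _))//.
  apply: cvg_rsum => i _; apply: cvgM; first exact: cvg_cst.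
  exact: (cvg_comp _ _ (@cvg_hp R) (@exprn_continuous R i 0)).
have c2 : vl (fun x => f x + hp m * dot x x) (hbox a b) @[m --> \oo] --> hconst Psi * fine (hmeas (hbox a b)).
  apply/cvgrPdist_le => eps e0.
  have Lh : L * hp m @[m --> \oo] --> (0 : R).
    by rewrite -[0](mulr0 L); apply: cvgM; [exact: cvg_cst|exact: cvg_hp].
  have /cvgrPdist_le/(_ eps e0) := Lh; apply: filterS => m.
  rewrite sub0r normrN => hm; rewrite distrC; apply: le_trans (hL (hp m) _) _.
    by rewrite hp_gt0 hp_le1.
  by apply: le_trans hm; exact: ler_norm.
exact: cvg_unique c1 c2.
Qed.

Lemma val_hessian B : bounded_borel B ->
  vl f B = hconst Psi * Rintegral mu B hdens.
Proof.
move=> bB; rewrite /val.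
by rewrite (sval_dybox_unique (pm_lf Psi f) (nm_lf Psi f) hmeas_lf val_dybox bB).
Qed.

End HessianMeasure.

(** * Real and imaginary parts of a complex valuation *)

Section ComplexParts.
Variables (R : realType) (n : nat).
Notation V := 'rV[R]_n.
Local Open Scope complex_scope.
Implicit Types (m : cradon R n) (B : set V).

Lemma cvalueE m B : cvalue m B = sval (cr1 m) (cr2 m) B +i* sval (cr3 m) (cr4 m) B.
Proof. by rewrite [RHS]complexE. Qed.

Lemma cpairE m phi : cpair m phi = spair (cr1 m) (cr2 m) phi +i* spair (cr3 m) (cr4 m) phi.
Proof. by rewrite [RHS]complexE. Qed.

Lemma realc_mul (t a b : R) : t%:C * (a +i* b) = (t * a) +i* (t * b).
Proof. by apply/eqP; rewrite eq_complex /= !mul0r subr0 addr0 !eqxx. Qed.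

Lemma norm_ReIm_le (z : R[i]) : `|complex.Re z|%:C <= `|z| /\ `|complex.Im z|%:C <= `|z|.
Proof.
case: z => a b; rewrite normc_def /= !lecR -!sqrtr_sqr.
by split; rewrite ler_sqrt ?addr_ge0 ?sqr_ge0// ?lerDl ?lerDr sqr_ge0.
Qed.

Variables (k : nat) (Psi : (V -> R) -> cradon R n) (mPsi : MAVal k Psi) (soPsi : SO_equivariant Psi).

(** [pi] will be the real or the imaginary part. Additivity and real scalars carry over the
    algebraic axioms, and |pi z| <= |z| the convergence. *)
Lemma sMA_part (p q : cradon R n -> {measure set (Rn_borel R n) -> \bar R})
    (pi : {additive R[i] -> R}) :
  (forall m, locally_finite (p m)) -> (forall m, locally_finite (q m)) ->
  (forall m B, sval (p m) (q m) B = pi (cvalue m B)) ->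
  (forall m phi, spair (p m) (q m) phi = pi (cpair m phi)) ->
  (forall (t : R) z, pi (t%:C * z) = t * pi z) -> (forall z, `|pi z|%:C <= `|z|) ->
  exists P : sMA R n k, forall f B, val P f B = pi (cvalue (Psi f) B).
Proof.
move=> lfp lfq svE spE piZ pi_le; have [h1 [h2 [h3 [h4 [h5 h6]]]]] := mPsi.
unshelve refine (ex_intro _ (@SMA R n k (fun f => p (Psi f)) (fun f => q (Psi f))
  (fun f => lfp (Psi f)) (fun f => lfq (Psi f)) _ _ _ _ _ _ _) _); last by move=> f B; exact: svE.
- by move=> f g cf cg cm B bB; rewrite !svE -!raddfD h1.
- move=> fs f cfs cf fsf phi tphi; apply/cvgrPdist_lt => e e0.
  have [N hN] := h2 fs f cfs cf fsf phi tphi e e0; exists N => // j /= /hN hj.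
  by rewrite !spE -raddfB -ltcR; apply: le_lt_trans (pi_le _) _; rewrite distrC.
- by move=> f l cf la B bB; rewrite !svE h3.
- by move=> f g U cf cg oU fg B bB BU; rewrite !svE (h4 f g U).
- by move=> f y cf B bB; rewrite !svE h5.
- by move=> f t cf t0 B bB; rewrite !svE h6.
- by move=> g sg f cf B bB; rewrite !svE soPsi.
Qed.

End ComplexParts.

(** * The one-point space *)

Section DimensionZero.
Variables (R : realType) (k : nat) (Psi : sMA R 0 k).
Notation V := 'rV[R]_0.

(** Every function on a point is constant, so affine invariance reduces to the zero function. For k
    = 0 the density is the empty product 1; for k > 0 it is 0. *)
Lemma val_hessian_dim0 : exists c : R,
  forall mu : {measure set (Rn_borel R 0) -> \bar R}, is_lebesgue_n mu ->
  forall (f : V -> R) (B : set V), bounded_borel B ->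
    val Psi f B = c * Rintegral mu B (fun x => sigma_k k (hessian f x)).
Proof.
exists (val Psi (fun=> 0) setT) => mu lmu f B bB.
have one (x : V) : x = 0 by apply/rowP => -[].
have -> : f = (fun x => 0 + f 0) by apply/funext => x; rewrite add0r (one x).
have af : affine_fun (fun _ : V => f 0) by exists 0, (f 0) => x; rewrite big_ord0 add0r.
rewrite (val_affine Psi (@convex_cst R 0 0) af bB).
have [->|/set0P[x Bx]] := eqVneq B set0; first by rewrite val0 Rintegral_set0 mulr0.
have BT : B = setT by rewrite -subTset => y _; rewrite (one y) -(one x).
have sE (A : 'M[R]_0) : sigma_k k A = (k == 0%N)%:R.
  have eA : eigenvalues_of A (fun=> 0).
    by rewrite /eigenvalues_of /char_poly big_ord0 det_mx00.
  rewrite (sigma_kE k eA) /Defs.esym; case: k => [|k'] /=.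
    by rewrite (big_pred1 finset.set0) ?big_set0// => I; rewrite cards_eq0.
  by apply: esym_gt.
rewrite BT; under eq_Rintegral do rewrite sE.
have muT : mu setT = 1%:E.
  have -> : [set: V] = box 0 0 by apply/seteqP; split=> // y _ [].
  by rewrite lmu ?big_ord0// => -[].
rewrite Rintegral_cst// muT /= mulr1; case: eqP => [_|/eqP kn0]; first by rewrite mulr1.
(* The zero function is twice itself, so for k > 0 homogeneity makes its value vanish. *)
rewrite mulr0; have := @val_homogeneous _ _ _ Psi (fun=> 0) 2 (@convex_cst R 0 0) ltac:(by []) B bB.
rewrite BT; under eq_fun do rewrite mulr0.
move: (val Psi _ _) => v h; have : (2 ^+ k - 1) * v = 0 by rewrite mulrBl -h mul1r subrr.
move/eqP; rewrite mulf_eq0 => /orP[|/eqP//]; rewrite subr_eq0 => /eqP E.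
by move: kn0; rewrite -(@exprn_egt1 R k 2) ?ltr1n// E ltxx.
Qed.

End DimensionZero.

Theorem hessian_representation (R : realType) (n k : nat) (P : sMA R n k) : exists c : R,
  forall mu : {measure set (Rn_borel R n) -> \bar R}, is_lebesgue_n mu ->
  forall f : 'rV[R]_n -> R, convex_fun f -> C2 f ->
  forall B : set 'rV[R]_n, bounded_borel B ->
    val P f B = c * Rintegral mu B (fun x => sigma_k k (hessian f x)).
Proof.
case: n P => [|n] P.
  have [c hc] := val_hessian_dim0 P; exists c => mu lmu f _ _ B bB; exact: hc.
exists (hconst P) => mu lmu f cf C2f B bB; exact: val_hessian.
Qed.

Local Open Scope complex_scope.

Theorem theorem1p5 (R : realType) (n k : nat)
    (Psi : ('rV[R]_n -> R) -> cradon R n) :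
  MAVal k Psi -> SO_equivariant Psi ->
  exists c : R[i],
    forall mu : {measure set (Rn_borel R n) -> \bar R}, is_lebesgue_n mu ->
    forall f : 'rV[R]_n -> R, convex_fun f -> C2 f ->
    forall B : set 'rV[R]_n, bounded_borel B ->
      cvalue (Psi f) B = c * (Rintegral mu B (fun x => sigma_k k (hessian f x)))%:C.
Proof.
move=> mPsi soPsi.
have [||||||P PE] := @sMA_part R n k Psi mPsi soPsi (@cr1 R n) (@cr2 R n) (@complex.Re R).
- exact: cr1_lf.
- exact: cr2_lf.
- by move=> m B; rewrite cvalueE.
- by move=> m phi; rewrite cpairE.
- by move=> t [u v]; rewrite realc_mul.
- by move=> z; have [] := norm_ReIm_le z.
have [||||||Q QE] := @sMA_part R n k Psi mPsi soPsi (@cr3 R n) (@cr4 R n) (@complex.Im R).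
- exact: cr3_lf.
- exact: cr4_lf.
- by move=> m B; rewrite cvalueE.
- by move=> m phi; rewrite cpairE.
- by move=> t [u v]; rewrite realc_mul.
- by move=> z; have [] := norm_ReIm_le z.
have [a ha] := hessian_representation P; have [b hb] := hessian_representation Q.
exists (a +i* b) => mu lmu f cf C2f B bB.
rewrite [LHS]complexE -PE -QE (ha mu lmu f cf C2f B bB) (hb mu lmu f cf C2f B bB).
by rewrite [RHS]mulrC realc_mul ![Rintegral _ _ _ * _]mulrC [RHS]complexE.
Qed.
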